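(* For every $v_0 \in C^1_0$, there exists the maximal existence time $T > 0$ (finite or infinite) and the unique solution $v \in C^1([0,T),C^1_0)$ to the initial-value problem $$v_t = (c - \varphi) v_x + \varphi w - \pi m^2 \bar{v} \sinh(x) + (v|_{x=0} - v) v_x - Q[v], \qquad v|_{t = 0} = v_0,$$ that depends continuously on $v_0 \in C^1_0$. Here $w(t,x) := \int_0^x v(t,y)\,dy$, $\bar v(t) := \frac{1}{2\pi}\int_{-\pi}^{\pi} v(t,y)\,dy$ and $Q[v](x) := \frac{1}{2} \int_{\mathbb{T}} \varphi'(x-y) \left[v^2 + \frac{1}{2} v_x^2\right](y)\, dy$.
   Context: $\mathbb{T} = [-\pi,\pi]$ with periodic boundary conditions at $\pm\pi$. $\varphi(x) = \cosh(\pi - |x|)/\sinh(\pi)$ for $x\in\mathbb{T}$, extended $2\pi$-periodically, $\varphi'$ is its piecewise continuous derivative, $m = 1/\sinh(\pi)$, $c = \varphi(0) = \coth(\pi)$. $C^1_{0} := \{ v \in H^1_{\rm per}(\mathbb{T})\cap W^{1,\infty}(\mathbb{T}) : v_x \in C(\mathbb{T}\setminus \{0\}) \}$. $v|_{x=0}$ denotes $v(t,0)$. The evolution equation is posed for $x\in\mathbb{T}$, piecewise on both sides of the peak at $x=0$.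
   Formalization: As printed, v in C^1([0,T),C^1_0) fails for general v_0 (v_t contains v_x, not Lipschitz). Here v solves the equation pointwise off the peak; C^1 in time in C^1_0 and continuous dependence hold for v along the flow and for the flow; v itself depends continuously in H^1. *)

(* Defs.v *)
From Stdlib Require Import Reals ZArith.
From Coquelicot Require Export Coquelicot.
Open Scope R_scope.

(** Functions on the torus [-PI, PI] are represented by 2*PI-periodic functions
    on [R]; the peak [x = 0] is then the set of integer multiples of [2*PI]. *)

Definition periodic (f : R -> R) : Prop := forall x, f (x + 2 * PI) = f x.

Definition off_peak (x : R) : Prop := forall k : Z, x <> 2 * IZR k * PI.

(** Representative of [x] modulo [2*PI] in [-PI, PI). *)
Definition wrap (x : R) : R := x - 2 * PI * IZR (Int_part ((x + PI) / (2 * PI))).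

Definition phi (x : R) : R := cosh (PI - Rabs (wrap x)) / sinh PI.

Definition m : R := / sinh PI.

Definition c : R := phi 0.

(** The space [C^1_0].  For [f] in [H^1_per] and [W^{1,oo}] take the continuous
    representative; since the weak derivative is continuous off the peak, it is
    the classical derivative there.  Conversely, a continuous [f] which is [C^1]
    off the peak with bounded [f'] is Lipschitz, hence in both Sobolev spaces.
    One-sided limits of [f'] at the peak are not required.  The value of the
    total function [Derive f] at the peak is never relevant. *)
Record C10 (f : R -> R) : Prop := {
  C10_periodic : periodic f;
  C10_continuous : forall x, continuous f x;
  C10_derivable : forall x, off_peak x -> ex_derive f x;
  C10_derive_continuous : forall x, off_peak x -> continuous (Derive f) x;
  C10_derive_bounded : exists B, forall x, off_peak x -> Rabs (Derive f x) <= B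
}.

(** The norm of [f] in [C^1_0] is at most [B]; the norm used is the one of
    [W^{1,oo}], max (sup |f|) (sup |f'|), which on the torus controls [H^1]. *)
Definition C10_norm_le (f : R -> R) (B : R) : Prop :=
  (forall x, Rabs (f x) <= B) /\
  (forall x, off_peak x -> Rabs (Derive f x) <= B).

Definition H1_norm (f : R -> R) : R :=
  sqrt (RInt (fun x => f x ^ 2 + Derive f x ^ 2) (- PI) PI).

Definition mean (f : R -> R) : R := / (2 * PI) * RInt f (- PI) PI.

Definition Q (f : R -> R) (x : R) : R :=
  / 2 * RInt (fun y => Derive phi (x - y) * (f y ^ 2 + / 2 * Derive f y ^ 2))
             (- PI) PI.

(** Right-hand side of the evolution equation, for [x] in [-PI, PI]. *)
Definition rhs (f : R -> R) (x : R) : R :=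
  (c - phi x) * Derive f x + phi x * RInt f 0 x
  - PI * m ^ 2 * mean f * sinh x
  + (f 0 - f x) * Derive f x - Q f x.

(** [T] is finite or [p_infty]. *)
Definition in_time (T : Rbar) (t : R) : Prop := 0 <= t /\ Rbar_lt t T.

(** Derivative on [[0,T)], one-sided at [0]. *)
Definition time_derive (T : Rbar) (g : R -> R) (t l : R) : Prop :=
  filterlim (fun tau => (g tau - g t) / (tau - t))
    (within (fun tau => in_time T tau /\ tau <> t) (locally t)) (locally l).

(** [g] is in [C^1([0,T), C^1_0)], with respect to the norm of [C^1_0]. *)
Definition C1_time_C10 (T : Rbar) (g : R -> R -> R) : Prop :=
  exists g' : R -> R -> R,
    (forall t, in_time T t -> C10 (g t) /\ C10 (g' t)) /\
    (forall t, in_time T t -> forall eps, 0 < eps ->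
       exists delta, 0 < delta /\
       forall tau, in_time T tau -> Rabs (tau - t) < delta ->
         C10_norm_le (fun x => g tau x - g t x - (tau - t) * g' t x)
                     (eps * Rabs (tau - t))) /\
    (forall t, in_time T t -> forall eps, 0 < eps ->
       exists delta, 0 < delta /\
       forall tau, in_time T tau -> Rabs (tau - t) < delta ->
         C10_norm_le (fun x => g' tau x - g' t x) eps).

(** Solutions on [[0,T)] of the initial-value problem: trajectories in [C^1_0],
    bounded in [C^1_0] on compact time intervals, continuous in [(t,x)] and
    [C^1] in [(t,x)] off the peak.  Joint continuity of [v_t] is not listed, as
    it follows from the equation. *)
Record is_solution (v0 : R -> R) (T : Rbar) (v : R -> R -> R) : Prop := {
  sol_C10 : forall t, in_time T t -> C10 (v t);
  sol_bounded : forall T1, in_time T T1 ->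
    exists B, forall t, 0 <= t <= T1 -> C10_norm_le (v t) B;
  sol_continuous : forall t x, in_time T t ->
    filterlim (fun p : R * R => v (fst p) (snd p))
      (within (fun p => in_time T (fst p)) (locally (t, x))) (locally (v t x));
  sol_derive_continuous : forall t x, in_time T t -> off_peak x ->
    filterlim (fun p : R * R => Derive (v (fst p)) (snd p))
      (within (fun p => in_time T (fst p)) (locally (t, x)))
      (locally (Derive (v t) x));
  sol_equation : forall t x, in_time T t -> - PI <= x <= PI -> x <> 0 ->
    time_derive T (fun tau => v tau x) t (rhs (v t) x);
  sol_initial : forall x, v 0 x = v0 x
}.

(** [v] is a solution on [[0,T)], and every solution with the same initial value,
    on any time interval, is a restriction of it.  This is uniqueness of the
    solution together with maximality of [T]. *)
Definition unique_maximal_solution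
    (v0 : R -> R) (T : Rbar) (v : R -> R -> R) : Prop :=
  Rbar_lt 0 T /\ is_solution v0 T v /\
  forall T' u, is_solution v0 T' u ->
    Rbar_le T' T /\ forall t x, in_time T' t -> u t x = v t x.

(** Flow of the transport part of the equation, written as
    [v_t + (phi - c + v - v|_{x=0}) v_x = ...]; the peak is a fixed point. *)
Definition is_flow (T : Rbar) (v X : R -> R -> R) : Prop :=
  (forall s, X 0 s = s) /\
  (forall t s, in_time T t ->
     time_derive T (fun tau => X tau s) t
       (phi (X t s) - c + v t (X t s) - v t 0)).

(** The solution is continuously differentiable in time with values in [C^1_0]
    in the frame moving with the transport velocity.  In the fixed frame this
    fails for general data: there [v_t] contains the term
    [(c - phi + v|_{x=0} - v) v_x], which need not be Lipschitz in [x]. *)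
Definition C1_time_C10_along (T : Rbar) (v X : R -> R -> R) : Prop :=
  is_flow T v X /\
  C1_time_C10 T (fun t s => X t s - s) /\
  C1_time_C10 T (fun t s => v t (X t s)).

(* Main.v *)
(** Let [X] be the flow of the transport part, [X_t = phi(X) - c + V - V|_{s=0}] with
    [V(t,s) = v(t,X(t,s))].  The derivative loss of the term in [v_x] disappears in the variables
    [(X_s - 1, V_s, V|_{s=0})]: on [[0, 2 * PI]] the function [phi] is analytic and [w], [Q] are
    combinations of primitives of [v], [cosh y * (v^2 + v_x^2 / 2)] and [sinh y * (v^2 + v_x^2 / 2)],
    which become integrals in [s].  One gets an autonomous ODE in a space of bounded functions that
    are continuous on [(0, 2 * PI)], with a vector field that is Lipschitz where the unknowns are
    bounded and [X_s] is bounded below.  Picard iteration and Gronwall's inequality give a maximal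
    trajectory depending continuously on its initial value, and [v = V o X^-1] solves the equation.

    Conversely, the flow of an arbitrary solution [u] is continuously differentiable in [s] off the
    peak, and the time derivatives of the difference quotients in [s] of [X] and [u o X] show that
    [u] comes from a trajectory of the same ODE; hence uniqueness and maximality.

    For the [H^1] estimate, [v_x o X] is equicontinuous away from the peak, uniformly on compact time
    intervals, and the contribution of a small neighbourhood of the peak is small by boundedness. *)
Require Import Defs.
From Stdlib Require Import Reals Lra Lia ZArith ClassicalEpsilon FunctionalExtensionality.
Open Scope R_scope.

(** * Bounded functions on an open interval *)

(** No derivative is lost in Lagrangian variables because [phi'' = phi - 2 delta]: differentiating
    [Q] in [x] gives a convolution plus the pointwise term [-(v^2 + v_x^2 / 2)], so the time
    derivative of [V_s] involves only [X], [V], [X_s], [V_s] and integrals of them. The transport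
    velocity vanishes at the peak, hence the labels [[0, 2 * PI]] form an invariant interval and the
    jump of [phi'] is never crossed. Periodicity turns into the closed linear constraints
    [X(2 PI) = 2 PI] and [V(2 PI) = V(0)], whose invariance has to be proved.

    The space [C^1_0] prescribes no one-sided limits of [v_x] at the peak. States are therefore
    controlled only inside the open interval, and one integrates bounded functions with arbitrary
    endpoint values. The same freedom explains the [H^1] norm in the fixed frame: [v_x] may
    oscillate near the peak, so a small change of [X^-1] can change [v_x] by a fixed amount in the
    supremum norm. *)

Lemma Rabs_le_iff (x M : R) : Rabs x <= M <-> - M <= x <= M.
Proof. split; [intros H; apply Rabs_le_between; exact H | intros H; apply Rabs_le; exact H]. Qed.

Lemma Rabs_mult_le (x y A B : R) : Rabs x <= A -> Rabs y <= B -> Rabs (x * y) <= A * B.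
Proof.
  intros Hx Hy; rewrite Rabs_mult.
  apply Rmult_le_compat; auto using Rabs_pos.
Qed.

Lemma Rabs_plus_le (x y A B : R) : Rabs x <= A -> Rabs y <= B -> Rabs (x + y) <= A + B.
Proof. intros Hx Hy; pose proof (Rabs_triang x y); lra. Qed.

Lemma continuous_eps (f : R -> R) (x : R) :
  continuous f x <->
  (forall eps, 0 < eps ->
    exists d, 0 < d /\ forall y, Rabs (y - x) < d -> Rabs (f y - f x) < eps).
Proof.
  split.
  - intros H eps He.
    destruct (proj1 (filterlim_locally f (f x)) H (mkposreal eps He)) as [d Hd].
    exists d; split; [apply cond_pos|]. intros y Hy. apply Hd. exact Hy.
  - intros H. apply filterlim_locally. intros eps.
    destruct (H eps (cond_pos eps)) as [d [Hd0 Hd]].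
    exists (mkposreal d Hd0). intros y Hy. apply Hd. exact Hy.
Qed.

Lemma continuous_lipschitz (f : R -> R) (L x : R) :
  (forall y, Rabs (f y - f x) <= L * Rabs (y - x)) -> continuous f x.
Proof.
  intros H. apply continuous_eps. intros eps He.
  assert (HL : 0 < Rabs L + 1) by (pose proof (Rabs_pos L); lra).
  exists (eps / (Rabs L + 1)). split. { apply Rdiv_lt_0_compat; lra. }
  intros y Hy. eapply Rle_lt_trans; [apply H|].
  apply Rle_lt_trans with ((Rabs L + 1) * Rabs (y - x)).
  - apply Rmult_le_compat_r; [apply Rabs_pos|]. pose proof (Rle_abs L); lra.
  - apply Rmult_lt_compat_l with (r := Rabs L + 1) in Hy; [|lra].
    replace ((Rabs L + 1) * (eps / (Rabs L + 1))) with eps in Hy by (field; lra). exact Hy.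
Qed.

Lemma is_derive_eps (f : R -> R) (x l : R) :
  is_derive f x l ->
  forall eps, 0 < eps -> exists d, 0 < d /\
    forall y, Rabs (y - x) < d -> Rabs (f y - f x - l * (y - x)) <= eps * Rabs (y - x).
Proof.
  intros [_ H] eps He.
  destruct (H x (fun P HP => HP) (mkposreal eps He)) as [d Hd].
  exists d. split; [apply cond_pos|]. intros y Hy.
  generalize (Hd y Hy). unfold norm, minus, plus, opp, scal; simpl.
  unfold abs, mult; simpl. intros H1.
  replace (f y - f x - l * (y - x)) with (f y + - f x + - ((y + - x) * l)) by ring.
  exact H1.
Qed.

Lemma is_derive_of_eps (f : R -> R) (x l : R) :
  (forall eps, 0 < eps -> exists d, 0 < d /\
    forall y, Rabs (y - x) < d -> Rabs (f y - f x - l * (y - x)) <= eps * Rabs (y - x)) ->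
  is_derive f x l.
Proof.
  intros H. apply is_derive_Reals. intros eps He.
  destruct (H (eps / 2)) as [d [Hd0 Hd]]; [lra|].
  exists (mkposreal d Hd0). intros h Hh Hhd. simpl in Hhd.
  assert (Ha : 0 < Rabs h) by (apply Rabs_pos_lt; exact Hh).
  specialize (Hd (x + h)). replace (x + h - x) with h in Hd by ring.
  specialize (Hd Hhd).
  replace ((f (x + h) - f x) / h - l) with ((f (x + h) - f x - l * h) / h) by (field; exact Hh).
  unfold Rdiv. rewrite Rabs_mult, Rabs_inv.
  apply Rmult_lt_reg_r with (Rabs h); [exact Ha|].
  rewrite Rmult_assoc, Rinv_l, Rmult_1_r by lra.
  eapply Rle_lt_trans; [exact Hd|]. apply Rmult_lt_compat_r; lra.
Qed.

Lemma MVT_open (f df : R -> R) (a b : R) :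
  a <= b ->
  (forall x, a < x < b -> is_derive f x (df x)) ->
  (forall x, a <= x <= b -> continuous f x) ->
  a < b -> exists c, a < c < b /\ f b - f a = df c * (b - a).
Proof.
  intros Hab Hd Hc Hlt.
  assert (pr : forall x, a < x < b -> derivable_pt f x).
  { intros x Hx. exists (df x). apply is_derive_Reals, Hd, Hx. }
  destruct (MVT f id a b pr (fun x _ => derivable_pt_id x) Hlt) as [x [Hx H]].
  - intros x Hx. apply continuity_pt_filterlim. apply Hc, Hx.
  - intros x Hx. apply derivable_continuous_pt, derivable_pt_id.
  - exists x. split; [exact Hx|].
    assert (E1 : derive_pt f x (pr x Hx) = df x).
    { rewrite Derive_Reals. apply is_derive_unique, Hd, Hx. }
    assert (E2 : derive_pt id x (derivable_pt_id x) = 1) by apply derive_pt_id.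
    rewrite E1, E2 in H. unfold id in H. lra.
Qed.

Lemma MVT_bound (f df : R -> R) (a b M : R) :
  a <= b ->
  (forall x, a < x < b -> is_derive f x (df x)) ->
  (forall x, a <= x <= b -> continuous f x) ->
  (forall x, a < x < b -> Rabs (df x) <= M) ->
  Rabs (f b - f a) <= M * (b - a).
Proof.
  intros Hab Hd Hc HM. destruct (Req_dec a b) as [E|E].
  - subst b. rewrite !Rminus_diag, Rabs_R0. lra.
  - destruct (MVT_open f df a b Hab Hd Hc) as [x [Hx Hx2]]; [lra|].
    rewrite Hx2, Rabs_mult, (Rabs_right (b - a)) by lra.
    apply Rmult_le_compat_r; [lra | apply HM, Hx].
Qed.

(** The Riemann sums of [f] differ from those of [g] by at most those of [psi], which are small;
    hence they are Cauchy along fine subdivisions, and completeness of the reals gives the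
    integral. *)
Lemma ex_RInt_approx (f : R -> R) (a b : R) :
  a <= b ->
  (forall eps, 0 < eps -> exists (g psi : R -> R) (I : R),
    ex_RInt g a b /\ is_RInt psi a b I /\ I < eps /\
    forall x, a <= x <= b -> Rabs (f x - g x) <= psi x) ->
  ex_RInt f a b.
Proof.
  intros Hab H. destruct (Req_dec a b) as [E|E].
  { subst b. apply ex_RInt_point. }
  assert (Hs : sign (b - a) = 1) by (apply sign_eq_1; lra).
  change (exists y : R_CompleteSpace,
    filterlim (fun ptd => scal (sign (b - a)) (Riemann_sum f ptd)) (Riemann_fine a b) (locally y)).
  refine (proj1 (filterlim_locally_cauchy (F := Riemann_fine a b) _) _).
  intros eps. pose proof (cond_pos eps) as He.
  (* The sums of [g] err by [eps / 8] and those of [psi] stay below [I + eps / 8 < eps / 4]. Each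
     sum of [f] is thus within [3 * eps / 8] of [Ig], and two of them within [eps]. *)
  destruct (H (eps / 8)) as (g & psi & I & [Ig Hg] & Hpsi & HI & Hfg); [lra|].
  assert (He8 : 0 < eps / 8) by lra.
  pose proof (proj1 (filterlim_locally _ _) Hg (mkposreal _ He8)) as Pg.
  pose proof (proj1 (filterlim_locally _ _) Hpsi (mkposreal _ He8)) as Pp.
  assert (Pf : Riemann_fine a b (fun ptd => pointed_subdiv ptd /\ SF_h ptd = Rmin a b /\
     seq.last (SF_h ptd) (SF_lx ptd) = Rmax a b)).
  { exists (mkposreal 1 Rlt_0_1). intros y _ Hy. exact Hy. }
  generalize (filter_and _ _ Pf (filter_and _ _ Pg Pp)). intros HP.
  eexists. split; [exact HP|]. simpl. rewrite Hs.
  assert (key : forall u, (pointed_subdiv u /\ SF_h u = Rmin a b /\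
     seq.last (SF_h u) (SF_lx u) = Rmax a b) /\
     ball Ig (eps / 8) (scal 1 (Riemann_sum g u)) /\
     ball I (eps / 8) (scal 1 (Riemann_sum psi u)) ->
     Rabs (Riemann_sum f u - Ig) < 3 * eps / 8).
  { intros u [[H1 [H2 H3]] [H4 H5]].
    unfold ball, scal in H4, H5; simpl in H4, H5.
    unfold AbsRing_ball, abs, minus, plus, opp, mult in H4, H5; simpl in H4, H5.
    rewrite Rmult_1_l in H4, H5.
    assert (H6 : Rabs (Riemann_sum f u - Riemann_sum g u) <= Riemann_sum psi u).
    { pose proof (Riemann_sum_minus f g u) as Hm.
      unfold minus, plus, opp in Hm; simpl in Hm.
      unfold Rminus. rewrite <- Hm.
      apply (Riemann_sum_norm (fun x => f x + - g x) psi u H1).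
      intros t Ht. rewrite H3, H2, Rmin_left, Rmax_right in Ht by lra.
      apply (Hfg t Ht). }
    apply Rabs_def2 in H4. apply Rabs_def2 in H5.
    apply Rabs_le_iff in H6. apply Rabs_def1; lra. }
  intros u v Hu Hv. apply key in Hu. apply key in Hv.
  apply Rabs_def2 in Hu. apply Rabs_def2 in Hv.
  unfold ball, scal; simpl.
  unfold AbsRing_ball, abs, minus, plus, opp, mult; simpl.
  apply Rabs_def1; lra.
Qed.

Lemma is_RInt_constR (a b v : R) : is_RInt (fun _ => v) a b ((b - a) * v).
Proof. exact (is_RInt_const (V := R_NormedModule) a b v). Qed.

Lemma RInt_split (f : R -> R) (a b c : R) :
  ex_RInt f a b -> ex_RInt f b c -> RInt f a c = RInt f a b + RInt f b c.
Proof. intros H1 H2. symmetry. exact (RInt_Chasles (V := R_CompleteNormedModule) f a b c H1 H2). Qed.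

(** [f] is cut off to zero on two layers of width [h] at the endpoints, where it is only known to be
    bounded; the error function [psi] has integral [2 * h * M]. *)
Lemma ex_RInt_open (f : R -> R) (a b B : R) :
  a <= b ->
  (forall x, a < x < b -> continuous f x) ->
  (forall x, a < x < b -> Rabs (f x) <= B) ->
  ex_RInt f a b.
Proof.
  intros Hab Hc HB. destruct (Req_dec a b) as [E|E].
  { subst b. apply ex_RInt_point. }
  (* The approximation is required on the closed interval, so the bound also covers the arbitrary
     endpoint values. *)
  set (M := Rabs B + Rabs (f a) + Rabs (f b) + 1).
  assert (HM : forall x, a <= x <= b -> Rabs (f x) <= M).
  { intros x Hx. unfold M. pose proof (Rabs_pos B). pose proof (Rle_abs B).
    pose proof (Rabs_pos (f a)). pose proof (Rabs_pos (f b)).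
    destruct (Req_dec x a) as [->|]; [lra|]. destruct (Req_dec x b) as [->|]; [lra|].
    assert (Rabs (f x) <= B) by (apply HB; lra). lra. }
  assert (HM0 : 0 < M).
  { unfold M. pose proof (Rabs_pos B). pose proof (Rabs_pos (f a)).
    pose proof (Rabs_pos (f b)). lra. }
  apply ex_RInt_approx; [exact Hab|]. intros eps He.
  (* The first term keeps the two layers disjoint, the second makes [2 * h * M <= eps / 2]. *)
  set (h := Rmin ((b - a) / 3) (eps / (4 * M))).
  assert (Hh : 0 < h).
  { unfold h. apply Rmin_glb_lt; [lra|]. apply Rdiv_lt_0_compat; lra. }
  assert (Hh1 : h <= (b - a) / 3) by apply Rmin_l.
  assert (Hh2 : h * (4 * M) <= eps).
  { apply Rmult_le_reg_r with (/ (4 * M)); [apply Rinv_0_lt_compat; lra|].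
    rewrite Rmult_assoc, Rinv_r, Rmult_1_r by lra. apply Rmin_r. }
  set (g := fun x => if Rlt_dec x (a + h) then 0 else if Rlt_dec (b - h) x then 0 else f x).
  set (psi := fun x => if Rlt_dec x (a + h) then M else if Rlt_dec (b - h) x then M else 0).
  exists g, psi, (h * M + (0 + h * M)). split; [|split; [|split]].
  - apply ex_RInt_Chasles with (a + h).
    { apply ex_RInt_ext with (fun _ => 0); [|apply ex_RInt_const].
      intros x. rewrite Rmin_left, Rmax_right by lra. intros Hx. unfold g.
      destruct (Rlt_dec x (a + h)); [reflexivity | lra]. }
    apply ex_RInt_Chasles with (b - h).
    { apply ex_RInt_ext with f.
      - intros x. rewrite Rmin_left, Rmax_right by lra. intros Hx. unfold g.
        destruct (Rlt_dec x (a + h)); [lra|]. destruct (Rlt_dec (b - h) x); [lra|reflexivity].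
      - apply (ex_RInt_continuous (V := R_CompleteNormedModule)). intros x. rewrite Rmin_left, Rmax_right by lra. intros Hx.
        apply Hc. lra. }
    apply ex_RInt_ext with (fun _ => 0); [|apply ex_RInt_const].
    intros x. rewrite Rmin_left, Rmax_right by lra. intros Hx. unfold g.
    destruct (Rlt_dec x (a + h)); [reflexivity|]. destruct (Rlt_dec (b - h) x); [reflexivity|lra].
  - apply (is_RInt_Chasles psi a (a + h) b (h * M) (0 + h * M)).
    { replace (h * M) with ((a + h - a) * M) by ring.
      apply is_RInt_ext with (fun _ => M); [|apply is_RInt_constR].
      intros x. rewrite Rmin_left, Rmax_right by lra. intros Hx. unfold psi.
      destruct (Rlt_dec x (a + h)); [reflexivity | lra]. }
    apply (is_RInt_Chasles psi (a + h) (b - h) b 0 (h * M)).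
    { replace 0 with ((b - h - (a + h)) * 0) at 1 by ring.
      apply is_RInt_ext with (fun _ => 0); [|apply is_RInt_constR].
      intros x. rewrite Rmin_left, Rmax_right by lra. intros Hx. unfold psi.
      destruct (Rlt_dec x (a + h)); [lra|]. destruct (Rlt_dec (b - h) x); [lra|reflexivity]. }
    replace (h * M) with ((b - (b - h)) * M) by ring.
    apply is_RInt_ext with (fun _ => M); [|apply is_RInt_constR].
    intros x. rewrite Rmin_left, Rmax_right by lra. intros Hx. unfold psi.
    destruct (Rlt_dec x (a + h)); [reflexivity|]. destruct (Rlt_dec (b - h) x); [reflexivity|lra].
  - lra.
  - intros x Hx. unfold g, psi. specialize (HM x Hx).
    destruct (Rlt_dec x (a + h)); [rewrite Rminus_0_r; exact HM|].
    destruct (Rlt_dec (b - h) x); [rewrite Rminus_0_r; exact HM|].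
    rewrite Rminus_diag, Rabs_R0. lra.
Qed.

Lemma RInt_bound_open (f : R -> R) (a b B : R) :
  a <= b ->
  (forall x, a < x < b -> continuous f x) ->
  (forall x, a < x < b -> Rabs (f x) <= B) ->
  Rabs (RInt f a b) <= B * (b - a).
Proof.
  intros Hab Hc HB.
  pose proof (ex_RInt_open f a b B Hab Hc HB) as Hex.
  assert (H1 : RInt f a b <= RInt (fun _ => B) a b).
  { apply RInt_le; auto. apply ex_RInt_const.
    intros x Hx. specialize (HB x Hx). apply Rabs_le_iff in HB. lra. }
  assert (H2 : RInt (fun _ => - B) a b <= RInt f a b).
  { apply RInt_le; auto. apply ex_RInt_const.
    intros x Hx. specialize (HB x Hx). apply Rabs_le_iff in HB. lra. }
  rewrite RInt_const in H1, H2. unfold scal in H1, H2; simpl in H1, H2.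
  unfold mult in H1, H2; simpl in H1, H2. apply Rabs_le_iff. lra.
Qed.

(** [cb f]: the values of [f] at and beyond the endpoints [0] and [2 * PI] are junk. *)
Definition cb (f : R -> R) : Prop :=
  (forall s, 0 < s < 2 * PI -> continuous f s) /\
  exists B, forall s, 0 < s < 2 * PI -> Rabs (f s) <= B.

Lemma two_PI_pos : 0 < 2 * PI.
Proof. pose proof PI_RGT_0; lra. Qed.

Lemma cb_ex_RInt (f : R -> R) (a b : R) :
  cb f -> 0 <= a <= 2 * PI -> 0 <= b <= 2 * PI -> ex_RInt f a b.
Proof.
  intros [Hc [B HB]] Ha Hb.
  assert (H : forall a b, 0 <= a -> a <= b -> b <= 2 * PI -> ex_RInt f a b).
  { intros a' b' H1 H2 H3. apply ex_RInt_open with B; auto.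
    - intros x Hx. apply Hc. lra.
    - intros x Hx. apply HB. lra. }
  destruct (Rle_dec a b); [apply H; lra|]. apply ex_RInt_swap, H; lra.
Qed.

(** Precomposition with this 1-Lipschitz retraction extends functions given on [[a, b]] to the line,
    so that two-sided continuity is available at the endpoints. *)
Definition clamp (a b x : R) : R := Rmax a (Rmin b x).

Lemma clamp_in (a b x : R) : a <= b -> a <= clamp a b x <= b.
Proof. intros H. unfold clamp, Rmax, Rmin; repeat destruct Rle_dec; lra. Qed.

Lemma clamp_id (a b x : R) : a <= x <= b -> clamp a b x = x.
Proof. intros H. unfold clamp, Rmax, Rmin; repeat destruct Rle_dec; lra. Qed.

Lemma clamp_lip (a b x y : R) : Rabs (clamp a b y - clamp a b x) <= Rabs (y - x).
Proof.
  unfold clamp, Rmax, Rmin; repeat destruct Rle_dec;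
    unfold Rabs; repeat destruct Rcase_abs; lra.
Qed.

Definition prim (f : R -> R) (s : R) : R := RInt f 0 (clamp 0 (2 * PI) s).

Lemma prim_eq (f : R -> R) (s : R) : 0 <= s <= 2 * PI -> prim f s = RInt f 0 s.
Proof. intros H. unfold prim. rewrite clamp_id; auto. Qed.

Lemma prim_0 (f : R -> R) : prim f 0 = 0.
Proof.
  pose proof two_PI_pos. rewrite prim_eq by lra. exact (RInt_point (V := R_CompleteNormedModule) 0 f).
Qed.

Lemma prim_lip (f : R -> R) (B x y : R) :
  (forall s, 0 < s < 2 * PI -> continuous f s) ->
  (forall s, 0 < s < 2 * PI -> Rabs (f s) <= B) ->
  Rabs (prim f y - prim f x) <= B * Rabs (y - x).
Proof.
  intros Hc HB. pose proof two_PI_pos as Hp.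
  assert (HB0 : 0 <= B).
  { eapply Rle_trans; [apply Rabs_pos|]. apply (HB PI). pose proof PI_RGT_0; lra. }
  assert (key : forall x y, 0 <= x -> x <= y -> y <= 2 * PI ->
    Rabs (RInt f 0 y - RInt f 0 x) <= B * (y - x)).
  { intros x' y' H1 H2 H3.
    assert (Hcb : cb f) by (split; [exact Hc | exists B; exact HB]).
    rewrite (RInt_split f 0 x' y') by (apply cb_ex_RInt; auto; lra).
    replace (RInt f 0 x' + RInt f x' y' - RInt f 0 x') with (RInt f x' y') by lra.
    apply RInt_bound_open; auto.
    - intros u Hu; apply Hc; lra.
    - intros u Hu; apply HB; lra. }
  apply Rle_trans with (B * Rabs (clamp 0 (2 * PI) y - clamp 0 (2 * PI) x)).
  2:{ apply Rmult_le_compat_l; [exact HB0 | apply clamp_lip]. }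
  unfold prim.
  pose proof (clamp_in 0 (2 * PI) x ltac:(lra)). pose proof (clamp_in 0 (2 * PI) y ltac:(lra)).
  set (x' := clamp 0 (2 * PI) x) in *. set (y' := clamp 0 (2 * PI) y) in *.
  destruct (Rle_dec x' y').
  - rewrite (Rabs_right (y' - x')) by lra. apply key; lra.
  - rewrite (Rabs_minus_sym y'), (Rabs_minus_sym (RInt f 0 y')), (Rabs_right (x' - y')) by lra.
    apply key; lra.
Qed.

Lemma prim_continuous (f : R -> R) (x : R) : cb f -> continuous (prim f) x.
Proof.
  intros [Hc [B HB]]. apply continuous_lipschitz with B. intros y. apply prim_lip; auto.
Qed.

Lemma locally_between (a b x : R) : a < x < b -> locally x (fun y => a < y < b).
Proof.
  intros H. apply (open_and (fun y => a < y) (fun y => y < b)); [apply open_gt | apply open_lt | exact H].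
Qed.

Lemma prim_derive (f : R -> R) (s : R) : cb f -> 0 < s < 2 * PI -> is_derive (prim f) s (f s).
Proof.
  intros H Hs. apply is_derive_RInt with 0.
  - generalize (locally_between _ _ _ Hs). apply filter_imp. intros y Hy.
    unfold prim. rewrite clamp_id by lra. apply (RInt_correct (V := R_CompleteNormedModule)), cb_ex_RInt; auto; lra.
  - apply (proj1 H s Hs).
Qed.

(** The difference of [prim h] and [H] has zero derivative inside and is continuous up to the
    endpoints, so the endpoint values of [h] cannot matter. *)
Lemma FTC_open (H h : R -> R) (s : R) :
  cb h ->
  (forall x, 0 < x < 2 * PI -> is_derive H x (h x)) ->
  (forall x, continuous H x) ->
  0 <= s <= 2 * PI -> prim h s = H s - H 0.
Proof.
  intros Hcb Hd Hc Hs.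
  assert (E : Rabs ((prim h s - H s) - (prim h 0 - H 0)) <= 0 * (s - 0)).
  { apply (MVT_bound (fun x => prim h x - H x) (fun x => h x - h x)).
    - lra.
    - intros x Hx. apply (is_derive_minus (prim h) H); [apply prim_derive; auto; lra | apply Hd; lra].
    - intros x Hx. apply (continuous_minus (prim h) H); [apply prim_continuous, Hcb | apply Hc].
    - intros x _. rewrite Rminus_diag, Rabs_R0. lra. }
  rewrite Rmult_0_l in E. apply Rabs_le_iff in E. rewrite prim_0 in E. lra.
Qed.

Lemma cb_ext (f g : R -> R) : (forall s, 0 < s < 2 * PI -> f s = g s) -> cb f -> cb g.
Proof.
  intros E [Hc [B HB]]. split.
  - intros s Hs. apply continuous_ext_loc with f; [|apply Hc, Hs].
    generalize (locally_between _ _ _ Hs). apply filter_imp. intros y Hy; apply E, Hy.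
  - exists B. intros s Hs. rewrite <- E by exact Hs. apply HB, Hs.
Qed.

Lemma prim_ext (f g : R -> R) (s : R) :
  (forall x, 0 < x < 2 * PI -> f x = g x) -> prim f s = prim g s.
Proof.
  intros E. unfold prim. pose proof two_PI_pos.
  pose proof (clamp_in 0 (2 * PI) s ltac:(lra)).
  apply RInt_ext. intros x. rewrite Rmin_left, Rmax_right by lra. intros Hx. apply E; lra.
Qed.

(** [Pr t d] says that the modulus [d] is valid at [t]. *)
Lemma compact_uniform (a b : R) (Pr : R -> R -> Prop) :
  (forall t d d', 0 < d' <= d -> Pr t d -> Pr t d') ->
  (forall t, a <= t <= b -> exists r d, 0 < r /\ 0 < d /\
     forall t', a <= t' <= b -> Rabs (t' - t) < r -> Pr t' d) ->
  exists d, 0 < d /\ forall t, a <= t <= b -> Pr t d.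
Proof.
  intros Hmono Hloc.
  assert (H : forall t, exists e : posreal, a <= t <= b ->
     forall t', a <= t' <= b -> Rabs (t' - t) < e -> Pr t' e).
  { intros t. destruct (classic (a <= t <= b)) as [Ht|Ht].
    - destruct (Hloc t Ht) as (r & d & Hr & Hd & Hrd).
      assert (Hm : 0 < Rmin r d) by (apply Rmin_glb_lt; lra).
      exists (mkposreal _ Hm). intros _ t' Ht' Htt. simpl in *.
      apply Hmono with d. split; [exact Hm | apply Rmin_r].
      apply Hrd; auto. eapply Rlt_le_trans; [exact Htt | apply Rmin_l].
    - exists (mkposreal 1 Rlt_0_1). intros Ht'. contradiction. }
  apply choice in H. destruct H as [dl Hdl].
  destruct (compactness_value_1d a b dl) as [d Hd].
  exists d. split; [apply cond_pos|]. intros t Ht.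
  apply NNPP. intros Hn. apply (Hd t Ht). intros (t0 & Ht0 & H1 & H2).
  apply Hn. apply Hmono with (dl t0). { split; [apply cond_pos | exact H2]. }
  apply (Hdl t0); auto.
Qed.

Lemma le_of_le_eps (x y K : R) : (forall eps, 0 < eps -> x <= y + K * eps) -> x <= y.
Proof.
  intros H. destruct (Rle_dec x y) as [h|h]; [exact h|exfalso].
  assert (HK : 0 < 2 * (Rabs K + 1)) by (pose proof (Rabs_pos K); lra).
  assert (He : 0 < (x - y) / (2 * (Rabs K + 1))) by (apply Rdiv_lt_0_compat; lra).
  specialize (H _ He). set (e := (x - y) / (2 * (Rabs K + 1))) in *.
  assert (E : x - y = 2 * (Rabs K + 1) * e) by (unfold e; field; pose proof (Rabs_pos K); lra).
  pose proof (Rle_abs K).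
  assert (K * e <= (Rabs K + 1) * e) by (apply Rmult_le_compat_r; lra).
  nra.
Qed.

Lemma exp_le_compat (x y : R) : x <= y -> exp x <= exp y.
Proof. intros [H| ->]; [left; apply exp_increasing, H | right; reflexivity]. Qed.

Lemma exp_ge_1 (x : R) : 0 <= x -> 1 <= exp x.
Proof. intros H. rewrite <- exp_0. apply exp_le_compat, H. Qed.

(** * Ordinary differential equations in the supremum norm *)

(** Picard limits are taken coordinate by coordinate with [Lim_seq]; this explicit rate is what
    makes them uniform over the coordinates. *)
Lemma geometric_limit (u : nat -> R) (K : R) :
  (forall n, Rabs (u (S n) - u n) <= K / 2 ^ n) ->
  forall n, Rabs (real (Lim_seq u) - u n) <= 2 * K / 2 ^ n.
Proof.
  intros H.
  assert (Hp : forall n, 0 < 2 ^ n) by (intros n; apply pow_lt; lra).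
  (* The subtracted tail makes the bound telescope in the induction on [p]. *)
  assert (H1 : forall n p, Rabs (u (n + p)%nat - u n) <= 2 * K / 2 ^ n - 2 * K / 2 ^ (n + p)).
  { intros n p. induction p as [|p IH].
    - rewrite Nat.add_0_r, Rminus_diag, Rabs_R0. lra.
    - replace (n + S p)%nat with (S (n + p)) by lia.
      replace (u (S (n + p)) - u n) with ((u (S (n + p)) - u (n + p)%nat) + (u (n + p)%nat - u n)) by ring.
      eapply Rle_trans; [apply Rabs_triang|]. specialize (H (n + p)%nat).
      replace (2 * K / 2 ^ S (n + p)) with (K / 2 ^ (n + p)).
      2:{ simpl. field. apply Rgt_not_eq, Hp. }
      replace (2 * K / 2 ^ (n + p)) with (K / 2 ^ (n + p) + K / 2 ^ (n + p)) in IH by (field; apply Rgt_not_eq, Hp).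
      lra. }
  assert (HK : 0 <= K).
  { specialize (H 0%nat). pose proof (Rabs_pos (u 1%nat - u 0%nat)). simpl in H. lra. }
  assert (H2 : forall n p, Rabs (u (n + p)%nat - u n) <= 2 * K / 2 ^ n).
  { intros n p. specialize (H1 n p).
    assert (0 <= 2 * K / 2 ^ (n + p)).
    { apply Rmult_le_pos; [lra|]. left. apply Rinv_0_lt_compat, Hp. } lra. }
  assert (Hex : ex_finite_lim_seq u).
  { apply ex_lim_seq_cauchy_corr. intros eps.
    assert (Hl : is_lim_seq (fun n => 2 * K * (/ 2) ^ n) 0).
    { replace (Finite 0) with (Rbar_mult (2 * K) 0) by (simpl; f_equal; ring).
      apply is_lim_seq_scal_l, is_lim_seq_geom. rewrite Rabs_right; lra. }
    apply is_lim_seq_spec in Hl. destruct (Hl (pos_div_2 eps)) as [N HN].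
    exists N. intros n k Hn Hk.
    specialize (HN N (Nat.le_refl N)). simpl in HN. rewrite Rminus_0_r in HN.
    rewrite pow_inv in HN. fold (Rdiv (2 * K) (2 ^ N)) in HN.
    pose proof (Rle_abs (2 * K / 2 ^ N)).
    pose proof (H2 N (n - N)%nat) as A1. pose proof (H2 N (k - N)%nat) as A2.
    replace (N + (n - N))%nat with n in A1 by lia. replace (N + (k - N))%nat with k in A2 by lia.
    apply Rabs_le_iff in A1. apply Rabs_le_iff in A2. apply Rabs_def1; lra. }
  apply Lim_seq_correct' in Hex. intros n.
  assert (Hl : is_lim_seq (fun p => u (p + n)%nat) (real (Lim_seq u))) by (apply (is_lim_seq_incr_n u n); exact Hex).
  assert (Hb : forall p, u n - 2 * K / 2 ^ n <= u (p + n)%nat <= u n + 2 * K / 2 ^ n).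
  { intros p. specialize (H2 n p). rewrite Nat.add_comm in H2. apply Rabs_le_iff in H2. lra. }
  pose proof (is_lim_seq_le (fun _ => u n - 2 * K / 2 ^ n) _ _ _ (fun p => proj1 (Hb p)) (is_lim_seq_const _) Hl) as B1.
  pose proof (is_lim_seq_le _ (fun _ => u n + 2 * K / 2 ^ n) _ _ (fun p => proj2 (Hb p)) Hl (is_lim_seq_const _)) as B2.
  simpl in B1, B2. apply Rabs_le_iff. lra.
Qed.

Lemma archimed_inv (eps : R) : 0 < eps -> exists N, (0 < N)%nat /\ / INR N < eps.
Proof.
  intros H. destruct (archimed_cor1 eps H) as [N [H1 H2]]. exists N. split; [lia | exact H1].
Qed.

Lemma exp_pow_INR (x : R) (n : nat) : exp x ^ n = exp (INR n * x).
Proof.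
  induction n as [|n IH].
  - simpl. rewrite Rmult_0_l, exp_0. reflexivity.
  - rewrite S_INR. simpl. rewrite IH, <- exp_plus. f_equal. ring.
Qed.

(** * Integrals of Lipschitz functions of time *)

Section Lipschitz_integrand.

Variables (g : R -> R) (K : R).
Hypothesis Hg : forall s t, Rabs (g s - g t) <= K * Rabs (s - t).

Lemma lip_ex_RInt (a b : R) : ex_RInt g a b.
Proof.
  apply (ex_RInt_continuous (V := R_CompleteNormedModule)). intros x _.
  apply continuous_lipschitz with K. intros y. apply Hg.
Qed.

Lemma lip_RInt_diff (a b c : R) : RInt g a c - RInt g a b = RInt g b c.
Proof. rewrite (RInt_split g a b c) by apply lip_ex_RInt. ring. Qed.

Lemma lip_RInt_bound (a b M : R) :
  a <= b -> (forall t, a <= t <= b -> Rabs (g t) <= M) -> Rabs (RInt g a b) <= M * (b - a).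
Proof.
  intros Hab HM. rewrite Rmult_comm. apply abs_RInt_le_const; auto. apply lip_ex_RInt.
Qed.

Lemma lip_RInt_remainder (a b : R) : a <= b -> Rabs (RInt g a b - (b - a) * g a) <= K * (b - a) ^ 2.
Proof.
  intros Hab.
  assert (HK : 0 <= K).
  { pose proof (Hg 1 0) as H. rewrite Rminus_0_r, Rabs_R1 in H.
    pose proof (Rabs_pos (g 1 - g 0)). lra. }
  assert (E : RInt g a b - (b - a) * g a = RInt (fun x => g x - g a) a b).
  { pose proof (RInt_minus (V := R_CompleteNormedModule) g (fun _ => g a) a b (lip_ex_RInt a b)
      (ex_RInt_const a b (g a))) as H.
    rewrite RInt_const in H. unfold minus, plus, opp, scal in H; simpl in H.
    unfold mult in H; simpl in H. symmetry. exact H. }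
  rewrite E. replace (K * (b - a) ^ 2) with ((b - a) * (K * (b - a))) by ring.
  apply abs_RInt_le_const; auto.
  - apply (ex_RInt_minus (V := R_NormedModule)); [apply lip_ex_RInt | apply ex_RInt_const].
  - intros t Ht. eapply Rle_trans; [apply Hg|]. rewrite Rabs_right by lra.
    apply Rmult_le_compat_l; lra.
Qed.

End Lipschitz_integrand.

Section ODE.

Variables (I : Type) (dom : I -> Prop).

(** A distance is expressed by its upper bounds, so no supremum over [dom] is formed; coordinates
    outside [dom] are unconstrained. *)
Definition near (x y : I -> R) (d : R) : Prop := forall i, dom i -> Rabs (x i - y i) <= d.

Lemma near_sym (x y : I -> R) (d : R) : near x y d -> near y x d.
Proof. intros H i Hi. rewrite Rabs_minus_sym. apply H, Hi. Qed.

Lemma near_le (x y : I -> R) (d e : R) : d <= e -> near x y d -> near x y e.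
Proof. intros Hd H i Hi. specialize (H i Hi). lra. Qed.

Lemma near_refl (x : I -> R) (d : R) : 0 <= d -> near x x d.
Proof. intros Hd i Hi. rewrite Rminus_diag, Rabs_R0. exact Hd. Qed.

(** [P] is a closed linear space of states, exhausted by the levels [Om k], on each of which the
    vector field [F] is bounded and Lipschitz for the supremum norm over [dom]. *)
Record vector_field (P : (I -> R) -> Prop) (Om : R -> (I -> R) -> Prop)
    (F : (I -> R) -> I -> R) : Prop := {
  vf_lin : forall f g a, P f -> P g -> P (fun i => f i + a * g i);
  vf_lim : forall f, (forall eps, 0 < eps -> exists g, P g /\ near f g eps) -> P f;
  vf_level : forall k z, Om k z -> P z;
  vf_mono : forall k R' z, k <= R' -> Om k z -> Om R' z;
  vf_tube : forall k, exists r R', 0 < r /\ k <= R' /\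
    forall z z', Om k z -> P z' -> near z' z r -> Om R' z';
  vf_stable : forall k z, Om k z -> P (F z);
  vf_lip : forall k, exists L, 0 < L /\
    (forall z i, Om k z -> dom i -> Rabs (F z i) <= L) /\
    (forall z1 z2 d, Om k z1 -> Om k z2 -> near z1 z2 d -> near (F z1) (F z2) (L * d))
}.

Variables (P : (I -> R) -> Prop) (Om : R -> (I -> R) -> Prop) (F : (I -> R) -> I -> R).
Hypothesis VF : vector_field P Om F.

(** The equation [y' = F y] in the supremum norm, encoded as a quadratic Taylor remainder uniform in
    the coordinate. Such a remainder holds because [F] is Lipschitz along bounded curves, and it is
    convenient for gluing and for the discrete Gronwall argument. *)
Definition traj (k T : R) (y0 : I -> R) (y : R -> I -> R) : Prop :=
  0 <= T /\ (forall i, dom i -> y 0 i = y0 i) /\ (forall t, 0 <= t <= T -> Om k (y t)) /\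
  exists C, forall t u i, 0 <= t -> t <= u -> u <= T -> dom i ->
    Rabs (y u i - y t i - (u - t) * F (y t) i) <= C * (u - t) ^ 2.

(** An integral is a uniform limit of left Riemann sums, which are finite linear combinations of
    elements of [P]; [vf_lin] and [vf_lim] then apply. *)
Lemma P_integral (f0 : I -> R) (g : R -> I -> R) (K t : R) :
  0 <= t -> P f0 -> (forall s, P (g s)) ->
  (forall s u, near (g s) (g u) (K * Rabs (s - u))) ->
  P (fun i => f0 i + RInt (fun s => g s i) 0 t).
Proof.
  intros Ht H0 Hg HK.
  assert (key : forall h n, 0 <= h -> exists f, P f /\
    near (fun i => f0 i + RInt (fun s => g s i) 0 (INR n * h)) f (INR n * K * h ^ 2)).
  { intros h n Hh. induction n as [|n [f [Hf1 Hf2]]].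
    - exists f0. split; [exact H0|]. intros i Hi. simpl. rewrite !Rmult_0_l.
      assert (E : RInt (fun s => g s i) 0 0 = 0)
        by exact (RInt_point (V := R_CompleteNormedModule) 0 (fun s => g s i)).
      rewrite E, Rplus_0_r, Rminus_diag, Rabs_R0. lra.
    - exists (fun i => f i + h * g (INR n * h) i). split; [apply (vf_lin _ _ _ VF); auto|].
      intros i Hi.
      assert (Hl : forall s u, Rabs (g s i - g u i) <= K * Rabs (s - u)) by (intros; apply HK, Hi).
      rewrite (RInt_split _ 0 (INR n * h) (INR (S n) * h)) by (eapply lip_ex_RInt; exact Hl).
      pose proof (lip_RInt_remainder _ _ Hl (INR n * h) (INR (S n) * h)) as B.
      rewrite S_INR in *.
      replace ((INR n + 1) * h - INR n * h) with h in B by ring.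
      specialize (B ltac:(nra)). specialize (Hf2 i Hi).
      set (A1 := RInt _ _ _) in *. set (A2 := RInt _ _ _) in *.
      apply Rabs_le_iff in B. apply Rabs_le_iff in Hf2. apply Rabs_le_iff. lra. }
  apply (vf_lim _ _ _ VF). intros eps He.
  (* With [N] steps of length [t / N] the total error is [K * t ^ 2 / N]. *)
  destruct (archimed_inv (eps / (Rabs K * t ^ 2 + 1))) as [N [HN1 HN2]].
  { apply Rdiv_lt_0_compat; [exact He|]. pose proof (Rabs_pos K). nra. }
  assert (HN : 0 < INR N) by (apply lt_0_INR; exact HN1).
  destruct (key (t / INR N) N) as [f [Hf1 Hf2]].
  { apply Rmult_le_pos; [exact Ht|]. left; apply Rinv_0_lt_compat, HN. }
  exists f. split; [exact Hf1|].
  replace (INR N * (t / INR N)) with t in Hf2 by (field; lra).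
  apply near_le with (2 := Hf2).
  replace (INR N * K * (t / INR N) ^ 2) with (K * t ^ 2 * / INR N) by (field; lra).
  assert (B0 : 0 <= Rabs K * t ^ 2) by (pose proof (Rabs_pos K); nra).
  assert (B1 : K * t ^ 2 * / INR N <= (Rabs K * t ^ 2 + 1) * / INR N).
  { apply Rmult_le_compat_r; [left; apply Rinv_0_lt_compat, HN|].
    pose proof (Rle_abs K). nra. }
  apply Rmult_lt_compat_l with (r := Rabs K * t ^ 2 + 1) in HN2; [|lra].
  replace ((Rabs K * t ^ 2 + 1) * (eps / (Rabs K * t ^ 2 + 1))) with eps in HN2 by (field; lra). lra.
Qed.

(** * Picard iteration on a short time interval *)

Section Picard.

Variables (R1 r L h : R) (y0 : I -> R).
Hypothesis (Hh : 0 <= h) (Hr : 0 < r) (HL : 0 < L) (Hhr : h * L <= r).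
Hypothesis Htube : forall z', P z' -> near z' y0 r -> Om R1 z'.
Hypothesis HLb : forall z i, Om R1 z -> dom i -> Rabs (F z i) <= L.
Hypothesis HLl : forall z1 z2 d, Om R1 z1 -> Om R1 z2 -> near z1 z2 d -> near (F z1) (F z2) (L * d).
Hypothesis HP0 : P y0.

Definition good_curve (y : R -> I -> R) : Prop :=
  (forall t, Om R1 (y t)) /\ forall s t, near (y s) (y t) (L * Rabs (s - t)).

(** Clamping time keeps every iterate a [good_curve] on the whole line, so that the integrand is
    globally Lipschitz. *)
Definition picard_step (y : R -> I -> R) (t : R) (i : I) : R :=
  y0 i + RInt (fun s => F (y s) i) 0 (clamp 0 h t).

Lemma good_curve_lip (y : R -> I -> R) : good_curve y ->
  forall i, dom i -> forall s t, Rabs (F (y s) i - F (y t) i) <= L * L * Rabs (s - t).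
Proof.
  intros [H1 H2] i Hi s t. rewrite Rmult_assoc. apply HLl; auto.
Qed.

Lemma picard_step_near (y : R -> I -> R) : good_curve y -> forall t, near (picard_step y t) y0 (L * h).
Proof.
  intros Hy t i Hi. unfold picard_step.
  pose proof (clamp_in 0 h t Hh) as Hc.
  replace (y0 i + RInt (fun s => F (y s) i) 0 (clamp 0 h t) - y0 i)
    with (RInt (fun s => F (y s) i) 0 (clamp 0 h t) : R) by (symmetry; apply Rplus_minus_l).
  eapply Rle_trans. { apply (lip_RInt_bound _ _ (good_curve_lip y Hy i Hi) 0 _ L); [lra|].
    intros u _. apply HLb; [apply (proj1 Hy) | exact Hi]. }
  nra.
Qed.

Lemma picard_step_good (y : R -> I -> R) : good_curve y -> good_curve (picard_step y).
Proof.
  intros Hy. split.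
  - intros t. apply Htube.
    + unfold picard_step. apply P_integral with (K := L * L); auto.
      * apply clamp_in, Hh.
      * intros s. apply (vf_stable _ _ _ VF) with R1. apply (proj1 Hy).
      * intros s u i Hi. apply (good_curve_lip y Hy i Hi).
    + apply near_le with (L * h); [lra|]. apply picard_step_near, Hy.
  - assert (key : forall s t, s <= t -> 0 <= s -> forall i, dom i ->
      Rabs (RInt (fun u => F (y u) i) 0 t - RInt (fun u => F (y u) i) 0 s) <= L * (t - s)).
    { intros s t Hst Hs i Hi.
      rewrite (lip_RInt_diff _ _ (good_curve_lip y Hy i Hi)).
      apply (lip_RInt_bound _ _ (good_curve_lip y Hy i Hi)); [exact Hst|].
      intros u _. apply HLb; [apply (proj1 Hy) | exact Hi]. }
    intros s t i Hi. unfold picard_step.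
    apply Rle_trans with (L * Rabs (clamp 0 h s - clamp 0 h t)).
    2:{ apply Rmult_le_compat_l; [lra | apply clamp_lip]. }
    pose proof (clamp_in 0 h s Hh) as Hs. pose proof (clamp_in 0 h t Hh) as Ht.
    set (s' := clamp 0 h s) in *. set (t' := clamp 0 h t) in *.
    replace (y0 i + RInt (fun u => F (y u) i) 0 s' - (y0 i + RInt (fun u => F (y u) i) 0 t'))
      with (RInt (fun u => F (y u) i) 0 s' - RInt (fun u => F (y u) i) 0 t') by lra.
    destruct (Rle_dec t' s').
    + rewrite (Rabs_right (s' - t')) by lra. apply key; auto; lra.
    + rewrite (Rabs_minus_sym s'), (Rabs_right (t' - s')), Rabs_minus_sym by lra. apply key; auto; lra.
Qed.

(* The weight [exp (2 * L * t)] makes the Picard map a contraction of ratio [1/2]. *)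
Lemma picard_step_contract (y z : R -> I -> R) (c : R) :
  good_curve y -> good_curve z ->
  (forall t, 0 <= t <= h -> near (y t) (z t) (c * exp (2 * L * t))) ->
  forall t, 0 <= t <= h -> near (picard_step y t) (picard_step z t) (c / 2 * exp (2 * L * t)).
Proof.
  intros Hy Hz Hd t Ht i Hi. unfold picard_step. rewrite clamp_id by exact Ht.
  pose proof (good_curve_lip y Hy i Hi) as Ly. pose proof (good_curve_lip z Hz i Hi) as Lz.
  assert (Ey : ex_RInt (fun s => F (y s) i) 0 t) by (eapply lip_ex_RInt; exact Ly).
  assert (Ez : ex_RInt (fun s => F (z s) i) 0 t) by (eapply lip_ex_RInt; exact Lz).
  replace (y0 i + RInt (fun s => F (y s) i) 0 t - (y0 i + RInt (fun s => F (z s) i) 0 t))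
    with (RInt (fun s => F (y s) i) 0 t - RInt (fun s => F (z s) i) 0 t) by lra.
  pose proof (RInt_minus (V := R_CompleteNormedModule) _ _ 0 t Ey Ez) as E.
  unfold minus, plus, opp in E; simpl in E. unfold Rminus. rewrite <- E.
  assert (Hint : is_RInt (fun s => L * (c * exp (2 * L * s))) 0 t
     (c / 2 * exp (2 * L * t) - c / 2 * exp (2 * L * 0))).
  { apply (is_RInt_derive (V := R_CompleteNormedModule) (fun s => c / 2 * exp (2 * L * s))).
    - intros x _. auto_derive; [exact Logic.I|]. field.
    - intros x _. apply (ex_derive_continuous (V := R_NormedModule)). auto_derive. exact Logic.I. }
  assert (Hc : 0 <= c).
  { specialize (Hd 0 ltac:(lra) i Hi). rewrite Rmult_0_r, exp_0 in Hd.
    pose proof (Rabs_pos (y 0 i - z 0 i)). lra. }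
  apply Rle_trans with (c / 2 * exp (2 * L * t) - c / 2 * exp (2 * L * 0)).
  2:{ rewrite Rmult_0_r, exp_0. lra. }
  apply (norm_RInt_le (V := R_NormedModule) (fun s => F (y s) i + - F (z s) i) _ 0 t _ _ (proj1 Ht)) with (3 := Hint).
  - intros x Hx. unfold norm; simpl. unfold abs; simpl. apply (HLl _ _ _ (proj1 Hy x) (proj1 Hz x)); [|exact Hi].
    apply Hd. lra.
  - apply (RInt_correct (V := R_CompleteNormedModule)).
    apply (ex_RInt_minus (V := R_NormedModule) _ _ _ _ Ey Ez).
Qed.

Fixpoint picard_iter (n : nat) : R -> I -> R :=
  match n with O => fun _ => y0 | S n => picard_step (picard_iter n) end.

Lemma picard_iter_good (n : nat) : good_curve (picard_iter n).
Proof.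
  induction n as [|n IH]; [|apply picard_step_good, IH].
  split; intros.
  - apply Htube; auto. apply near_refl; lra.
  - apply near_refl. apply Rmult_le_pos; [lra | apply Rabs_pos].
Qed.

Definition picard_limit (t : R) (i : I) : R := real (Lim_seq (fun n => picard_iter n (clamp 0 h t) i)).

(** The first step moves by at most [L * h]; the exponential converts the weighted distance, in
    which the map contracts, into the unweighted one. *)
Definition picard_rate : R := L * h * exp (2 * L * h).

Lemma picard_rate_pos : 0 <= picard_rate.
Proof.
  unfold picard_rate. pose proof (exp_pos (2 * L * h)). repeat apply Rmult_le_pos; lra.
Qed.

Lemma picard_limit_near (n : nat) (t : R) :
  near (picard_limit t) (picard_iter n (clamp 0 h t)) (2 * picard_rate / 2 ^ n).
Proof.
  intros i Hi. unfold picard_limit. apply (geometric_limit (fun n => picard_iter n (clamp 0 h t) i)).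
  assert (key : forall n t, 0 <= t <= h ->
     near (picard_iter (S n) t) (picard_iter n t) (L * h / 2 ^ n * exp (2 * L * t))).
  { clear n t. induction n as [|n IH]; intros t Ht.
    - simpl. apply near_le with (L * h); [|apply (picard_step_near (fun _ => y0) (picard_iter_good 0))].
      rewrite Rdiv_1_r. assert (1 <= exp (2 * L * t)) by (apply exp_ge_1; repeat apply Rmult_le_pos; lra).
      assert (0 <= L * h) by (apply Rmult_le_pos; lra). nra.
    - replace (L * h / 2 ^ S n) with (L * h / 2 ^ n / 2) by (simpl; field; apply pow_nonzero; lra).
      apply (picard_step_contract (picard_iter (S n)) (picard_iter n)); auto using picard_iter_good. }
  intros k. pose proof (clamp_in 0 h t Hh) as Hc.
  eapply Rle_trans; [apply (key k _ Hc i Hi)|]. unfold picard_rate.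
  replace (L * h * exp (2 * L * h) / 2 ^ k) with (L * h / 2 ^ k * exp (2 * L * h)) by (unfold Rdiv; ring).
  apply Rmult_le_compat_l.
  - apply Rmult_le_pos; [nra|]. left. apply Rinv_0_lt_compat, pow_lt. lra.
  - apply exp_le_compat, Rmult_le_compat_l; lra.
Qed.

Lemma small_rate (K eps : R) : 0 < eps -> exists n, K / 2 ^ n < eps.
Proof.
  intros He. assert (Hl : is_lim_seq (fun n => K * (/ 2) ^ n) 0).
  { replace (Finite 0) with (Rbar_mult K 0) by (simpl; f_equal; ring).
    apply is_lim_seq_scal_l, is_lim_seq_geom. rewrite Rabs_right; lra. }
  apply is_lim_seq_spec in Hl. destruct (Hl (mkposreal eps He)) as [N HN].
  exists N. specialize (HN N (Nat.le_refl N)). simpl in HN. rewrite Rminus_0_r, pow_inv in HN.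
  pose proof (Rle_abs (K * / 2 ^ N)). unfold Rdiv. lra.
Qed.

Lemma picard_limit_good : good_curve picard_limit.
Proof.
  split.
  - intros t. apply Htube.
    + apply (vf_lim _ _ _ VF). intros eps He. destruct (small_rate (2 * picard_rate) eps He) as [n Hn].
      exists (picard_iter n (clamp 0 h t)). split; [apply (vf_level _ _ _ VF) with R1, picard_iter_good|].
      eapply near_le; [left; exact Hn | apply picard_limit_near].
    + intros i Hi. apply le_of_le_eps with 1. intros eps He.
      destruct (small_rate (2 * picard_rate) eps He) as [n Hn].
      (* The rank [S n] makes the iterate an image of [picard_step], hence within [L * h <= r] of
         [y0]. *)
      pose proof (picard_limit_near (S n) t i Hi) as B1.
      pose proof (picard_step_near _ (picard_iter_good n) (clamp 0 h t) i Hi) as B2.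
      assert (B3 : 2 * picard_rate / 2 ^ S n <= 2 * picard_rate / 2 ^ n).
      { apply Rmult_le_compat_l. { pose proof picard_rate_pos. lra. }
        apply Rinv_le_contravar; [apply pow_lt; lra|]. apply Rle_pow; [lra | lia]. }
      change (picard_step (picard_iter n)) with (picard_iter (S n)) in B2.
      apply Rabs_le_iff in B1. apply Rabs_le_iff in B2. apply Rabs_le_iff. lra.
  - intros s t i Hi. apply le_of_le_eps with 2. intros eps He.
    destruct (small_rate (2 * picard_rate) eps He) as [n Hn].
    pose proof (picard_limit_near n t i Hi) as B1. pose proof (picard_limit_near n s i Hi) as B2.
    pose proof (proj2 (picard_iter_good n) (clamp 0 h s) (clamp 0 h t) i Hi) as B3.
    pose proof (clamp_lip 0 h t s) as B4.
    apply Rmult_le_compat_l with (r := L) in B4; [|lra].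
    apply Rabs_le_iff in B1. apply Rabs_le_iff in B2. apply Rabs_le_iff in B3. apply Rabs_le_iff. lra.
Qed.

(** Both the limit and its image under [picard_step] are within a multiple of [2 ^ (- n)] of the
    iterate of rank [S n], the image by contraction. *)
Lemma picard_limit_fixed (t : R) (i : I) :
  0 <= t <= h -> dom i -> picard_limit t i = y0 i + RInt (fun s => F (picard_limit s) i) 0 t.
Proof.
  intros Ht Hi. apply Rminus_diag_uniq. set (K := 2 * picard_rate * (1 + exp (2 * L * h))).
  set (E := picard_limit t i - _).
  enough (Rabs E <= 0) as B. { apply Rabs_le_iff in B. lra. }
  apply le_of_le_eps with 1. intros eps He.
  pose proof picard_rate_pos as Hr0.
  destruct (small_rate (2 * picard_rate + 2 * picard_rate * exp (2 * L * h)) eps He) as [n Hn].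
  pose proof (picard_limit_near (S n) t i Hi) as B1. rewrite clamp_id in B1 by exact Ht.
  assert (Hp : 0 < 2 ^ n) by (apply pow_lt; lra).
  assert (B2 : near (picard_step picard_limit t) (picard_step (picard_iter n) t)
     (2 * picard_rate / 2 ^ n / 2 * exp (2 * L * t))).
  { apply picard_step_contract; auto using picard_limit_good, picard_iter_good.
    intros u Hu. pose proof (picard_limit_near n u) as B. rewrite clamp_id in B by exact Hu.
    apply near_le with (2 := B).
    assert (1 <= exp (2 * L * u)) by (apply exp_ge_1; repeat apply Rmult_le_pos; lra).
    assert (0 <= 2 * picard_rate / 2 ^ n).
    { apply Rmult_le_pos; [lra|]. left. apply Rinv_0_lt_compat, Hp. } nra. }
  specialize (B2 i Hi). change (picard_step (picard_iter n)) with (picard_iter (S n)) in B2.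
  unfold picard_step in B2. rewrite clamp_id in B2 by exact Ht.
  assert (B3 : exp (2 * L * t) <= exp (2 * L * h)).
  { apply exp_le_compat, Rmult_le_compat_l; lra. }
  assert (B4 : 2 * picard_rate / 2 ^ S n <= 2 * picard_rate / 2 ^ n).
  { apply Rmult_le_compat_l; [lra|].
    apply Rinv_le_contravar; [exact Hp|]. apply Rle_pow; [lra | lia]. }
  assert (B5 : 2 * picard_rate / 2 ^ n / 2 * exp (2 * L * t) <= 2 * picard_rate * exp (2 * L * h) / 2 ^ n).
  { replace (2 * picard_rate * exp (2 * L * h) / 2 ^ n) with (2 * picard_rate / 2 ^ n * exp (2 * L * h))
      by (unfold Rdiv; ring).
    assert (0 <= 2 * picard_rate / 2 ^ n).
    { apply Rmult_le_pos; [lra|]. left. apply Rinv_0_lt_compat, Hp. }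
    pose proof (exp_pos (2 * L * t)). apply Rmult_le_compat; lra. }
  replace ((2 * picard_rate + 2 * picard_rate * exp (2 * L * h)) / 2 ^ n) with
    (2 * picard_rate / 2 ^ n + 2 * picard_rate * exp (2 * L * h) / 2 ^ n) in Hn by (unfold Rdiv; ring).
  unfold E. set (A1 := RInt _ _ _) in *. set (A2 := picard_iter (S n) t i) in *.
  apply Rabs_le_iff in B1. apply Rabs_le_iff in B2. apply Rabs_le_iff. lra.
Qed.

Lemma picard : traj R1 h y0 picard_limit.
Proof.
  pose proof picard_limit_good as Hg.
  split; [exact Hh|]. split; [|split].
  - intros i Hi. rewrite picard_limit_fixed by (auto; lra).
    assert (E : RInt (fun s => F (picard_limit s) i) 0 0 = 0)
      by exact (RInt_point (V := R_CompleteNormedModule) 0 (fun s => F (picard_limit s) i)).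
    rewrite E. ring.
  - intros t _. apply (proj1 Hg).
  - exists (L * L). intros t u i Ht Htu Hu Hi.
    pose proof (good_curve_lip _ Hg i Hi) as Hl.
    rewrite (picard_limit_fixed u), (picard_limit_fixed t) by (auto; lra).
    pose proof (lip_RInt_remainder _ _ Hl t u Htu) as B.
    rewrite <- (lip_RInt_diff _ _ Hl 0) in B.
    match type of B with Rabs ?X <= _ => match goal with |- Rabs ?Y <= _ => replace Y with X by ring end end.
    exact B.
Qed.

End Picard.

(** * Gluing, Gronwall and maximal trajectories *)

Lemma traj_restrict (k T T' : R) (y0 : I -> R) (y : R -> I -> R) :
  traj k T y0 y -> 0 <= T' <= T -> traj k T' y0 y.
Proof.
  intros (H1 & H2 & H3 & C & H4) HT. split; [lra|]. split; [exact H2|]. split.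
  - intros t Ht. apply H3. lra.
  - exists C. intros t u i A1 A2 A3 A4. apply H4; auto. lra.
Qed.

Lemma traj_mono (k R' T : R) (y0 : I -> R) (y : R -> I -> R) :
  k <= R' -> traj k T y0 y -> traj R' T y0 y.
Proof.
  intros HR (H1 & H2 & H3 & H4). split; [exact H1|]. split; [exact H2|]. split; [|exact H4].
  intros t Ht. apply (vf_mono _ _ _ VF) with k; auto.
Qed.

(** The step [h] and the new level depend only on [k], not on the initial state; continuation with a
    fixed step rests on this uniformity. *)
Lemma local_existence (k : R) : exists h R', 0 < h /\ k <= R' /\
  forall y0 h', Om k y0 -> 0 <= h' <= h -> exists y, traj R' h' y0 y.
Proof.
  destruct (vf_tube _ _ _ VF k) as (r & R' & Hr & HR & Ht).
  destruct (vf_lip _ _ _ VF R') as (L & HL & Hb & Hl).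
  exists (r / L), R'. split; [apply Rdiv_lt_0_compat; lra|]. split; [exact HR|].
  intros y0 h' Hy0 Hh'. exists (picard_limit h' y0).
  apply traj_restrict with h'; [|lra].
  apply picard with (r := r) (L := L); auto; try lra.
  - destruct Hh' as [_ Hh']. apply Rmult_le_compat_r with (r := L) in Hh'; [|lra].
    replace (r / L * L) with r in Hh' by (field; lra). exact Hh'.
  - intros z' Hz' Hn. apply Ht with y0; auto.
  - apply (vf_level _ _ _ VF) with k, Hy0.
Qed.

Lemma traj_lip (k T : R) (y0 : I -> R) (y : R -> I -> R) :
  traj k T y0 y -> exists K, 0 <= K /\ forall t u, 0 <= t <= T -> 0 <= u <= T ->
    near (y u) (y t) (K * Rabs (u - t)).
Proof.
  intros (H1 & H2 & H3 & C & H4). destruct (vf_lip _ _ _ VF k) as (L & HL & Hb & Hl).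
  assert (HK : 0 <= L + Rabs C * T) by (pose proof (Rabs_pos C); nra).
  exists (L + Rabs C * T). split; [exact HK|].
  assert (key : forall t u, 0 <= t -> t <= u -> u <= T -> near (y u) (y t) ((L + Rabs C * T) * (u - t))).
  { intros t u A1 A2 A3 i Hi. specialize (H4 t u i A1 A2 A3 Hi).
    assert (B : Rabs ((u - t) * F (y t) i) <= (u - t) * L).
    { apply Rabs_mult_le; [rewrite Rabs_right; lra | apply Hb; auto; apply H3; lra]. }
    assert (B2 : C * (u - t) ^ 2 <= Rabs C * T * (u - t)).
    { replace (C * (u - t) ^ 2) with (C * (u - t) * (u - t)) by ring. pose proof (Rle_abs C).
      pose proof (Rabs_pos C). apply Rmult_le_compat_r; [lra|].
      apply Rle_trans with (Rabs C * (u - t)); [apply Rmult_le_compat_r | apply Rmult_le_compat_l]; lra. }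
    apply Rabs_le_iff in B. apply Rabs_le_iff in H4. apply Rabs_le_iff. lra. }
  intros t u Ht Hu. destruct (Rle_dec t u).
  - rewrite (Rabs_right (u - t)) by lra. apply key; lra.
  - rewrite (Rabs_left (u - t)) by lra. apply near_sym.
    replace (- (u - t)) with (t - u) by ring. apply key; lra.
Qed.

(* The step inequality [e (t + h) <= (1 + L * h) * e t + C * h ^ 2] is iterated [N] times with
   [h = t / N], and [N] is sent to infinity. *)
Lemma gronwall (k T L d : R) (y0 z0 : I -> R) (y z : R -> I -> R) :
  traj k T y0 y -> traj k T z0 z -> 0 < L -> 0 <= d ->
  (forall z1 z2 d, Om k z1 -> Om k z2 -> near z1 z2 d -> near (F z1) (F z2) (L * d)) ->
  near y0 z0 d -> forall t, 0 <= t <= T -> near (y t) (z t) (d * exp (L * t)).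
Proof.
  intros (HT & Hy0 & Hy & C1 & Hy1) (_ & Hz0 & Hz & C2 & Hz1) HL Hd0 Hl Hd t Ht.
  set (C := Rabs C1 + Rabs C2).
  assert (HC : 0 <= C) by (unfold C; pose proof (Rabs_pos C1); pose proof (Rabs_pos C2); lra).
  assert (key : forall h, 0 <= h -> forall n, INR n * h <= T ->
    near (y (INR n * h)) (z (INR n * h)) ((1 + L * h) ^ n * (d + C * h ^ 2 * INR n))).
  { intros h Hh n. induction n as [|n IH]; intros Hn.
    - simpl INR. rewrite Rmult_0_l. intros i Hi. rewrite (Hy0 i Hi), (Hz0 i Hi).
      simpl. specialize (Hd i Hi). lra.
    - rewrite S_INR in *. pose proof (pos_INR n) as Hn0.
      specialize (IH ltac:(nra)). intros i Hi.
      assert (A0 : 0 <= INR n * h) by nra.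
      pose proof (Hl _ _ _ (Hy (INR n * h) ltac:(nra)) (Hz (INR n * h) ltac:(nra)) IH i Hi) as B1.
      pose proof (Hy1 (INR n * h) ((INR n + 1) * h) i A0 ltac:(nra) Hn Hi) as B2.
      pose proof (Hz1 (INR n * h) ((INR n + 1) * h) i A0 ltac:(nra) Hn Hi) as B3.
      specialize (IH i Hi).
      replace ((INR n + 1) * h - INR n * h) with h in B2, B3 by ring.
      set (E := (1 + L * h) ^ n * (d + C * h ^ 2 * INR n)) in *.
      assert (Hpow : 1 <= (1 + L * h) ^ S n) by (apply pow_R1_Rle; nra).
      assert (Hgoal : (1 + L * h) * E + C * h ^ 2 <= (1 + L * h) ^ S n * (d + C * h ^ 2 * (INR n + 1))).
      { unfold E.
        replace ((1 + L * h) ^ S n * (d + C * h ^ 2 * (INR n + 1))) with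
          ((1 + L * h) * ((1 + L * h) ^ n * (d + C * h ^ 2 * INR n)) + (1 + L * h) ^ S n * (C * h ^ 2))
          by (simpl; ring).
        assert (0 <= C * h ^ 2) by (apply Rmult_le_pos; [exact HC | apply pow_le, Hh]). nra. }
      assert (Hh2 : 0 <= h ^ 2) by (apply pow_le, Hh).
      assert (HC12 : C1 * h ^ 2 + C2 * h ^ 2 <= C * h ^ 2).
      { unfold C. pose proof (Rle_abs C1). pose proof (Rle_abs C2). nra. }
      assert (B4 : Rabs (h * (F (y (INR n * h)) i - F (z (INR n * h)) i)) <= h * (L * E)).
      { apply Rabs_mult_le; [rewrite Rabs_right; lra | exact B1]. }
      apply Rabs_le_iff in B2, B3, B4, IH. apply Rabs_le_iff. lra. }
  intros i Hi. apply le_of_le_eps with (C * t ^ 2 * exp (L * t)). intros eps He.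
  destruct (archimed_inv eps He) as [N [HN1 HN2]].
  assert (HN : 0 < INR N) by (apply lt_0_INR; exact HN1).
  assert (Hh : 0 <= t / INR N).
  { apply Rmult_le_pos; [lra|]. left; apply Rinv_0_lt_compat, HN. }
  assert (HE : INR N * (t / INR N) = t) by (field; lra).
  pose proof (key (t / INR N) Hh N ltac:(rewrite HE; lra) i Hi) as B. rewrite HE in B.
  eapply Rle_trans; [exact B|].
  assert (Hpow : (1 + L * (t / INR N)) ^ N <= exp (L * t)).
  { apply Rle_trans with (exp (L * (t / INR N)) ^ N).
    - apply pow_incr. split; [|apply exp_ineq1_le]. nra.
    - right. rewrite exp_pow_INR. f_equal. rewrite <- HE at 2. ring. }
  replace (C * (t / INR N) ^ 2 * INR N) with (C * t ^ 2 * / INR N) by (field; lra).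
  assert (H0 : 0 <= C * t ^ 2) by (apply Rmult_le_pos; [exact HC | apply pow_le; lra]).
  pose proof (Rinv_0_lt_compat _ HN) as HNi.
  assert (0 <= (1 + L * (t / INR N)) ^ N) by (apply pow_le; nra).
  assert (A : C * t ^ 2 * / INR N <= C * t ^ 2 * eps) by (apply Rmult_le_compat_l; lra).
  apply Rle_trans with (exp (L * t) * (d + C * t ^ 2 * eps)); [|right; ring].
  apply Rmult_le_compat; try lra. nra.
Qed.

Lemma traj_unique (k R' T : R) (y0 : I -> R) (y z : R -> I -> R) :
  traj k T y0 y -> traj R' T y0 z -> forall t i, 0 <= t <= T -> dom i -> y t i = z t i.
Proof.
  intros Hy Hz t i Ht Hi.
  apply (traj_mono k (Rmax k R')) in Hy; [|apply Rmax_l].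
  apply (traj_mono R' (Rmax k R')) in Hz; [|apply Rmax_r].
  destruct (vf_lip _ _ _ VF (Rmax k R')) as (L & HL & Hb & Hl).
  pose proof (gronwall _ _ L 0 _ _ _ _ Hy Hz HL (Rle_refl 0) Hl (near_refl _ _ (Rle_refl 0)) t Ht i Hi) as B.
  rewrite Rmult_0_l in B. apply Rabs_le_iff in B. lra.
Qed.

(** A level is a predicate on the whole function, including coordinates outside [dom], where [z] and
    [y] may differ. Membership of [z] is recovered from closedness of [P] and the tube condition. *)
Lemma traj_ext (k T : R) (y0 : I -> R) (y z : R -> I -> R) :
  traj k T y0 y -> (forall t i, 0 <= t <= T -> dom i -> z t i = y t i) ->
  exists R', traj R' T y0 z.
Proof.
  intros (H1 & H2 & H3 & C & H4) E.
  destruct (vf_tube _ _ _ VF k) as (r & R' & Hr & HR & Htube).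
  exists R'. destruct (vf_lip _ _ _ VF R') as (L & HL & Hb & Hl).
  assert (Hn : forall t, 0 <= t <= T -> near (z t) (y t) 0).
  { intros t Ht i Hi. rewrite E, Rminus_diag, Rabs_R0 by auto. lra. }
  assert (Hz : forall t, 0 <= t <= T -> Om R' (z t)).
  { intros t Ht. apply Htube with (y t); auto.
    - apply (vf_lim _ _ _ VF). intros eps He. exists (y t).
      split; [apply (vf_level _ _ _ VF) with k; auto|]. apply near_le with 0; [lra|]. apply Hn, Ht.
    - apply near_le with 0; [lra|]. apply Hn, Ht. }
  split; [exact H1|]. split; [|split; [exact Hz|]].
  - intros i Hi. rewrite E by (auto; lra). apply H2, Hi.
  - exists C. intros t u i A1 A2 A3 Hi. rewrite !E by (auto; lra).
    assert (B : Rabs (F (z t) i - F (y t) i) <= L * 0).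
    { apply Hl; auto; try (apply Hz; lra); try (apply Hn; lra).
      apply (vf_mono _ _ _ VF) with k; auto. apply H3; lra. }
    rewrite Rmult_0_r in B. apply Rabs_le_iff in B.
    replace (F (z t) i) with (F (y t) i) by lra. apply H4; auto.
Qed.

Lemma traj_concat (k T h : R) (y0 : I -> R) (y z : R -> I -> R) :
  traj k T y0 y -> traj k h (y T) z -> exists w, traj k (T + h) y0 w.
Proof.
  intros Hy Hz. destruct (traj_lip _ _ _ _ Hy) as (K & HK & HyK).
  destruct Hy as (H1 & H2 & H3 & C1 & H4). destruct Hz as (G1 & G2 & G3 & C2 & G4).
  destruct (vf_lip _ _ _ VF k) as (L & HL & Hb & Hl).
  set (w := fun t => if Rle_dec t T then y t else z (t - T)).
  assert (W1 : forall t, t <= T -> w t = y t).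
  { intros t Ht. unfold w. destruct (Rle_dec t T); [reflexivity|lra]. }
  assert (W2 : forall t i, T <= t -> dom i -> w t i = z (t - T) i).
  { intros t i Ht Hi. unfold w. destruct (Rle_dec t T); [|reflexivity].
    replace t with T by lra. rewrite Rminus_diag. symmetry. apply G2, Hi. }
  exists w. split; [lra|]. split; [|split].
  - intros i Hi. rewrite W1 by lra. apply H2, Hi.
  - intros t Ht. unfold w. destruct (Rle_dec t T); [apply H3; lra | apply G3; lra].
  - exists (Rabs C1 + Rabs C2 + L * K). intros t u i A1 A2 A3 Hi.
    assert (HC1 := Rle_abs C1). assert (HC2 := Rle_abs C2).
    assert (P1 := Rabs_pos C1). assert (P2 := Rabs_pos C2).
    destruct (Rle_dec u T) as [Hu|Hu]; [|destruct (Rlt_dec T t) as [HtT|HtT]].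
    + rewrite !W1 by lra. eapply Rle_trans; [apply H4; auto|].
      apply Rmult_le_compat_r; [apply pow2_ge_0 | nra].
    + assert (E : w t = z (t - T)) by (unfold w; destruct (Rle_dec t T); [lra|reflexivity]).
      rewrite (W2 u) by (auto; lra). rewrite E.
      pose proof (G4 (t - T) (u - T) i ltac:(lra) ltac:(lra) ltac:(lra) Hi) as B.
      replace (u - T - (t - T)) with (u - t) in B by ring.
      eapply Rle_trans; [exact B|]. apply Rmult_le_compat_r; [apply pow2_ge_0 | nra].
    (* The interval straddles [T]: the remainders on both sides are added, together with the change
       of [F] between [t] and [T]. With [a = u - T] and [b = T - t] this cross term is at most
       [L * K * a * b]. *)
    + rewrite (W2 u) by (auto; lra). rewrite (W1 t) by lra.
      pose proof (G4 0 (u - T) i ltac:(lra) ltac:(lra) ltac:(lra) Hi) as B1.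
      pose proof (H4 t T i ltac:(lra) ltac:(lra) ltac:(lra) Hi) as B2.
      rewrite Rminus_0_r, (G2 i Hi) in B1.
      assert (B3 : Rabs (F (y T) i - F (y t) i) <= L * (K * (T - t))).
      { rewrite <- (Rabs_right (T - t)) by lra. apply Hl; auto; try (apply H3; lra).
        apply HyK; lra. }
      assert (B4 : Rabs (F (z 0) i - F (y T) i) <= L * 0).
      { apply Hl; auto; try (apply H3; lra); try (apply G3; lra).
        intros j Hj. rewrite (G2 j Hj), Rminus_diag, Rabs_R0. lra. }
      rewrite Rmult_0_r in B4. apply Rabs_le_iff in B4.
      replace (F (z 0) i) with (F (y T) i) in B1 by lra.
      assert (B5 : Rabs ((u - T) * (F (y T) i - F (y t) i)) <= (u - T) * (L * (K * (T - t)))).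
      { apply Rabs_mult_le; [rewrite Rabs_right; lra | exact B3]. }
      replace (z (u - T) i - y t i - (u - t) * F (y t) i) with
        ((z (u - T) i - y T i - (u - T) * F (y T) i) + (y T i - y t i - (T - t) * F (y t) i)
         + (u - T) * (F (y T) i - F (y t) i)) by ring.
      set (a := u - T) in *. set (b := T - t) in *. replace (u - t) with (a + b) by (unfold a, b; ring).
      assert (0 <= a) by (unfold a; lra). assert (0 <= b) by (unfold b; lra).
      eapply Rle_trans.
      { apply Rabs_plus_le; [apply Rabs_plus_le|]; [exact B1 | exact B2 | exact B5]. }
      assert (0 <= L * K) by nra. assert (0 <= a * b) by nra.
      assert (Q1 : C2 * a ^ 2 <= Rabs C2 * (a + b) ^ 2).
      { apply Rle_trans with (Rabs C2 * a ^ 2); [apply Rmult_le_compat_r; [apply pow2_ge_0|lra]|].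
        apply Rmult_le_compat_l; [exact P2 | nra]. }
      assert (Q2 : C1 * b ^ 2 <= Rabs C1 * (a + b) ^ 2).
      { apply Rle_trans with (Rabs C1 * b ^ 2); [apply Rmult_le_compat_r; [apply pow2_ge_0|lra]|].
        apply Rmult_le_compat_l; [exact P1 | nra]. }
      assert (Q3 : L * K * (a * b) <= L * K * (a + b) ^ 2) by (apply Rmult_le_compat_l; [lra | nra]).
      lra.
Qed.

(** Extends the remainder to backward increments; moving the base point of [F] from [u] to [t] costs
    the additional [L * K]. *)
Lemma traj_remainder (k T : R) (y0 : I -> R) (y : R -> I -> R) :
  traj k T y0 y -> exists C, 0 <= C /\ forall t u i, 0 <= t <= T -> 0 <= u <= T -> dom i ->
    Rabs (y u i - y t i - (u - t) * F (y t) i) <= C * (u - t) ^ 2.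
Proof.
  intros Hy. destruct (traj_lip _ _ _ _ Hy) as (K & HK & HyK).
  destruct Hy as (H1 & H2 & H3 & C & H4).
  destruct (vf_lip _ _ _ VF k) as (L & HL & Hb & Hl).
  assert (HC := Rle_abs C). assert (HC0 := Rabs_pos C).
  exists (Rabs C + L * K). split; [nra|]. intros t u i Ht Hu Hi.
  pose proof (pow2_ge_0 (u - t)) as Hsq.
  destruct (Rle_dec t u) as [Htu|Htu].
  - eapply Rle_trans; [apply H4; auto; lra|]. apply Rmult_le_compat_r; [exact Hsq | nra].
  - pose proof (H4 u t i ltac:(lra) ltac:(lra) ltac:(lra) Hi) as B1.
    assert (B2 : Rabs (F (y t) i - F (y u) i) <= L * (K * (t - u))).
    { rewrite <- (Rabs_right (t - u)) by lra. apply Hl; auto; try (apply H3; lra); try (apply HyK; lra). }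
    assert (B3 : Rabs ((t - u) * (F (y t) i - F (y u) i)) <= (t - u) * (L * (K * (t - u)))).
    { apply Rabs_mult_le; [rewrite Rabs_right; lra | exact B2]. }
    replace (y u i - y t i - (u - t) * F (y t) i) with
      (- (y t i - y u i - (t - u) * F (y u) i) + (t - u) * (F (y t) i - F (y u) i)) by ring.
    eapply Rle_trans. { apply Rabs_plus_le; [rewrite Rabs_Ropp|]; [exact B1 | exact B3]. }
    replace ((u - t) ^ 2) with ((t - u) ^ 2) in * by ring.
    assert (C * (t - u) ^ 2 <= Rabs C * (t - u) ^ 2) by (apply Rmult_le_compat_r; lra). lra.
Qed.

Lemma traj_zero (k : R) (y0 : I -> R) : Om k y0 -> traj k 0 y0 (fun _ => y0).
Proof.
  intros H. split; [lra|]. split; [reflexivity|]. split; [auto|].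
  exists 0. intros t u i A1 A2 A3 _. replace u with t by lra.
  rewrite !Rminus_diag, !Rmult_0_l, Rminus_diag, Rabs_R0. lra.
Qed.

(** [T] is the supremum of the existence times. It is not attained, since every trajectory can be
    prolonged. The curve [y] is chosen separately at each time and uniqueness makes the choices
    consistent, but only on [dom], whence [traj_ext]. *)
Theorem maximal_trajectory (R0 : R) (y0 : I -> R) :
  Om R0 y0 ->
  exists (T : Rbar) (y : R -> I -> R), Rbar_lt 0 T /\
    (forall T1, in_time T T1 -> exists k, traj k T1 y0 y) /\
    (forall T1 k z, traj k T1 y0 z -> Rbar_lt T1 T).
Proof.
  intros HR0.
  set (E := fun T => exists k z, traj k T y0 z).
  assert (Ext : forall T, E T -> exists h, 0 < h /\ E (T + h)).
  { intros T (k & z & Hz). destruct (local_existence k) as (h & R' & Hh & HRR & Hex).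
    destruct (Hex (z T) h) as [w Hw]. { destruct Hz as (G1 & _ & G & _). apply G; lra. } { lra. }
    exists h. split; [exact Hh|].
    destruct (traj_concat R' T h y0 z w) as [w' Hw']; auto.
    { apply traj_mono with k; auto. } exists R', w'. exact Hw'. }
  assert (E0 : E 0) by (exists R0, (fun _ => y0); apply traj_zero, HR0).
  assert (Hlub := Lub_Rbar_correct E). set (T := Lub_Rbar E) in *.
  assert (Hlt : forall T1, E T1 -> Rbar_lt T1 T).
  { intros T1 H1. destruct (Ext T1 H1) as (h & Hh & H2). apply (proj1 Hlub) in H2.
    eapply Rbar_lt_le_trans; [|exact H2]. simpl. lra. }
  assert (Hin : forall T1, in_time T T1 -> E T1).
  { intros T1 [A1 A2]. apply NNPP. intros Hn.
    apply (Rbar_lt_not_le _ _ A2). apply (proj2 Hlub). intros x Hx. simpl.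
    destruct (Rle_dec x T1) as [h|h]; [exact h|]. exfalso. apply Hn.
    destruct Hx as (k & z & Hz). exists k, z. apply traj_restrict with x; auto. lra. }
  assert (Hch : exists y : R -> I -> R, forall t, E t -> exists k z, traj k t y0 z /\ y t = z t).
  { apply (choice (fun t w => E t -> exists k z, traj k t y0 z /\ w = z t)). intros t.
    destruct (classic (E t)) as [(k & z & Hz)|Hn].
    - exists (z t). intros _. exists k, z. auto.
    - exists y0. intros H. contradiction. }
  destruct Hch as [y Hy].
  exists T, y. split; [apply Hlt, E0|]. split.
  - intros T1 HT1. destruct (Hin T1 HT1) as (k & z & Hz).
    destruct (traj_ext k T1 y0 z y Hz) as [R' HR']; [|exists R'; exact HR'].
    intros t i Ht Hi.
    assert (Hzt : traj k t y0 z) by (apply traj_restrict with T1; auto).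
    destruct (Hy t) as (R2 & z2 & Hz2 & ->); [exists k, z; exact Hzt|].
    apply (traj_unique R2 k t y0 z2 z); auto. lra.
  - intros T1 k z Hz. apply Hlt. exists k, z. exact Hz.
Qed.

(** A bootstrap between two levels: a local step from level [R1] ends at level [R2], and Gronwall at
    level [R2] keeps the perturbed trajectory within [r] of [y], which brings it back to [R1]. The
    factor [exp (- (L * T))] in [delta] pays for Gronwall. The final level is independent of
    [eps]. *)
Theorem continuous_dependence (k T : R) (y0 : I -> R) (y : R -> I -> R) :
  traj k T y0 y -> exists R', k <= R' /\ forall eps, 0 < eps -> exists delta, 0 < delta /\
    forall z0, P z0 -> near z0 y0 delta ->
      exists z, traj R' T z0 z /\ forall t, 0 <= t <= T -> near (z t) (y t) eps.
Proof.
  intros Hy.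
  destruct (vf_tube _ _ _ VF k) as (r & R1 & Hr & HR1 & Htube).
  destruct (local_existence R1) as (h & R2 & Hh & HR2 & Hex).
  destruct (vf_lip _ _ _ VF R2) as (L & HL & Hb & Hl).
  assert (HT : 0 <= T) by apply Hy.
  exists R2. split; [lra|]. intros eps He.
  set (e := Rmin r eps). assert (He0 : 0 < e) by (apply Rmin_glb_lt; lra).
  set (delta := e * exp (- (L * T))).
  assert (Hd0 : 0 < delta) by (apply Rmult_lt_0_compat; [exact He0 | apply exp_pos]).
  assert (Hde : forall t, 0 <= t <= T -> delta * exp (L * t) <= e).
  { intros t Ht. unfold delta. rewrite Rmult_assoc, <- exp_plus.
    rewrite <- (Rmult_1_r e) at 2. apply Rmult_le_compat_l; [lra|]. rewrite <- exp_0.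
    apply exp_le_compat. assert (L * t <= L * T) by (apply Rmult_le_compat_l; lra). lra. }
  exists delta. split; [exact Hd0|]. intros z0 Pz0 Hz0.
  assert (Hy2 : traj R2 T y0 y) by (apply traj_mono with k; auto; lra).
  assert (Hnear : forall T' z, T' <= T -> traj R2 T' z0 z -> forall t, 0 <= t <= T' -> near (z t) (y t) e).
  { intros T' z HT' Hz t Ht. apply near_le with (delta * exp (L * t)); [apply Hde; lra|].
    apply (gronwall R2 T' L delta z0 y0 z y); auto; try lra.
    apply traj_restrict with T; auto. destruct Hz as [? _]. lra. }
  assert (Hlev : forall T' z, T' <= T -> traj R2 T' z0 z -> Om R1 (z T')).
  { intros T' z HT' Hz. assert (0 <= T') by apply Hz.
    apply Htube with (y T').
    - apply Hy. lra.
    - destruct Hz as (_ & _ & G & _). apply (vf_level _ _ _ VF) with R2. apply G. lra.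
    - apply near_le with e; [apply Rmin_l|]. apply Hnear with T'; auto. lra. }
  (* [[0, T]] is covered by [N] steps of length at most [h]; [T + 1] covers the case [T = 0]. *)
  destruct (archimed_inv (h / (T + 1))) as [N [HN1 HN2]]. { apply Rdiv_lt_0_compat; lra. }
  assert (HN : 0 < INR N) by (apply lt_0_INR; exact HN1).
  assert (Hh' : 0 <= T / INR N <= h).
  { split; [apply Rmult_le_pos; [lra|]; left; apply Rinv_0_lt_compat, HN|].
    apply Rmult_lt_compat_l with (r := T + 1) in HN2; [|lra].
    replace ((T + 1) * (h / (T + 1))) with h in HN2 by (field; lra).
    pose proof (Rinv_0_lt_compat _ HN). unfold Rdiv. nra. }
  assert (key : forall n, (n <= N)%nat -> exists z, traj R2 (INR n * (T / INR N)) z0 z).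
  { induction n as [|n IH]; intros Hn.
    - exists (fun _ => z0). simpl INR. rewrite Rmult_0_l. apply traj_zero.
      apply (vf_mono _ _ _ VF) with R1; auto. apply Htube with (y 0); auto.
      + apply Hy. lra.
      + apply near_le with delta; [|intros i Hi; rewrite (proj1 (proj2 Hy) i Hi); apply Hz0, Hi].
        replace delta with (delta * exp (L * 0)).
        2:{ rewrite Rmult_0_r, exp_0. ring. }
        eapply Rle_trans; [apply Hde; lra | apply Rmin_l].
    - destruct IH as [z Hz]; [lia|].
      assert (HnT : INR n * (T / INR N) <= T).
      { replace T with (INR N * (T / INR N)) at 2 by (field; lra).
        apply Rmult_le_compat_r; [lra|]. apply le_INR. lia. }
      destruct (Hex _ (T / INR N) (Hlev _ _ HnT Hz) Hh') as [w Hw].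
      destruct (traj_concat R2 _ _ z0 z w Hz Hw) as [w' Hw'].
      exists w'. rewrite S_INR. replace ((INR n + 1) * (T / INR N)) with (INR n * (T / INR N) + T / INR N) by ring.
      exact Hw'. }
  destruct (key N (Nat.le_refl N)) as [z Hz].
  replace (INR N * (T / INR N)) with T in Hz by (field; lra).
  exists z. split; [exact Hz|]. intros t Ht. apply near_le with e; [apply Rmin_r|].
  apply Hnear with T; auto. lra.
Qed.

End ODE.

Arguments near {I}.
Arguments vector_field {I}.
Arguments traj {I}.

(** * The Lagrangian vector field *)

Lemma is_derive_cosh (x : R) : is_derive cosh x (sinh x).
Proof. apply is_derive_Reals, derivable_pt_lim_cosh. Qed.

Lemma is_derive_sinh (x : R) : is_derive sinh x (cosh x).
Proof. apply is_derive_Reals, derivable_pt_lim_sinh. Qed.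

Lemma continuous_cosh (x : R) : continuous cosh x.
Proof. apply (ex_derive_continuous (V := R_NormedModule)). exists (sinh x). apply is_derive_cosh. Qed.

Lemma continuous_sinh (x : R) : continuous sinh x.
Proof. apply (ex_derive_continuous (V := R_NormedModule)). exists (cosh x). apply is_derive_sinh. Qed.

Lemma cosh_opp (x : R) : cosh (- x) = cosh x.
Proof. unfold cosh. rewrite Ropp_involutive. lra. Qed.

Lemma sinh_opp (x : R) : sinh (- x) = - sinh x.
Proof. unfold sinh. rewrite Ropp_involutive. lra. Qed.

Lemma cosh_plus (x y : R) : cosh (x + y) = cosh x * cosh y + sinh x * sinh y.
Proof. unfold cosh, sinh. rewrite Ropp_plus_distr, !exp_plus. field. Qed.

Lemma sinh_plus (x y : R) : sinh (x + y) = sinh x * cosh y + cosh x * sinh y.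
Proof. unfold cosh, sinh. rewrite Ropp_plus_distr, !exp_plus. field. Qed.

Lemma cosh_sq (x : R) : cosh x ^ 2 = 1 + sinh x ^ 2.
Proof.
  pose proof (cosh_plus x (- x)) as H. rewrite Rplus_opp_r, cosh_0, cosh_opp, sinh_opp in H. lra.
Qed.

Lemma sinh_PI_pos : 0 < sinh PI.
Proof. rewrite <- sinh_0. apply sinh_lt, PI_RGT_0. Qed.

Lemma cosh_bound (x B : R) : Rabs x <= B -> Rabs (cosh x) <= exp B.
Proof.
  intros H. apply Rabs_le_iff in H. unfold cosh.
  pose proof (exp_pos x). pose proof (exp_pos (- x)).
  assert (exp x <= exp B) by (apply exp_le_compat; lra).
  assert (exp (- x) <= exp B) by (apply exp_le_compat; lra). apply Rabs_le_iff. lra.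
Qed.

Lemma sinh_bound (x B : R) : Rabs x <= B -> Rabs (sinh x) <= exp B.
Proof.
  intros H. apply Rabs_le_iff in H. unfold sinh.
  pose proof (exp_pos x). pose proof (exp_pos (- x)).
  assert (exp x <= exp B) by (apply exp_le_compat; lra).
  assert (exp (- x) <= exp B) by (apply exp_le_compat; lra). apply Rabs_le_iff. lra.
Qed.

Lemma lip_of_derive (f df : R -> R) (a b M : R) :
  (forall x, is_derive f x (df x)) ->
  (forall x, Rmin a b <= x <= Rmax a b -> Rabs (df x) <= M) ->
  Rabs (f b - f a) <= M * Rabs (b - a).
Proof.
  intros Hd HM.
  assert (Hc : forall x, continuous f x).
  { intros x. apply (ex_derive_continuous (V := R_NormedModule)). exists (df x). apply Hd. }
  destruct (Rle_dec a b).
  - rewrite Rmin_left, Rmax_right in HM by lra. rewrite (Rabs_right (b - a)) by lra.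
    apply (MVT_bound f df); auto. intros x Hx; apply HM; lra.
  - rewrite Rmin_right, Rmax_left in HM by lra.
    rewrite (Rabs_minus_sym b), (Rabs_minus_sym (f b)), (Rabs_right (a - b)) by lra.
    apply (MVT_bound f df); auto. lra. intros x Hx; apply HM; lra.
Qed.

Lemma cosh_lip (x y B : R) : Rabs x <= B -> Rabs y <= B -> Rabs (cosh x - cosh y) <= exp B * Rabs (x - y).
Proof.
  intros Hx Hy. apply (lip_of_derive cosh sinh); [apply is_derive_cosh|].
  intros u Hu. apply sinh_bound. apply Rabs_le_iff in Hx. apply Rabs_le_iff in Hy. apply Rabs_le_iff.
  unfold Rmin, Rmax in Hu. destruct Rle_dec; lra.
Qed.

Lemma sinh_lip (x y B : R) : Rabs x <= B -> Rabs y <= B -> Rabs (sinh x - sinh y) <= exp B * Rabs (x - y).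
Proof.
  intros Hx Hy. apply (lip_of_derive sinh cosh); [apply is_derive_sinh|].
  intros u Hu. apply cosh_bound. apply Rabs_le_iff in Hx. apply Rabs_le_iff in Hy. apply Rabs_le_iff.
  unfold Rmin, Rmax in Hu. destruct Rle_dec; lra.
Qed.

Lemma cb_plus (f g : R -> R) : cb f -> cb g -> cb (fun s => f s + g s).
Proof.
  intros [Hf [B HB]] [Hg [C HC]]. split.
  - intros s Hs. apply (continuous_plus f g); auto.
  - exists (B + C). intros s Hs. apply Rabs_plus_le; auto.
Qed.

Lemma cb_const (a : R) : cb (fun _ => a).
Proof.
  split; [intros; apply continuous_const|]. exists (Rabs a). intros; lra.
Qed.

Lemma cb_mult (f g : R -> R) : cb f -> cb g -> cb (fun s => f s * g s).
Proof.
  intros [Hf [B HB]] [Hg [C HC]]. split.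
  - intros s Hs. apply (continuous_mult f g); auto.
  - exists (B * C). intros s Hs. apply Rabs_mult_le; auto.
Qed.

Lemma prim_lin (f g : R -> R) (a s : R) : cb f -> cb g ->
  prim (fun x => f x + a * g x) s = prim f s + a * prim g s.
Proof.
  intros Hf Hg. unfold prim. pose proof two_PI_pos.
  pose proof (clamp_in 0 (2 * PI) s ltac:(lra)) as Hc.
  assert (Ef : ex_RInt f 0 (clamp 0 (2 * PI) s)) by (apply cb_ex_RInt; auto; lra).
  assert (Eg : ex_RInt g 0 (clamp 0 (2 * PI) s)) by (apply cb_ex_RInt; auto; lra).
  pose proof (RInt_scal (V := R_CompleteNormedModule) g 0 (clamp 0 (2 * PI) s) a Eg) as H1.
  pose proof (RInt_plus (V := R_CompleteNormedModule) f (fun x => scal a (g x)) _ _ Ef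
    (ex_RInt_scal (V := R_NormedModule) g _ _ a Eg)) as H2.
  refine (eq_trans H2 _). apply (f_equal (Rplus (RInt f 0 (clamp 0 (2 * PI) s)))). exact H1.
Qed.

Lemma prim_bound (f : R -> R) (B s : R) :
  (forall s, 0 < s < 2 * PI -> continuous f s) ->
  (forall s, 0 < s < 2 * PI -> Rabs (f s) <= B) ->
  Rabs (prim f s) <= B * (2 * PI).
Proof.
  intros Hc HB. pose proof PI_RGT_0.
  assert (HB0 : 0 <= B).
  { eapply Rle_trans; [apply Rabs_pos|]. apply (HB PI). lra. }
  pose proof (clamp_in 0 (2 * PI) s ltac:(lra)) as Hcl.
  assert (E : prim f s = prim f (clamp 0 (2 * PI) s)).
  { unfold prim at 2. rewrite (clamp_id _ _ (clamp _ _ _)) by exact Hcl. reflexivity. }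
  pose proof (prim_lip f B 0 (clamp 0 (2 * PI) s) Hc HB) as H0.
  rewrite prim_0, !Rminus_0_r, (Rabs_right (clamp _ _ _)) in H0 by lra.
  rewrite E. eapply Rle_trans; [exact H0|]. apply Rmult_le_compat_l; lra.
Qed.

Lemma prim_near (f g : R -> R) (d s : R) :
  cb f -> cb g -> (forall x, 0 < x < 2 * PI -> Rabs (f x - g x) <= d) ->
  Rabs (prim f s - prim g s) <= d * (2 * PI).
Proof.
  intros Hf Hg Hd.
  replace (prim f s - prim g s) with (prim f s + (-1) * prim g s) by ring.
  rewrite <- prim_lin by assumption. apply prim_bound.
  - intros x Hx. apply (continuous_plus f); [apply (proj1 Hf x Hx)|].
    apply (continuous_mult (fun _ => -1) g); [apply continuous_const | apply (proj1 Hg x Hx)].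
  - intros x Hx. replace (f x + -1 * g x) with (f x - g x) by ring. apply Hd, Hx.
Qed.

(** A Lagrangian state: [cJ s] holds [X_s - 1], [cK s] holds the [s]-derivative of the velocity
    [V = v o X], and [cV] holds [V] at the peak. *)
Inductive coord : Type := cJ (s : R) | cK (s : R) | cV.

Definition cdom (i : coord) : Prop :=
  match i with cJ s | cK s => 0 < s < 2 * PI | cV => True end.

Definition state : Type := coord -> R.

Definition Jc (z : state) (s : R) : R := 1 + z (cJ s).
Definition Kc (z : state) (s : R) : R := z (cK s).
Definition Xc (z : state) (s : R) : R := s + prim (fun r => z (cJ r)) s.
Definition Vc (z : state) (s : R) : R := z cV + prim (Kc z) s.

(** The vanishing integrals say [X(2 PI) = 2 PI] and [V(2 PI) = V(0)], that is, the state closes up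
    on the torus. *)
Definition nice (z : state) : Prop :=
  cb (fun s => z (cJ s)) /\ cb (Kc z) /\
  prim (fun s => z (cJ s)) (2 * PI) = 0 /\ prim (Kc z) (2 * PI) = 0.

(** The lower bound on [X_s] makes the label map bi-Lipschitz and keeps [v_x o X], which is
    [Kc / Jc], bounded. *)
Definition level (k : R) (z : state) : Prop :=
  0 < k /\ nice z /\ (forall i, cdom i -> Rabs (z i) <= k) /\
  forall s, 0 < s < 2 * PI -> / k <= Jc z s.

(** A class of functionals closed under sums, products, smooth composition and primitives. The
    bounds that [vector_field] asks of [field] then follow from the shape of its formula. *)
Definition adm (f : state -> R -> R) : Prop :=
  (forall k, exists B, 0 <= B /\
    (forall z s, level k z -> 0 < s < 2 * PI -> Rabs (f z s) <= B) /\
    (forall z1 z2 d s, level k z1 -> level k z2 -> near cdom z1 z2 d -> 0 < s < 2 * PI ->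
       Rabs (f z1 s - f z2 s) <= B * d)) /\
  (forall k z s, level k z -> 0 < s < 2 * PI -> continuous (f z) s).

Lemma near_nonneg (z1 z2 : state) (d : R) : near cdom z1 z2 d -> 0 <= d.
Proof. intros H. eapply Rle_trans; [apply Rabs_pos | apply (H cV Logic.I)]. Qed.

Lemma adm_cb (f : state -> R -> R) (k : R) (z : state) : adm f -> level k z -> cb (f z).
Proof.
  intros [H1 H2] Hz. split.
  - intros s Hs. apply H2 with k; auto.
  - destruct (H1 k) as (B & _ & HB & _). exists B. intros s Hs. apply HB; auto.
Qed.

Lemma adm_const (a : R) : adm (fun _ _ => a).
Proof.
  split; [|intros; apply continuous_const].
  intros k. exists (Rabs a). split; [apply Rabs_pos|]. split; [intros; lra|].
  intros z1 z2 d s _ _ Hn _. rewrite Rminus_diag, Rabs_R0.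
  apply Rmult_le_pos; [apply Rabs_pos | apply (near_nonneg _ _ _ Hn)].
Qed.

Lemma adm_id : adm (fun _ s => s).
Proof.
  pose proof two_PI_pos. split; [|intros; apply continuous_id].
  intros k. exists (2 * PI). split; [lra|]. split; [intros; apply Rabs_le_iff; lra|].
  intros z1 z2 d s _ _ Hn _. rewrite Rminus_diag, Rabs_R0.
  apply Rmult_le_pos; [lra | apply (near_nonneg _ _ _ Hn)].
Qed.

Lemma adm_coord (c : R -> coord) :
  (forall s, 0 < s < 2 * PI -> cdom (c s)) ->
  (forall z, nice z -> cb (fun s => z (c s))) -> adm (fun z s => z (c s)).
Proof.
  intros H1 H2. split.
  - intros k. exists (Rabs k + 1). split; [pose proof (Rabs_pos k); lra|]. split.
    + intros z s (_ & _ & Hz & _) Hs. pose proof (Hz _ (H1 s Hs)). pose proof (Rle_abs k). lra.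
    + intros z1 z2 d s _ _ Hn Hs. pose proof (near_nonneg _ _ _ Hn).
      pose proof (Hn _ (H1 s Hs)). pose proof (Rabs_pos k). nra.
  - intros k z s (_ & Hz & _) Hs. apply (H2 z Hz). exact Hs.
Qed.

Lemma adm_j : adm (fun z s => z (cJ s)).
Proof. apply adm_coord; [auto | intros z Hz; apply Hz]. Qed.

Lemma adm_K : adm Kc.
Proof. apply (adm_coord cK); [auto | intros z Hz; apply Hz]. Qed.

Lemma adm_V0 : adm (fun z _ => z cV).
Proof. apply (adm_coord (fun _ => cV)); [intros; exact Logic.I | intros; apply cb_const]. Qed.

Lemma adm_plus (f g : state -> R -> R) : adm f -> adm g -> adm (fun z s => f z s + g z s).
Proof.
  intros [Hf Cf] [Hg Cg]. split.
  - intros k. destruct (Hf k) as (B & HB & B1 & B2). destruct (Hg k) as (C & HC & C1 & C2).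
    exists (B + C). split; [lra|]. split.
    + intros z s Hz Hs. apply Rabs_plus_le; auto.
    + intros z1 z2 d s H1 H2 Hn Hs.
      replace (f z1 s + g z1 s - (f z2 s + g z2 s)) with ((f z1 s - f z2 s) + (g z1 s - g z2 s)) by ring.
      rewrite Rmult_plus_distr_r. apply Rabs_plus_le; auto.
  - intros k z s Hz Hs. apply (continuous_plus (f z) (g z)); [apply Cf with k | apply Cg with k]; auto.
Qed.

Lemma adm_mult (f g : state -> R -> R) : adm f -> adm g -> adm (fun z s => f z s * g z s).
Proof.
  intros [Hf Cf] [Hg Cg]. split.
  - intros k. destruct (Hf k) as (B & HB & B1 & B2). destruct (Hg k) as (C & HC & C1 & C2).
    exists (2 * (B * C)). split; [nra|]. split.
    + intros z s Hz Hs. apply Rle_trans with (B * C); [apply Rabs_mult_le; auto | nra].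
    + intros z1 z2 d s H1 H2 Hn Hs.
      replace (f z1 s * g z1 s - f z2 s * g z2 s)
        with ((f z1 s - f z2 s) * g z1 s + f z2 s * (g z1 s - g z2 s)) by ring.
      replace (2 * (B * C) * d) with (B * d * C + B * (C * d)) by ring.
      apply Rabs_plus_le; apply Rabs_mult_le; auto.
  - intros k z s Hz Hs. apply (continuous_mult (f z) (g z)); [apply Cf with k | apply Cg with k]; auto.
Qed.

Lemma adm_opp (f : state -> R -> R) : adm f -> adm (fun z s => - f z s).
Proof.
  intros Hf. apply (adm_mult (fun _ _ => -1)) in Hf; [|apply adm_const].
  replace (fun z s => - f z s) with (fun z s => -1 * f z s); [exact Hf|].
  apply functional_extensionality; intros z; apply functional_extensionality; intros s. ring.
Qed.

Lemma adm_minus (f g : state -> R -> R) : adm f -> adm g -> adm (fun z s => f z s - g z s).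
Proof. intros Hf Hg. apply (adm_plus f (fun z s => - g z s)); [exact Hf | apply adm_opp, Hg]. Qed.

Lemma adm_sq (f : state -> R -> R) : adm f -> adm (fun z s => f z s ^ 2).
Proof.
  intros Hf. replace (fun z s => f z s ^ 2) with (fun z s => f z s * f z s); [apply adm_mult; exact Hf|].
  apply functional_extensionality; intros z; apply functional_extensionality; intros s. ring.
Qed.

Lemma adm_comp (h : R -> R) (f : state -> R -> R) :
  (forall x, continuous h x) ->
  (forall B, exists C, forall x y, Rabs x <= B -> Rabs y <= B ->
     Rabs (h x) <= C /\ Rabs (h x - h y) <= C * Rabs (x - y)) ->
  adm f -> adm (fun z s => h (f z s)).
Proof.
  intros Ch Hh [Hf Cf]. split.
  - intros k. destruct (Hf k) as (B & HB & B1 & B2). destruct (Hh B) as [C HC].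
    assert (C0 : 0 <= C).
    { destruct (HC 0 0) as [H _]; [rewrite Rabs_R0; lra..|]. pose proof (Rabs_pos (h 0)). lra. }
    exists (C + C * B). split; [nra|]. split.
    + intros z s Hz Hs. destruct (HC (f z s) (f z s)) as [H _]; auto. nra.
    + intros z1 z2 d s H1 H2 Hn Hs. destruct (HC (f z1 s) (f z2 s)) as [_ H]; auto.
      eapply Rle_trans; [exact H|]. specialize (B2 _ _ _ _ H1 H2 Hn Hs).
      apply Rle_trans with (C * (B * d)); [apply Rmult_le_compat_l; auto|].
      pose proof (near_nonneg _ _ _ Hn). nra.
  - intros k z s Hz Hs. apply (continuous_comp (f z) h); [apply Cf with k; auto | apply Ch].
Qed.

Lemma adm_cosh (f : state -> R -> R) : adm f -> adm (fun z s => cosh (f z s)).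
Proof.
  apply adm_comp; [apply continuous_cosh|]. intros B. exists (exp B). intros x y Hx Hy.
  split; [apply cosh_bound | apply cosh_lip]; auto.
Qed.

Lemma adm_sinh (f : state -> R -> R) : adm f -> adm (fun z s => sinh (f z s)).
Proof.
  apply adm_comp; [apply continuous_sinh|]. intros B. exists (exp B). intros x y Hx Hy.
  split; [apply sinh_bound | apply sinh_lip]; auto.
Qed.

Lemma adm_J : adm Jc.
Proof. apply adm_plus; [apply adm_const | apply adm_j]. Qed.

Lemma level_J_pos (k : R) (z : state) (s : R) : level k z -> 0 < s < 2 * PI -> 0 < Jc z s.
Proof.
  intros (Hk & _ & _ & Hz) Hs. specialize (Hz s Hs). pose proof (Rinv_0_lt_compat _ Hk). lra.
Qed.

Lemma level_inv_J (k : R) (z : state) (s : R) : level k z -> 0 < s < 2 * PI -> 0 < / Jc z s <= k.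
Proof.
  intros Hz Hs. pose proof (level_J_pos k z s Hz Hs) as HJ.
  destruct Hz as (Hk & _ & _ & Hz). specialize (Hz s Hs).
  split; [apply Rinv_0_lt_compat, HJ|].
  rewrite <- (Rinv_inv k). apply Rinv_le_contravar; [apply Rinv_0_lt_compat, Hk | exact Hz].
Qed.

Lemma adm_inv_J : adm (fun z s => / Jc z s).
Proof.
  split.
  - intros k. exists (Rabs k + k ^ 2). split; [pose proof (Rabs_pos k); nra|]. split.
    + intros z s Hz Hs. destruct (level_inv_J k z s Hz Hs) as [H1 H2].
      rewrite Rabs_right by lra. pose proof (Rle_abs k). nra.
    + intros z1 z2 d s H1 H2 Hn Hs.
      destruct (level_inv_J k z1 s H1 Hs) as [A1 A2]. destruct (level_inv_J k z2 s H2 Hs) as [A3 A4].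
      pose proof (level_J_pos k z1 s H1 Hs). pose proof (level_J_pos k z2 s H2 Hs).
      replace (/ Jc z1 s - / Jc z2 s) with (/ Jc z1 s * / Jc z2 s * (z2 (cJ s) - z1 (cJ s))).
      2:{ unfold Jc in *. field. lra. }
      apply Rle_trans with (k * k * d).
      * apply Rabs_mult_le.
        -- apply Rabs_mult_le; rewrite Rabs_right; lra.
        -- rewrite Rabs_minus_sym. apply Hn. exact Hs.
      * pose proof (near_nonneg _ _ _ Hn). pose proof (Rabs_pos k). nra.
  - intros k z s Hz Hs. apply (continuous_Rinv_comp (Jc z) s).
    + apply (proj2 adm_J k z s Hz Hs).
    + pose proof (level_J_pos k z s Hz Hs). lra.
Qed.

Lemma adm_prim (f : state -> R -> R) : adm f -> adm (fun z s => prim (f z) s).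
Proof.
  intros Hf. pose proof (fun k z => adm_cb f k z Hf) as Hcb. destruct Hf as [Hf Cf].
  pose proof two_PI_pos. split.
  - intros k. destruct (Hf k) as (B & HB & B1 & B2). exists (B * (2 * PI)). split; [nra|]. split.
    + intros z s Hz Hs. apply prim_bound; auto. intros x Hx. apply Cf with k; auto.
    + intros z1 z2 d s H1 H2 Hn Hs. replace (B * (2 * PI) * d) with (B * d * (2 * PI)) by ring.
      apply prim_near; try (apply Hcb with k; assumption). intros x Hx. apply B2; auto.
  - intros k z s Hz Hs. apply prim_continuous, Hcb with k, Hz.
Qed.

(** Separate from [adm_prim] because [adm] speaks only of labels inside the interval, and [2 * PI]
    is an endpoint. *)
Lemma adm_total (f : state -> R -> R) : adm f -> adm (fun z _ => prim (f z) (2 * PI)).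
Proof.
  intros Hf. pose proof (fun k z => adm_cb f k z Hf) as Hcb. destruct Hf as [Hf Cf].
  pose proof two_PI_pos. split.
  - intros k. destruct (Hf k) as (B & HB & B1 & B2). exists (B * (2 * PI)). split; [nra|]. split.
    + intros z s Hz Hs. apply prim_bound; auto. intros x Hx. apply Cf with k; auto.
    + intros z1 z2 d s H1 H2 Hn Hs. replace (B * (2 * PI) * d) with (B * d * (2 * PI)) by ring.
      apply prim_near; try (apply Hcb with k; assumption). intros x Hx. apply B2; auto.
  - intros k z s Hz Hs. apply continuous_const.
Qed.

(** [phiR] is [phi] on [[0, 2 * PI]], continued analytically. *)
Definition phiR (x : R) : R := m * cosh (PI - x).
Definition dphiR (x : R) : R := - m * sinh (PI - x).

(** For [x] in [[0, 2 * PI]], [Qx] is [Q] and [Gx] is the part of the right-hand side without [v_x],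
    written through the primitives [w], [a], [b] at [x] of [v], [cosh y * (v^2 + v_x^2 / 2)] and
    [sinh y * (v^2 + v_x^2 / 2)], and through their values [w1], [a1], [b1] at [2 * PI]. *)
Definition Qx (x a b a1 b1 : R) : R :=
  - cosh x * a + sinh x * b + m / 2 * (sinh (PI + x) * a1 - cosh (PI + x) * b1).
Definition dQx (x a b a1 b1 : R) : R :=
  - sinh x * a + cosh x * b + m / 2 * (cosh (PI + x) * a1 - sinh (PI + x) * b1).
Definition Gx (x w w1 a b a1 b1 : R) : R :=
  phiR x * w - m ^ 2 / 2 * w1 * sinh x - Qx x a b a1 b1.
Definition dGx (x v w w1 a b a1 b1 : R) : R :=
  dphiR x * w + phiR x * v - m ^ 2 / 2 * w1 * cosh x - dQx x a b a1 b1.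

(** [(v^2 + v_x^2 / 2) o X] times [X_s], with [v_x o X] written as [Kc / Jc]. *)
Definition Fc (z : state) (s : R) : R := Vc z s ^ 2 * Jc z s + / 2 * Kc z s ^ 2 * / Jc z s.
Definition Wc (z : state) : R -> R := prim (fun s => Vc z s * Jc z s).
Definition Ac (z : state) : R -> R := prim (fun s => cosh (Xc z s) * Fc z s).
Definition Bc (z : state) : R -> R := prim (fun s => sinh (Xc z s) * Fc z s).

Definition Gc (z : state) (s : R) : R :=
  Gx (Xc z s) (Wc z s) (Wc z (2 * PI)) (Ac z s) (Bc z s) (Ac z (2 * PI)) (Bc z (2 * PI)).
Definition dGc (z : state) (s : R) : R :=
  dGx (Xc z s) (Vc z s) (Wc z s) (Wc z (2 * PI)) (Ac z s) (Bc z s) (Ac z (2 * PI)) (Bc z (2 * PI)).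

(** The first two components are the [s]-derivatives of [phi(X) + V] and of [Gc]; the term [Fc]
    comes from the jump of [phi'] at the peak. At the peak itself the transport term vanishes, which
    leaves [Gc z 0]. *)
Definition field (z : state) (i : coord) : R :=
  match i with
  | cJ s => dphiR (Xc z s) * Jc z s + Kc z s
  | cK s => dGc z s * Jc z s + Fc z s
  | cV => Gc z 0
  end.

Lemma adm_X : adm Xc.
Proof. apply adm_plus; [apply adm_id | apply (adm_prim _ adm_j)]. Qed.

Lemma adm_V : adm Vc.
Proof. apply adm_plus; [apply adm_V0 | apply (adm_prim _ adm_K)]. Qed.

Lemma adm_F : adm Fc.
Proof.
  apply adm_plus.
  - apply adm_mult; [apply adm_sq, adm_V | apply adm_J].
  - apply adm_mult; [|apply adm_inv_J]. apply adm_mult; [apply adm_const | apply adm_sq, adm_K].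
Qed.

Lemma adm_w : adm (fun z s => Vc z s * Jc z s).
Proof. apply adm_mult; [apply adm_V | apply adm_J]. Qed.

Lemma adm_a : adm (fun z s => cosh (Xc z s) * Fc z s).
Proof. apply adm_mult; [apply adm_cosh, adm_X | apply adm_F]. Qed.

Lemma adm_b : adm (fun z s => sinh (Xc z s) * Fc z s).
Proof. apply adm_mult; [apply adm_sinh, adm_X | apply adm_F]. Qed.

Ltac adm_tac :=
  repeat first
    [ apply adm_cosh | apply adm_sinh | apply adm_const | apply adm_X | apply adm_V | apply adm_K | apply adm_J | apply adm_F
    | apply (adm_prim _ adm_w) | apply (adm_prim _ adm_a) | apply (adm_prim _ adm_b)
    | apply (adm_total _ adm_w) | apply (adm_total _ adm_a) | apply (adm_total _ adm_b)
    | apply adm_minus | apply adm_plus | apply adm_mult | apply adm_opp ].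

Lemma adm_G : adm Gc.
Proof. unfold Gc, Gx, Qx, phiR, Rdiv. adm_tac. Qed.

Lemma adm_dG : adm dGc.
Proof. unfold dGc, dGx, dQx, phiR, dphiR, Rdiv. adm_tac. Qed.

Lemma adm_field_J : adm (fun z s => field z (cJ s)).
Proof. unfold field, dphiR. adm_tac. Qed.

Lemma adm_field_K : adm (fun z s => field z (cK s)).
Proof. unfold field. apply adm_plus; [apply adm_mult; [apply adm_dG | apply adm_J] | apply adm_F]. Qed.

(** * Derivatives and periodicity of the vector field *)

Lemma Xc_0 (z : state) : Xc z 0 = 0.
Proof. unfold Xc. rewrite prim_0. ring. Qed.

Lemma Vc_0 (z : state) : Vc z 0 = z cV.
Proof. unfold Vc. rewrite prim_0. ring. Qed.

Lemma adm_field_V : adm (fun z _ => field z cV).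
Proof.
  (* Label [0] is outside the scope of [adm], so the functional is first rewritten as a function of
     the three totals alone. *)
  unfold field, Gc. replace (fun (z : state) (_ : R) => Gx (Xc z 0) (Wc z 0) (Wc z (2 * PI)) (Ac z 0) (Bc z 0) (Ac z (2 * PI)) (Bc z (2 * PI)))
   with (fun (z : state) (_ : R) => Gx 0 0 (Wc z (2 * PI)) 0 0 (Ac z (2 * PI)) (Bc z (2 * PI))).
  2:{ apply functional_extensionality; intros z; apply functional_extensionality; intros s.
      unfold Wc, Ac, Bc. rewrite Xc_0, !prim_0. reflexivity. }
  unfold Gx, Qx, phiR, Rdiv. adm_tac.
Qed.

Lemma Xc_2PI (z : state) : nice z -> Xc z (2 * PI) = 2 * PI.
Proof. intros (_ & _ & H & _). unfold Xc. rewrite H. ring. Qed.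

Lemma Vc_2PI (z : state) : nice z -> Vc z (2 * PI) = z cV.
Proof. intros (_ & _ & _ & H). unfold Vc. rewrite H. ring. Qed.

Lemma Xc_derive (z : state) (s : R) : nice z -> 0 < s < 2 * PI -> is_derive (Xc z) s (Jc z s).
Proof.
  intros (H & _) Hs. apply (is_derive_plus (fun x => x) (prim (fun r => z (cJ r)))).
  - apply (is_derive_id (K := R_AbsRing)).
  - apply (prim_derive (fun r => z (cJ r))); auto.
Qed.

Lemma Vc_derive (z : state) (s : R) : nice z -> 0 < s < 2 * PI -> is_derive (Vc z) s (Kc z s).
Proof.
  intros (_ & H & _) Hs. rewrite <- (Rplus_0_l (Kc z s)).
  apply (is_derive_plus (fun _ => z cV) (prim (Kc z))).
  - apply (is_derive_const (K := R_AbsRing) (V := R_NormedModule)).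
  - apply (prim_derive (Kc z)); auto.
Qed.

Lemma Xc_continuous (z : state) (s : R) : nice z -> continuous (Xc z) s.
Proof.
  intros (H & _). apply (continuous_plus (fun x => x) (prim (fun r => z (cJ r)))).
  - apply continuous_id.
  - apply prim_continuous, H.
Qed.

Lemma Vc_continuous (z : state) (s : R) : nice z -> continuous (Vc z) s.
Proof.
  intros (_ & H & _). apply (continuous_plus (fun _ => z cV) (prim (Kc z))).
  - apply continuous_const.
  - apply prim_continuous, H.
Qed.

Lemma phiR_derive (x : R) : is_derive phiR x (dphiR x).
Proof.
  unfold phiR, dphiR.
  replace (- m * sinh (PI - x)) with (scal m (scal (-1) (sinh (PI - x)))).
  2:{ unfold scal; simpl; unfold mult; simpl. ring. }
  apply (is_derive_scal (fun x => cosh (PI - x))).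
  apply (is_derive_comp cosh (fun x => PI - x)); [apply is_derive_cosh|].
  auto_derive; [exact Logic.I | ring].
Qed.

Lemma dphiR_continuous (x : R) : continuous dphiR x.
Proof.
  apply (ex_derive_continuous (V := R_NormedModule)).
  unfold dphiR, sinh. auto_derive. exact Logic.I.
Qed.

Lemma phiR_continuous (x : R) : continuous phiR x.
Proof. apply (ex_derive_continuous (V := R_NormedModule)). exists (dphiR x). apply phiR_derive. Qed.

Lemma phiR_2PI : phiR (2 * PI) = phiR 0.
Proof.
  unfold phiR. replace (PI - 2 * PI) with (- PI) by ring. rewrite cosh_opp, Rminus_0_r. reflexivity.
Qed.

(** The mean term of the equation cancels exactly the increment of [phi w] over one period, because
    [m * sinh PI = 1]; the rest is the periodicity of [Q]. *)
Lemma Gx_2PI (w a b : R) : Gx (2 * PI) w w a b a b = Gx 0 0 w 0 0 a b.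
Proof.
  unfold Gx, Qx. rewrite phiR_2PI. unfold phiR.
  rewrite sinh_0, cosh_0, Rminus_0_r, Rplus_0_r.
  replace (PI + 2 * PI) with (PI + (PI + PI)) by ring. replace (2 * PI) with (PI + PI) by ring.
  rewrite !sinh_plus, !cosh_plus, !sinh_plus. pose proof sinh_PI_pos as HS. pose proof (cosh_sq PI) as HC.
  assert (Em : m * sinh PI = 1) by (unfold m; field; lra).
  set (S := sinh PI) in *. set (C := cosh PI) in *. generalize dependent m. intros n En.
  assert (E : C * C = 1 + S * S) by (simpl in HC; lra).
  clear HS HC. clearbody S C.
  assert (E1 : n * (S * (C * C + S * S) + C * (S * C + C * S)) = 2 * (C * C + S * S) + n * S).
  { rewrite E. replace (C * (S * C + C * S)) with (2 * S * (C * C)) by ring. rewrite E.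
    transitivity (n * S * (3 + 4 * S * S)); [ring | rewrite En; ring]. }
  assert (E2 : n * (C * (C * C + S * S) + S * (S * C + C * S)) = 4 * S * C + n * C).
  { rewrite E. transitivity (n * C + n * S * (4 * S * C)); [ring | rewrite En; ring]. }
  assert (E3 : n ^ 2 / 2 * w * (S * C + C * S) = n * C * w).
  { transitivity (n * S * (n * C * w)); [field | rewrite En; ring]. }
  rewrite E3. set (u := S * (C * C + S * S) + C * (S * C + C * S)) in *.
  set (v := C * (C * C + S * S) + S * (S * C + C * S)) in *.
  replace (n / 2 * (u * a - v * b)) with ((n * u) * a / 2 - (n * v) * b / 2) by field.
  rewrite E1, E2. field.
Qed.

(* The derivatives of the primitives recombine into [- Fc] because [cosh ^ 2 - sinh ^ 2 = 1]. *)
Lemma Gc_derive (k : R) (z : state) (s : R) :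
  level k z -> 0 < s < 2 * PI -> is_derive (Gc z) s (field z (cK s)).
Proof.
  intros Hz Hs. assert (Hn : nice z) by apply Hz.
  pose proof (Xc_derive z s Hn Hs) as DX.
  pose proof (prim_derive _ s (adm_cb _ k z adm_w Hz) Hs) as DW. fold (Wc z) in DW.
  pose proof (prim_derive _ s (adm_cb _ k z adm_a Hz) Hs) as DA. fold (Ac z) in DA.
  pose proof (prim_derive _ s (adm_cb _ k z adm_b Hz) Hs) as DB. fold (Bc z) in DB.
  simpl in DW, DA, DB.
  assert (Dc : forall l : R -> R, forall dl, is_derive l s dl ->
     is_derive (fun r => cosh (l r)) s (dl * sinh (l s))).
  { intros l dl Hl. apply (is_derive_comp cosh l); [apply is_derive_cosh | exact Hl]. }
  assert (Ds : forall l : R -> R, forall dl, is_derive l s dl ->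
     is_derive (fun r => sinh (l r)) s (dl * cosh (l s))).
  { intros l dl Hl. apply (is_derive_comp sinh l); [apply is_derive_sinh | exact Hl]. }
  assert (DXp : is_derive (fun r => PI + Xc z r) s (Jc z s)).
  { rewrite <- (Rplus_0_l (Jc z s)). apply (is_derive_plus (fun _ => PI) (Xc z)); [|exact DX].
    apply (is_derive_const (K := R_AbsRing) (V := R_NormedModule)). }
  assert (DXm : is_derive (fun r => PI - Xc z r) s (- Jc z s)).
  { rewrite <- (Rminus_0_l (Jc z s)). apply (is_derive_minus (fun _ => PI) (Xc z)); [|exact DX].
    apply (is_derive_const (K := R_AbsRing) (V := R_NormedModule)). }
  unfold field, dGc, dGx, dQx, Gc, Gx, Qx, phiR, dphiR.
  pose proof (cosh_sq (Xc z s)) as E.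
  generalize (Wc z (2 * PI)) (Ac z (2 * PI)) (Bc z (2 * PI)). intros w1 a1 b1.
  (* The hyperbolic factors are made opaque so that [auto_derive] sees a polynomial in functions
     whose derivatives are known. *)
  set (c1 := fun r => cosh (Xc z r)) in *. set (s1 := fun r => sinh (Xc z r)) in *.
  set (c2 := fun r => cosh (PI + Xc z r)) in *. set (s2 := fun r => sinh (PI + Xc z r)) in *.
  set (c3 := fun r => cosh (PI - Xc z r)) in *.
  assert (D1 : is_derive c1 s (Jc z s * s1 s)) by exact (Dc _ _ DX).
  assert (D2 : is_derive s1 s (Jc z s * c1 s)) by exact (Ds _ _ DX).
  assert (D3 : is_derive c2 s (Jc z s * s2 s)) by exact (Dc _ _ DXp).
  assert (D4 : is_derive s2 s (Jc z s * c2 s)) by exact (Ds _ _ DXp).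
  assert (D5 : is_derive c3 s (- Jc z s * sinh (PI - Xc z s))) by exact (Dc _ _ DXm).
  change (is_derive (fun r => m * c3 r * Wc z r - m ^ 2 / 2 * w1 * s1 r -
    (- c1 r * Ac z r + s1 r * Bc z r + m / 2 * (s2 r * a1 - c2 r * b1))) s
    ((- m * sinh (PI - Xc z s) * Wc z s + m * c3 s * Vc z s - m ^ 2 / 2 * w1 * c1 s -
    (- s1 s * Ac z s + c1 s * Bc z s + m / 2 * (c2 s * a1 - s2 s * b1))) * Jc z s + Fc z s)).
  change (cosh (Xc z s)) with (c1 s) in *. change (sinh (Xc z s)) with (s1 s) in *.
  change (cosh (PI + Xc z s)) with (c2 s) in *. change (sinh (PI + Xc z s)) with (s2 s) in *.
  clearbody c1 s1 c2 s2 c3. clear Dc Ds. generalize dependent (Wc z). generalize dependent (Ac z).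
  generalize dependent (Bc z). intros B DB A DA W DW.
  auto_derive.
  - repeat split; eexists; eassumption.
  - rewrite (is_derive_unique (fun r : R => c1 r) _ _ D1), (is_derive_unique (fun r : R => s1 r) _ _ D2), (is_derive_unique (fun r : R => c2 r) _ _ D3),
      (is_derive_unique (fun r : R => s2 r) _ _ D4), (is_derive_unique (fun r : R => c3 r) _ _ D5), (is_derive_unique (fun r : R => W r) _ _ DW),
      (is_derive_unique (fun r : R => A r) _ _ DA), (is_derive_unique (fun r : R => B r) _ _ DB).
    set (f := Fc z s).
    replace f with ((c1 s ^ 2 - s1 s ^ 2) * f) at 3 by (rewrite E; ring). field.
Qed.

Lemma Wc_continuous (k : R) (z : state) (s : R) : level k z -> continuous (Wc z) s.
Proof. intros Hz. apply prim_continuous, (adm_cb _ k z adm_w Hz). Qed.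

Lemma Ac_continuous (k : R) (z : state) (s : R) : level k z -> continuous (Ac z) s.
Proof. intros Hz. apply prim_continuous, (adm_cb _ k z adm_a Hz). Qed.

Lemma Bc_continuous (k : R) (z : state) (s : R) : level k z -> continuous (Bc z) s.
Proof. intros Hz. apply prim_continuous, (adm_cb _ k z adm_b Hz). Qed.

Lemma Gc_continuous (k : R) (z : state) (s : R) : level k z -> continuous (Gc z) s.
Proof.
  intros Hz. assert (Hn : nice z) by apply Hz. unfold Gc, Gx, Qx.
  pose proof (Xc_continuous z s Hn) as CX.
  assert (Cc : forall l : R -> R, continuous l s -> continuous (fun r => cosh (l r)) s).
  { intros l Hl. apply (continuous_comp l cosh); [exact Hl | apply continuous_cosh]. }
  assert (Cs : forall l : R -> R, continuous l s -> continuous (fun r => sinh (l r)) s).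
  { intros l Hl. apply (continuous_comp l sinh); [exact Hl | apply continuous_sinh]. }
  assert (CXp : continuous (fun r => PI + Xc z r) s).
  { apply (continuous_plus (fun _ => PI) (Xc z)); [apply continuous_const | exact CX]. }
  assert (K0 : forall a : R, continuous (fun _ : R => a) s) by (intros; apply continuous_const).
  assert (Mu : forall f g : R -> R, continuous f s -> continuous g s -> continuous (fun r => f r * g r) s).
  { intros f g. apply (continuous_mult f g). }
  assert (Pl : forall f g : R -> R, continuous f s -> continuous g s -> continuous (fun r => f r + g r) s).
  { intros f g. apply (continuous_plus f g). }
  assert (Mi : forall f g : R -> R, continuous f s -> continuous g s -> continuous (fun r => f r - g r) s).
  { intros f g. apply (continuous_minus f g). }
  assert (Op : forall f : R -> R, continuous f s -> continuous (fun r => - f r) s).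
  { intros f. apply (continuous_opp f). }
  pose proof (Wc_continuous k z s Hz) as CW. pose proof (Ac_continuous k z s Hz) as CA.
  pose proof (Bc_continuous k z s Hz) as CB.
  apply Mi; [apply Mi|apply Pl; [apply Pl|]].
  - apply Mu; [|exact CW]. apply (continuous_comp (Xc z) phiR); [exact CX | apply phiR_continuous].
  - apply Mu; [apply K0 | apply Cs, CX].
  - apply Mu; [apply Op, Cc, CX | exact CA].
  - apply Mu; [apply Cs, CX | exact CB].
  - apply Mu; [apply K0|]. apply Mi; apply Mu; try apply K0; [apply Cs, CXp | apply Cc, CXp].
Qed.

(** The velocity [X_t] up to a term that does not depend on [s]. *)
Definition Uc (z : state) (s : R) : R := phiR (Xc z s) + Vc z s.

Lemma Uc_derive (z : state) (s : R) : nice z -> 0 < s < 2 * PI -> is_derive (Uc z) s (field z (cJ s)).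
Proof.
  intros Hz Hs. unfold Uc, field. apply (is_derive_plus (fun r => phiR (Xc z r)) (Vc z)).
  - rewrite Rmult_comm. apply (is_derive_comp phiR (Xc z)); [apply phiR_derive | apply Xc_derive; auto].
  - apply Vc_derive; auto.
Qed.

Lemma Uc_continuous (z : state) (s : R) : nice z -> continuous (Uc z) s.
Proof.
  intros Hz. apply (continuous_plus (fun r => phiR (Xc z r)) (Vc z)).
  - apply (continuous_comp (Xc z) phiR); [apply Xc_continuous, Hz | apply phiR_continuous].
  - apply Vc_continuous, Hz.
Qed.

Lemma prim_field_J (k : R) (z : state) (s : R) : level k z -> 0 <= s <= 2 * PI ->
  prim (fun r => field z (cJ r)) s = Uc z s - Uc z 0.
Proof.
  intros Hz Hs. assert (Hn : nice z) by apply Hz. apply FTC_open; auto.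
  - apply (adm_cb _ k z adm_field_J Hz).
  - intros x Hx. apply Uc_derive; auto.
  - intros x. apply Uc_continuous, Hn.
Qed.

Lemma prim_field_K (k : R) (z : state) (s : R) : level k z -> 0 <= s <= 2 * PI ->
  prim (fun r => field z (cK r)) s = Gc z s - Gc z 0.
Proof.
  intros Hz Hs. apply FTC_open; auto.
  - apply (adm_cb _ k z adm_field_K Hz).
  - intros x Hx. apply Gc_derive with k; auto.
  - intros x. apply Gc_continuous with k, Hz.
Qed.

Lemma Gc_2PI (z : state) : nice z -> Gc z (2 * PI) = Gc z 0.
Proof.
  intros Hz. unfold Gc. rewrite Xc_2PI, Xc_0 by exact Hz. rewrite Gx_2PI.
  unfold Wc, Ac, Bc. rewrite !prim_0. reflexivity.
Qed.

Lemma Uc_2PI (z : state) : nice z -> Uc z (2 * PI) = Uc z 0.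
Proof. intros Hz. unfold Uc. rewrite Xc_2PI, Vc_2PI, Xc_0, Vc_0, phiR_2PI by exact Hz. reflexivity. Qed.

(** The vector field is tangent to the constraints: its integrals over a period are increments of
    [Uc] and [Gc], which are periodic. *)
Lemma field_nice (k : R) (z : state) : level k z -> nice (field z).
Proof.
  intros Hz. assert (Hn : nice z) by apply Hz. pose proof two_PI_pos. split; [|split; [|split]].
  - apply (adm_cb _ k z adm_field_J Hz).
  - apply (adm_cb _ k z adm_field_K Hz).
  - rewrite (prim_field_J k z) by (auto; lra). rewrite Uc_2PI by exact Hn. ring.
  - unfold Kc. rewrite (prim_field_K k z) by (auto; lra). rewrite Gc_2PI by exact Hn. ring.
Qed.

(** * The vector field meets the requirements of the ODE theory *)

Lemma nice_lin (f g : state) (a : R) : nice f -> nice g -> nice (fun i => f i + a * g i).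
Proof.
  intros (F1 & F2 & F3 & F4) (G1 & G2 & G3 & G4). unfold nice, Kc in *. split; [|split; [|split]].
  - apply cb_plus; [exact F1|]. apply cb_mult; [apply cb_const | exact G1].
  - apply cb_plus; [exact F2|]. apply cb_mult; [apply cb_const | exact G2].
  - rewrite (prim_lin (fun s => f (cJ s)) (fun s => g (cJ s))), F3, G3 by assumption. ring.
  - rewrite (prim_lin (fun s => f (cK s)) (fun s => g (cK s))), F4, G4 by assumption. ring.
Qed.

Lemma cb_limit (f : R -> R) :
  (forall eps, 0 < eps -> exists g, cb g /\ forall s, 0 < s < 2 * PI -> Rabs (f s - g s) <= eps) -> cb f.
Proof.
  intros H. split.
  - intros s Hs. apply continuous_eps. intros eps He.
    destruct (H (eps / 4)) as (g & [Hg _] & Hfg); [lra|].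
    destruct (proj1 (continuous_eps g s) (Hg s Hs) (eps / 4)) as (d & Hd & Hgd); [lra|].
    destruct (locally_between _ _ _ Hs) as [d2 Hd2].
    exists (Rmin d d2). split; [apply Rmin_glb_lt; [exact Hd | apply cond_pos]|].
    intros y Hy. assert (Hy1 : Rabs (y - s) < d) by (eapply Rlt_le_trans; [exact Hy | apply Rmin_l]).
    assert (Hy2 : 0 < y < 2 * PI).
    { apply (Hd2 y). eapply Rlt_le_trans; [exact Hy | apply Rmin_r]. }
    specialize (Hgd y Hy1). pose proof (Hfg y Hy2) as A1. pose proof (Hfg s Hs) as A2.
    apply Rabs_le_iff in A1. apply Rabs_le_iff in A2. apply Rabs_def2 in Hgd. apply Rabs_def1; lra.
  - destruct (H 1 Rlt_0_1) as (g & [_ [B HB]] & Hfg). exists (B + 1). intros s Hs.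
    replace (f s) with (g s + (f s - g s)) by ring.
    apply Rabs_plus_le; [apply HB, Hs | apply Hfg, Hs].
Qed.

Lemma prim_limit_zero (f : R -> R) (s : R) : cb f ->
  (forall eps, 0 < eps -> exists g, cb g /\ prim g s = 0 /\ forall s, 0 < s < 2 * PI -> Rabs (f s - g s) <= eps) -> prim f s = 0.
Proof.
  intros Hf H. enough (E : Rabs (prim f s) <= 0) by (apply Rabs_le_iff in E; lra).
  apply le_of_le_eps with (2 * PI). intros eps He. destruct (H eps He) as (g & Hg & G0 & Hfg).
  pose proof (prim_near f g eps s Hf Hg Hfg) as B. rewrite G0, Rminus_0_r in B. lra.
Qed.

Lemma nice_lim (f : state) :
  (forall eps, 0 < eps -> exists g, nice g /\ near cdom f g eps) -> nice f.
Proof.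
  intros H.
  assert (H1 : forall eps, 0 < eps -> exists g, cb g /\ prim g (2 * PI) = 0 /\ forall s, 0 < s < 2 * PI -> Rabs (f (cJ s) - g s) <= eps).
  { intros eps He. destruct (H eps He) as (g & Hg & Hfg). exists (fun s => g (cJ s)).
    split; [apply Hg|]. split; [apply Hg|]. intros s Hs. apply (Hfg (cJ s)), Hs. }
  assert (H2 : forall eps, 0 < eps -> exists g, cb g /\ prim g (2 * PI) = 0 /\ forall s, 0 < s < 2 * PI -> Rabs (f (cK s) - g s) <= eps).
  { intros eps He. destruct (H eps He) as (g & Hg & Hfg). exists (Kc g).
    split; [apply Hg|]. split; [apply Hg|]. intros s Hs. apply (Hfg (cK s)), Hs. }
  assert (C1 : cb (fun s => f (cJ s))).
  { apply cb_limit. intros eps He. destruct (H1 eps He) as (g & G1 & _ & G2). exists g. auto. }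
  assert (C2 : cb (fun s => f (cK s))).
  { apply cb_limit. intros eps He. destruct (H2 eps He) as (g & G1 & _ & G2). exists g. auto. }
  split; [exact C1|]. split; [exact C2|]. split; apply prim_limit_zero; auto.
Qed.

Theorem field_regular : vector_field cdom nice level field.
Proof.
  constructor.
  - intros f g a. apply nice_lin.
  - apply nice_lim.
  - intros k z Hz. apply Hz.
  - intros k k' z Hk (H0 & H1 & H2 & H3). split; [lra|]. split; [exact H1|]. split.
    + intros i Hi. specialize (H2 i Hi). lra.
    + intros s Hs. apply Rle_trans with (/ k); [apply Rinv_le_contravar; lra | auto].
  - intros k. destruct (Rlt_dec 0 k) as [Hk|Hk].
    2:{ exists 1, k. split; [lra|]. split; [lra|]. intros z z' (H0 & _). contradiction. }
    (* Distance at most [1] keeps the coordinates below [k + 1]; distance at most [/ (2 * k)] keeps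
       [X_s] above [/ (2 * k)]. *)
    exists (Rmin 1 (/ (2 * k))), (2 * k + 1). pose proof (Rinv_0_lt_compat (2 * k) ltac:(lra)) as Hi.
    split; [apply Rmin_glb_lt; lra|]. split; [lra|].
    intros z z' (H0 & H1 & H2 & H3) Hz' Hn. split; [lra|]. split; [exact Hz'|]. split.
    + intros i Hdi. specialize (Hn i Hdi). specialize (H2 i Hdi).
      pose proof (Rmin_l 1 (/ (2 * k))).
      replace (z' i) with ((z' i - z i) + z i) by ring.
      eapply Rle_trans; [apply Rabs_plus_le; [exact Hn | exact H2] | lra].
    + intros s Hs. specialize (H3 s Hs). specialize (Hn (cJ s) Hs). unfold Jc in *.
      pose proof (Rmin_r 1 (/ (2 * k))).
      assert (E : / k = / (2 * k) + / (2 * k)) by (field; lra).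
      assert (/ (2 * k + 1) <= / (2 * k)) by (apply Rinv_le_contravar; lra).
      apply Rabs_le_iff in Hn. lra.
  - intros k z. apply field_nice.
  - intros k. destruct (proj1 adm_field_J k) as (B1 & P1 & Q1 & L1).
    destruct (proj1 adm_field_K k) as (B2 & P2 & Q2 & L2).
    destruct (proj1 adm_field_V k) as (B3 & P3 & Q3 & L3).
    (* The peak component does not depend on the label, so its bounds are read at the interior label
       [PI]. *)
    assert (HP : 0 < PI < 2 * PI) by (pose proof PI_RGT_0; lra).
    exists (B1 + B2 + B3 + 1). split; [lra|]. split.
    + intros z [s|s|] Hz Hi.
      * specialize (Q1 z s Hz Hi). lra.
      * specialize (Q2 z s Hz Hi). lra.
      * specialize (Q3 z PI Hz HP). lra.
    + intros z1 z2 d Hz1 Hz2 Hn. pose proof (near_nonneg _ _ _ Hn) as Hd.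
      intros [s|s|] Hi.
      * eapply Rle_trans; [apply (L1 z1 z2 d s Hz1 Hz2 Hn Hi)|]. apply Rmult_le_compat_r; lra.
      * eapply Rle_trans; [apply (L2 z1 z2 d s Hz1 Hz2 Hn Hi)|]. apply Rmult_le_compat_r; lra.
      * eapply Rle_trans; [apply (L3 z1 z2 d PI Hz1 Hz2 Hn HP)|]. apply Rmult_le_compat_r; lra.
Qed.

(** * Functions on the torus *)

(** Unlike [wrap], this puts the peak at the ends of the fundamental interval, where the functions
    may lose their derivative. *)
Definition frac (x : R) : R := x - 2 * PI * IZR (Int_part (x / (2 * PI))).

Lemma frac_range (x : R) : 0 <= frac x < 2 * PI.
Proof.
  pose proof two_PI_pos as H. destruct (base_Int_part (x / (2 * PI))) as [H1 H2].
  unfold frac. set (k := IZR (Int_part (x / (2 * PI)))) in *.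
  assert (E : x = 2 * PI * (x / (2 * PI))) by (field; lra).
  split; rewrite E at 1; nra.
Qed.

Lemma IZR_lt_1 (k l : Z) : IZR k < IZR l + 1 -> IZR k <= IZR l.
Proof. intros H. rewrite <- plus_IZR in H. apply lt_IZR in H. apply IZR_le. lia. Qed.

Lemma frac_unique (x y : R) (k : Z) : 0 <= y < 2 * PI -> x = y + 2 * PI * IZR k -> frac x = y.
Proof.
  intros Hy E. pose proof two_PI_pos as H. pose proof (frac_range x) as Hx. unfold frac in *.
  set (l := Int_part (x / (2 * PI))) in *.
  assert (E2 : IZR k = IZR l).
  { apply Rle_antisym; apply IZR_lt_1; nra. }
  rewrite E, E2. ring.
Qed.

Lemma frac_id (x : R) : 0 <= x < 2 * PI -> frac x = x.
Proof. intros H. apply frac_unique with 0%Z; [exact H | ring]. Qed.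

Lemma frac_eq (x : R) : exists k : Z, x = frac x + 2 * PI * IZR k.
Proof. exists (Int_part (x / (2 * PI))). unfold frac. ring. Qed.

Lemma frac_period (x : R) : frac (x + 2 * PI) = frac x.
Proof.
  destruct (frac_eq x) as [k Hk]. apply frac_unique with (k + 1)%Z; [apply frac_range|].
  rewrite plus_IZR. lra.
Qed.

Lemma off_peak_frac (x : R) : off_peak x -> 0 < frac x < 2 * PI.
Proof.
  intros H. pose proof (frac_range x) as Hx. split; [|lra].
  destruct (Req_dec (frac x) 0) as [E|E]; [|lra].
  destruct (frac_eq x) as [k Hk]. exfalso. apply (H k). rewrite Hk, E. ring.
Qed.

Lemma frac_off_peak (x : R) : 0 < frac x -> off_peak x.
Proof.
  intros H k E. rewrite (frac_unique x 0 k) in H; [lra| |].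
  - pose proof two_PI_pos. lra.
  - rewrite E. ring.
Qed.

Lemma off_peak_open (x : R) : 0 < x < 2 * PI -> off_peak x.
Proof. intros H. apply frac_off_peak. rewrite frac_id; lra. Qed.

Lemma frac_local (x : R) : off_peak x ->
  locally x (fun y => 0 < frac y /\ frac y = y - (x - frac x)).
Proof.
  intros H. apply off_peak_frac in H. destruct (frac_eq x) as [k Hk].
  assert (Hx : 2 * PI * IZR k < x < 2 * PI + 2 * PI * IZR k) by lra.
  assert (H0 : forall y : R, 2 * PI * IZR k < y < 2 * PI + 2 * PI * IZR k ->
     0 < frac y /\ frac y = y - (x - frac x)).
  { intros y Hy. assert (E : frac y = y - 2 * PI * IZR k).
    { apply frac_unique with k; [lra | ring]. }
    rewrite E. split; lra. }
  generalize (locally_between _ _ _ Hx). apply filter_imp. exact H0.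
Qed.

Lemma periodic_frac (f : R -> R) (x : R) : periodic f -> f x = f (frac x).
Proof.
  intros Hf.
  assert (Hn : forall n y, f (y + 2 * PI * INR n) = f y).
  { induction n as [|n IH]; intros y.
    - simpl. f_equal. ring.
    - rewrite S_INR. replace (y + 2 * PI * (INR n + 1)) with ((y + 2 * PI * INR n) + 2 * PI) by ring.
      rewrite Hf. apply IH. }
  destruct (frac_eq x) as [k Hk]. rewrite Hk at 1. destruct (Z_le_gt_dec 0 k) as [h|h].
  - replace k with (Z.of_nat (Z.to_nat k)) by lia. rewrite <- INR_IZR_INZ. apply Hn.
  - rewrite <- (Hn (Z.to_nat (- k)) (frac x + 2 * PI * IZR k)). f_equal.
    rewrite INR_IZR_INZ, Z2Nat.id, opp_IZR by lia. ring.
Qed.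

Definition per (a : R -> R) (x : R) : R := a (frac x).

Lemma per_periodic (a : R -> R) : periodic (per a).
Proof. intros x. unfold per. rewrite frac_period. reflexivity. Qed.

Definition lip_on_period (L : R) (a : R -> R) : Prop :=
  forall x y, 0 <= x <= 2 * PI -> 0 <= y <= 2 * PI -> Rabs (a x - a y) <= L * Rabs (x - y).

Lemma lip_on_period_nonneg (L : R) (a : R -> R) : lip_on_period L a -> 0 <= L.
Proof.
  intros H. pose proof two_PI_pos. specialize (H (2 * PI) 0 ltac:(lra) ltac:(lra)).
  pose proof (Rabs_pos (a (2 * PI) - a 0)). rewrite Rminus_0_r, (Rabs_right (2 * PI)) in H by lra. nra.
Qed.

(** The constant survives periodization: between points of different periods the increment is split
    at copies of the peak, where both ends of the profile agree. *)
Lemma per_lip (L : R) (a : R -> R) (x y : R) :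
  lip_on_period L a -> a 0 = a (2 * PI) -> Rabs (per a x - per a y) <= L * Rabs (x - y).
Proof.
  intros Ha E0. pose proof (lip_on_period_nonneg L a Ha) as HL.
  assert (key : forall x y, x <= y -> Rabs (per a x - per a y) <= L * (y - x)).
  { clear x y. intros x y Hxy. unfold per.
    destruct (frac_eq x) as [k Hk]. destruct (frac_eq y) as [l Hl].
    pose proof (frac_range x) as Hx. pose proof (frac_range y) as Hy.
    set (x' := frac x) in *. set (y' := frac y) in *. pose proof two_PI_pos as HP.
    assert (Hkl : IZR k <= IZR l) by (apply IZR_lt_1; nra).
    destruct (Z.eq_dec k l) as [->|Hne].
    - assert (y - x = y' - x') by lra. eapply Rle_trans; [apply Ha; lra|].
      rewrite Rabs_minus_sym, Rabs_right by lra. apply Req_le. f_equal. lra.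
    - assert (Hkl2 : IZR k + 1 <= IZR l).
      { apply le_IZR in Hkl. rewrite <- plus_IZR. apply IZR_le. lia. }
      replace (a x' - a y') with ((a x' - a (2 * PI)) + (a 0 - a y')) by (rewrite E0; ring).
      eapply Rle_trans; [apply Rabs_plus_le; apply Ha; lra|].
      rewrite <- Rmult_plus_distr_l. apply Rmult_le_compat_l; [exact HL|].
      rewrite (Rabs_left1 (x' - 2 * PI)), (Rabs_left1 (0 - y')) by lra.
      rewrite Hk, Hl. nra. }
  destruct (Rle_dec x y).
  - rewrite (Rabs_minus_sym x y), (Rabs_right (y - x)) by lra. apply key; lra.
  - rewrite (Rabs_right (x - y)) by lra. rewrite Rabs_minus_sym. apply key; lra.
Qed.

Definition profile (a a' : R -> R) : Prop :=
  (exists L, lip_on_period L a) /\ a 0 = a (2 * PI) /\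
  (forall x, 0 < x < 2 * PI -> is_derive a x (a' x)) /\ cb a'.

Lemma per_derive (a a' : R -> R) (x : R) :
  profile a a' -> off_peak x -> is_derive (per a) x (a' (frac x)).
Proof.
  intros (_ & _ & Hd & _) Hx. pose proof (off_peak_frac x Hx) as Hf.
  apply is_derive_ext_loc with (fun y => a (y - (x - frac x))).
  - generalize (frac_local x Hx). apply filter_imp. intros y [_ Hy]. unfold per. rewrite Hy. reflexivity.
  - replace (a' (frac x)) with (scal 1 (a' (frac x))) by (unfold scal; simpl; unfold mult; simpl; ring).
    apply (is_derive_comp a (fun y => y - (x - frac x))).
    + replace (x - (x - frac x)) with (frac x) by ring. apply Hd, Hf.
    + auto_derive; [exact Logic.I | ring].
Qed.

Lemma per_continuous_open (a' : R -> R) (x : R) :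
  (forall y, 0 < y < 2 * PI -> continuous a' y) -> off_peak x -> continuous (per a') x.
Proof.
  intros Hc Hx. pose proof (off_peak_frac x Hx) as Hf.
  apply continuous_ext_loc with (fun y => a' (y - (x - frac x))).
  - generalize (frac_local x Hx). apply filter_imp. intros y [_ Hy]. unfold per. rewrite Hy. reflexivity.
  - apply (continuous_comp (fun y => y - (x - frac x)) a').
    + apply (ex_derive_continuous (V := R_NormedModule)). auto_derive. exact Logic.I.
    + replace (x - (x - frac x)) with (frac x) by ring. apply Hc, Hf.
Qed.

Lemma per_Derive (a a' : R -> R) (x : R) : profile a a' -> off_peak x -> Derive (per a) x = a' (frac x).
Proof. intros H Hx. apply is_derive_unique, per_derive; auto. Qed.

Lemma profile_C10 (a a' : R -> R) : profile a a' -> C10 (per a).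
Proof.
  intros H. constructor.
  - apply per_periodic.
  - intros x. destruct H as ([L HL] & H0 & _). apply continuous_lipschitz with L.
    intros y. apply per_lip; auto.
  - intros x Hx. exists (a' (frac x)). apply per_derive; auto.
  - intros x Hx. apply continuous_ext_loc with (per a').
    + generalize (frac_local x Hx). apply filter_imp. intros y [Hy _].
      rewrite (per_Derive a a') by (auto using frac_off_peak). reflexivity.
    + apply per_continuous_open; [apply H | exact Hx].
  - pose proof H as (_ & _ & _ & _ & B & HB). exists B. intros x Hx.
    rewrite (per_Derive a a' x H Hx). apply HB, off_peak_frac, Hx.
Qed.

Lemma profile_norm (a a' : R -> R) (B : R) :
  profile a a' -> (forall x, 0 <= x < 2 * PI -> Rabs (a x) <= B) ->
  (forall x, 0 < x < 2 * PI -> Rabs (a' x) <= B) -> C10_norm_le (per a) B.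
Proof.
  intros H H1 H2. split.
  - intros x. apply H1, frac_range.
  - intros x Hx. rewrite (per_Derive a a') by auto. apply H2, off_peak_frac, Hx.
Qed.

Lemma profile_prim (a0 : R) (a' : R -> R) :
  cb a' -> prim a' (2 * PI) = 0 -> profile (fun s => a0 + prim a' s) a'.
Proof.
  intros H H0. split; [|split; [|split]]; [| | |exact H].
  - destruct H as [Hc [B HB]]. exists B. intros x y _ _.
    replace (a0 + prim a' x - (a0 + prim a' y)) with (prim a' x - prim a' y) by ring.
    apply prim_lip; auto.
  - rewrite prim_0, H0. reflexivity.
  - intros x Hx. rewrite <- (Rplus_0_l (a' x)). apply (is_derive_plus (fun _ => a0) (prim a')).
    + apply (is_derive_const (K := R_AbsRing) (V := R_NormedModule)).
    + apply prim_derive; auto.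
Qed.

Lemma profile_lin (a a' b b' : R -> R) (k : R) :
  profile a a' -> profile b b' -> profile (fun x => a x + k * b x) (fun x => a' x + k * b' x).
Proof.
  intros ([L HL] & H2 & H3 & H4) ([M HM] & G2 & G3 & G4). split; [|split; [|split]].
  - exists (L + Rabs k * M). intros x y Hx Hy.
    replace (a x + k * b x - (a y + k * b y)) with ((a x - a y) + k * (b x - b y)) by ring.
    rewrite Rmult_plus_distr_r, Rmult_assoc. apply Rabs_plus_le; [apply HL; auto|].
    apply Rabs_mult_le; [lra | apply HM; auto].
  - rewrite H2, G2. reflexivity.
  - intros x Hx. apply (is_derive_plus a (fun x => k * b x)); [apply H3, Hx|].
    apply (is_derive_scal b). apply G3, Hx.
  - apply cb_plus; [exact H4|]. apply cb_mult; [apply cb_const | exact G4].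
Qed.

(** * The kernel on one period *)

Lemma phi_per (x : R) : phi x = per phiR x.
Proof.
  unfold phi, per, phiR, m. pose proof PI_RGT_0 as HP.
  assert (E : wrap x = frac (x + PI) - PI) by (unfold wrap, frac; ring).
  pose proof (frac_range x) as Hx. destruct (frac_eq x) as [k Hk].
  destruct (Rlt_dec (frac x) PI) as [h|h].
  - rewrite (frac_unique (x + PI) (frac x + PI) k) in E by lra.
    replace (frac x + PI - PI) with (frac x) in E by ring.
    rewrite E, Rabs_right by lra. unfold Rdiv. ring.
  - rewrite (frac_unique (x + PI) (frac x - PI) (k + 1)) in E; [| lra | rewrite plus_IZR; lra].
    rewrite E, Rabs_left by lra.
    replace (PI - - (frac x - PI - PI)) with (- (PI - frac x)) by ring. rewrite cosh_opp. unfold Rdiv. ring.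
Qed.

Lemma c_phiR : c = phiR 0.
Proof. unfold c. rewrite phi_per. unfold per. rewrite frac_id; [reflexivity|]. pose proof two_PI_pos; lra. Qed.

Lemma dphiR_bound (x : R) : 0 <= x <= 2 * PI -> Rabs (dphiR x) <= 1.
Proof.
  intros Hx. unfold dphiR, m. pose proof sinh_PI_pos as HS.
  assert (H : - sinh PI <= sinh (PI - x) <= sinh PI).
  { assert (mono : forall u v, u <= v -> sinh u <= sinh v).
    { intros u v [H| ->]; [left; apply sinh_lt, H | lra]. }
    rewrite <- sinh_opp. split; apply mono; lra. }
  replace (- / sinh PI * sinh (PI - x)) with (- (sinh (PI - x) / sinh PI)) by (field; lra).
  rewrite Rabs_Ropp. apply Rabs_le_iff. split.
  - apply Rmult_le_reg_r with (sinh PI); [exact HS|].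
    replace (sinh (PI - x) / sinh PI * sinh PI) with (sinh (PI - x)) by (field; lra). lra.
  - apply Rmult_le_reg_r with (sinh PI); [exact HS|].
    replace (sinh (PI - x) / sinh PI * sinh PI) with (sinh (PI - x)) by (field; lra). lra.
Qed.

Lemma phiR_profile : profile phiR dphiR.
Proof.
  split; [|split; [|split]].
  - exists 1. intros x y Hx Hy. apply (lip_of_derive phiR dphiR); [apply phiR_derive|].
    intros u Hu. apply dphiR_bound. unfold Rmin, Rmax in Hu. destruct Rle_dec; lra.
  - symmetry. apply phiR_2PI.
  - intros x _. apply phiR_derive.
  - split; [intros; apply dphiR_continuous|]. exists 1. intros s Hs. apply dphiR_bound. lra.
Qed.

Lemma phi_lip (x y : R) : Rabs (phi x - phi y) <= Rabs (x - y).
Proof.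
  rewrite !phi_per, <- (Rmult_1_l (Rabs (x - y))). apply per_lip; [|apply phiR_profile].
  intros u v Hu Hv. apply (lip_of_derive phiR dphiR); [apply phiR_derive|].
  intros w Hw. apply dphiR_bound. unfold Rmin, Rmax in Hw. destruct Rle_dec; lra.
Qed.

Lemma Derive_phi (x : R) : off_peak x -> Derive phi x = dphiR (frac x).
Proof.
  intros Hx. rewrite (Derive_ext phi (per phiR)) by apply phi_per.
  apply (per_Derive phiR dphiR); [apply phiR_profile | exact Hx].
Qed.

(** * Closed forms of [Q] and of the right-hand side *)

Section C10_function.

Variable f : R -> R.
Hypothesis Hf : C10 f.

Lemma C10_cb_derive : cb (Derive f).
Proof.
  split.
  - intros s Hs. apply (C10_derive_continuous _ Hf). apply off_peak_open, Hs.
  - destruct (C10_derive_bounded _ Hf) as [B HB]. exists B. intros s Hs. apply HB, off_peak_open, Hs.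
Qed.

Lemma C10_cb : cb f.
Proof.
  split; [intros; apply (C10_continuous _ Hf)|].
  destruct (C10_cb_derive) as [_ [B HB]].
  exists (Rabs (f 0) + B * (2 * PI)). intros s Hs.
  replace (f s) with (f 0 + (f s - f 0)) by ring. apply Rabs_plus_le; [lra|].
  assert (HB0 : 0 <= B) by (eapply Rle_trans; [apply Rabs_pos | apply (HB s Hs)]).
  apply Rle_trans with (B * (s - 0)).
  - apply (MVT_bound f (Derive f)); [lra| | |].
    + intros x Hx. apply Derive_correct, (C10_derivable _ Hf), off_peak_open. lra.
    + intros x _. apply (C10_continuous _ Hf).
    + intros x Hx. apply HB. lra.
  - apply Rmult_le_compat_l; lra.
Qed.

(** The Lagrangian state with [X] the identity. Besides giving initial data, it lets [Gc] be
    evaluated on an Eulerian function at a fixed time. *)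
Definition st (f : R -> R) : state :=
  fun i => match i with cJ _ => 0 | cK s => Derive f s | cV => f 0 end.

Lemma prim_zero (s : R) : prim (fun _ => 0) s = 0.
Proof.
  pose proof (prim_near (fun _ => 0) (fun _ => 0) 0 s (cb_const 0) (cb_const 0)) as H.
  pose proof (prim_lip (fun _ => 0) 0 0 s) as B. rewrite prim_0 in B.
  enough (E : Rabs (prim (fun _ => 0) s - 0) <= 0) by (apply Rabs_le_iff in E; lra).
  rewrite Rmult_0_l in B. apply B; intros; [apply continuous_const | rewrite Rabs_R0; lra].
Qed.

Lemma Xc_st (s : R) : Xc (st f) s = s.
Proof. unfold Xc. simpl. rewrite prim_zero. ring. Qed.

Lemma Vc_st (s : R) : 0 <= s <= 2 * PI -> Vc (st f) s = f s.
Proof.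
  intros Hs. change (f 0 + prim (Derive f) s = f s). rewrite (FTC_open f (Derive f) s); auto; [ring| | |].
  - apply C10_cb_derive.
  - intros x Hx. apply Derive_correct, (C10_derivable _ Hf), off_peak_open, Hx.
  - apply (C10_continuous _ Hf).
Qed.

Lemma Jc_st (s : R) : Jc (st f) s = 1.
Proof. unfold Jc. simpl. ring. Qed.

Lemma st_nice : nice (st f).
Proof.
  pose proof two_PI_pos. split; [|split; [|split]].
  - exact (cb_const 0).
  - exact C10_cb_derive.
  - exact (prim_zero (2 * PI)).
  - pose proof (Vc_st (2 * PI) ltac:(lra)) as E. change (f 0 + prim (Kc (st f)) (2 * PI) = f (2 * PI)) in E.
    rewrite <- (Rplus_0_l (2 * PI)) in E at 2. rewrite (C10_periodic _ Hf) in E. lra.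
Qed.

Lemma st_level (k : R) : 1 <= k -> C10_norm_le f k -> level k (st f).
Proof.
  intros Hk [H1 H2]. split; [lra|]. split; [apply st_nice|]. split.
  - intros [s|s|] Hi; simpl.
    + rewrite Rabs_R0. lra.
    + apply H2, off_peak_open, Hi.
    + apply H1.
  - intros s _. rewrite Jc_st. rewrite <- Rinv_1. apply Rinv_le_contravar; lra.
Qed.

Lemma C10_norm_bound : exists k, 1 <= k /\ C10_norm_le f k.
Proof.
  destruct C10_cb as [_ [B1 H1]]. destruct (C10_derive_bounded _ Hf) as [B2 H2].
  exists (Rabs B1 + Rabs B2 + Rabs (f 0) + 1).
  pose proof (Rabs_pos B1). pose proof (Rabs_pos B2). pose proof (Rabs_pos (f 0)).
  pose proof (Rle_abs B1). pose proof (Rle_abs B2).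
  split; [lra|]. split.
  - intros x. rewrite (periodic_frac f x) by apply (C10_periodic _ Hf).
    pose proof (frac_range x). destruct (Req_dec (frac x) 0) as [->|]; [lra|].
    specialize (H1 (frac x) ltac:(lra)). lra.
  - intros x Hx. specialize (H2 x Hx). lra.
Qed.

Lemma Derive_period (x : R) : Derive f (x + 2 * PI) = Derive f x.
Proof.
  unfold Derive. f_equal. apply Lim_ext. intros h.
  replace (x + 2 * PI + h) with (x + h + 2 * PI) by ring. rewrite !(C10_periodic _ Hf). reflexivity.
Qed.

Lemma C10_lip (B x y : R) : C10_norm_le f B -> Rabs (f x - f y) <= B * Rabs (x - y).
Proof.
  intros [_ HB].
  assert (E : forall x, f x = per f x) by (intros u; apply periodic_frac, (C10_periodic _ Hf)).
  rewrite (E x), (E y). apply per_lip.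
  - intros u v Hu Hv.
    assert (key : forall u v, 0 <= u -> u <= v -> v <= 2 * PI -> Rabs (f v - f u) <= B * (v - u)).
    { intros a b H1 H2 H3. apply (MVT_bound f (Derive f)); auto.
      + intros w Hw. apply Derive_correct, (C10_derivable _ Hf), off_peak_open. lra.
      + intros w _. apply (C10_continuous _ Hf).
      + intros w Hw. apply HB, off_peak_open. lra. }
    destruct (Rle_dec u v).
    + rewrite (Rabs_minus_sym (f u)), (Rabs_minus_sym u), (Rabs_right (v - u)) by lra. apply key; lra.
    + rewrite (Rabs_right (u - v)) by lra. apply key; lra.
  - rewrite <- (Rplus_0_l (2 * PI)), (C10_periodic _ Hf). reflexivity.
Qed.

Definition energy (y : R) : R := f y ^ 2 + / 2 * Derive f y ^ 2.

Lemma energy_cb : cb energy.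
Proof.
  unfold energy. apply cb_plus.
  - apply cb_ext with (fun s => f s * f s); [intros; ring | apply cb_mult; apply C10_cb].
  - apply cb_mult; [apply cb_const|].
    apply cb_ext with (fun s => Derive f s * Derive f s); [intros; ring | apply cb_mult; apply C10_cb_derive].
Qed.

Lemma cosh_energy_cb : cb (fun y => cosh y * energy y).
Proof.
  apply cb_mult; [|apply energy_cb]. split; [intros; apply continuous_cosh|].
  exists (exp (2 * PI)). intros s Hs. apply cosh_bound, Rabs_le_iff. lra.
Qed.

Lemma sinh_energy_cb : cb (fun y => sinh y * energy y).
Proof.
  apply cb_mult; [|apply energy_cb]. split; [intros; apply continuous_sinh|].
  exists (exp (2 * PI)). intros s Hs. apply sinh_bound, Rabs_le_iff. lra.
Qed.

Lemma Ac_st (s : R) : Ac (st f) s = prim (fun y => cosh y * energy y) s.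
Proof.
  unfold Ac. apply prim_ext. intros x Hx. unfold Fc, energy. rewrite Xc_st, Vc_st, Jc_st by lra.
  unfold Kc; simpl. rewrite Rinv_1. ring.
Qed.

Lemma Bc_st (s : R) : Bc (st f) s = prim (fun y => sinh y * energy y) s.
Proof.
  unfold Bc. apply prim_ext. intros x Hx. unfold Fc, energy. rewrite Xc_st, Vc_st, Jc_st by lra.
  unfold Kc; simpl. rewrite Rinv_1. ring.
Qed.

Lemma Wc_st (s : R) : Wc (st f) s = prim f s.
Proof. unfold Wc. apply prim_ext. intros x Hx. rewrite Vc_st, Jc_st by lra. ring. Qed.

Lemma RInt_shift (g : R -> R) (a b : R) :
  periodic g -> ex_RInt g (a + 2 * PI) (b + 2 * PI) -> is_RInt g a b (RInt g (a + 2 * PI) (b + 2 * PI)).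
Proof.
  intros Hg H.
  assert (H' : is_RInt g (1 * a + 2 * PI) (1 * b + 2 * PI) (RInt g (a + 2 * PI) (b + 2 * PI))).
  { rewrite !Rmult_1_l. apply (RInt_correct (V := R_CompleteNormedModule)), H. }
  apply (is_RInt_comp_lin (V := R_NormedModule) g 1 (2 * PI) a b) in H'.
  apply is_RInt_ext with (2 := H'). intros x _. unfold scal; simpl; unfold mult; simpl.
  rewrite Rmult_1_l, Rmult_1_l. apply Hg.
Qed.

Lemma RInt_period (g : R -> R) (l1 l2 : R) :
  periodic g -> is_RInt g 0 PI l1 -> is_RInt g PI (2 * PI) l2 -> @eq R (RInt g (- PI) PI) (l1 + l2).
Proof.
  intros Hg H1 H2.
  assert (H3 : is_RInt g (- PI) 0 l2).
  { rewrite <- (is_RInt_unique (V := R_CompleteNormedModule) g _ _ _ H2).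
    replace (RInt g PI (2 * PI)) with (RInt g (- PI + 2 * PI) (0 + 2 * PI)) by (f_equal; ring).
    apply RInt_shift; [exact Hg|]. replace (- PI + 2 * PI) with PI by ring. rewrite Rplus_0_l. exists l2. exact H2. }
  rewrite Rplus_comm. apply (is_RInt_unique (V := R_CompleteNormedModule)).
  apply (is_RInt_Chasles (V := R_NormedModule) g (- PI) 0 PI l2 l1); assumption.
Qed.

(** On each side of [y = frac x] the kernel is a single hyperbolic sine, and the addition formula
    separates [x] from [y]; this yields the primitives of [cosh y] and [sinh y] times the energy. *)
Lemma Q_formula (x : R) : off_peak x ->
  Q f x = Qx (frac x) (Ac (st f) (frac x)) (Bc (st f) (frac x)) (Ac (st f) (2 * PI)) (Bc (st f) (2 * PI)).
Proof.
  intros Hx. pose proof (off_peak_frac x Hx) as Hr. set (r := frac x) in *.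
  pose proof PI_RGT_0 as HP.
  set (N := fun y => Derive phi (x - y) * (f y ^ 2 + / 2 * Derive f y ^ 2)).
  set (a := fun y => cosh y * energy y). set (b := fun y => sinh y * energy y).
  set (Nl := fun y => (- m * sinh (PI - r)) * a y + (- m * cosh (PI - r)) * b y).
  set (Nr := fun y => (m * sinh (PI + r)) * a y + (- m * cosh (PI + r)) * b y).
  assert (Ca : cb a) by apply cosh_energy_cb. assert (Cb : cb b) by apply sinh_energy_cb.
  assert (CNl : cb Nl) by (apply cb_plus; apply cb_mult; auto using cb_const).
  assert (CNr : cb Nr) by (apply cb_plus; apply cb_mult; auto using cb_const).
  destruct (frac_eq x) as [k Hk]. fold r in Hk.
  assert (El : forall y, 0 < y < r -> N y = Nl y).
  { intros y Hy. unfold N, Nl, a, b. fold (energy y).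
    assert (Efr : frac (x - y) = r - y) by (apply frac_unique with k; lra).
    rewrite Derive_phi by (apply frac_off_peak; lra). rewrite Efr. unfold dphiR.
    replace (PI - (r - y)) with ((PI - r) + y) by ring. rewrite sinh_plus. ring. }
  assert (Er : forall y, r < y < 2 * PI -> N y = Nr y).
  { intros y Hy. unfold N, Nr, a, b. fold (energy y).
    assert (Efr : frac (x - y) = r - y + 2 * PI).
    { apply frac_unique with (k - 1)%Z; [lra|]. rewrite minus_IZR. lra. }
    rewrite Derive_phi by (apply frac_off_peak; lra). rewrite Efr. unfold dphiR.
    replace (PI - (r - y + 2 * PI)) with (- ((PI + r) + - y)) by ring.
    rewrite sinh_opp, sinh_plus, sinh_opp, cosh_opp. ring. }
  assert (IN : forall u v, 0 <= u -> u <= v -> v <= r -> is_RInt N u v (RInt Nl u v)).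
  { intros u v H1 H2 H3. apply is_RInt_ext with Nl.
    - intros y. rewrite Rmin_left, Rmax_right by lra. intros Hy. symmetry. apply El. lra.
    - apply (RInt_correct (V := R_CompleteNormedModule)), cb_ex_RInt; auto; lra. }
  assert (IN2 : forall u v, r <= u -> u <= v -> v <= 2 * PI -> is_RInt N u v (RInt Nr u v)).
  { intros u v H1 H2 H3. apply is_RInt_ext with Nr.
    - intros y. rewrite Rmin_left, Rmax_right by lra. intros Hy. symmetry. apply Er. lra.
    - apply (RInt_correct (V := R_CompleteNormedModule)), cb_ex_RInt; auto; lra. }
  assert (PN : periodic N).
  { intros y. unfold N. rewrite Derive_period, (C10_periodic _ Hf). f_equal.
    replace (x - y) with (x - (y + 2 * PI) + 2 * PI) by ring.
    symmetry. unfold Derive. f_equal. apply Lim_ext. intros h.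
    replace (x - (y + 2 * PI) + 2 * PI + h) with (x - (y + 2 * PI) + h + 2 * PI) by ring.
    rewrite !phi_per, !per_periodic. reflexivity. }
  (* Shifting the domain to [[0, 2 * PI]] cuts it at [PI], and the jump of the kernel at [r] can lie
     in either half. *)
  assert (Etot : @eq R (RInt N (- PI) PI) (RInt Nl 0 r + RInt Nr r (2 * PI))).
  { destruct (Rle_dec r PI) as [h|h].
    - rewrite (RInt_period N (RInt Nl 0 r + RInt Nr r PI) (RInt Nr PI (2 * PI)) PN).
      + rewrite (RInt_split Nr r PI (2 * PI)) by (apply cb_ex_RInt; auto; lra). ring.
      + apply (is_RInt_Chasles (V := R_NormedModule) N 0 r PI); [apply IN | apply IN2]; lra.
      + apply IN2; lra.
    - rewrite (RInt_period N (RInt Nl 0 PI) (RInt Nl PI r + RInt Nr r (2 * PI)) PN).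
      + rewrite (RInt_split Nl 0 PI r) by (apply cb_ex_RInt; auto; lra). ring.
      + apply IN; lra.
      + apply (is_RInt_Chasles (V := R_NormedModule) N PI r (2 * PI)); [apply IN | apply IN2]; lra. }
  assert (E2 : @eq R (RInt Nr r (2 * PI)) (prim Nr (2 * PI) - prim Nr r)).
  { rewrite !prim_eq by lra. rewrite (RInt_split Nr 0 r (2 * PI)) by (apply cb_ex_RInt; auto; lra).
    symmetry. apply Rplus_minus_l. }
  assert (Lin : forall p q s, prim (fun y => p * a y + q * b y) s = p * prim a s + q * prim b s).
  { intros p q s. rewrite (prim_lin (fun y => p * a y) b) by (auto; apply cb_mult; auto using cb_const).
    f_equal. rewrite (prim_ext _ (fun y => 0 + p * a y)) by (intros; ring).
    rewrite (prim_lin (fun _ => 0) a) by auto using cb_const. rewrite prim_zero. ring. }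
  unfold Q. change (/ 2 * RInt N (- PI) PI = Qx r (Ac (st f) r) (Bc (st f) r) (Ac (st f) (2 * PI)) (Bc (st f) (2 * PI))).
  rewrite Etot, <- prim_eq, E2 by lra. unfold Nl, Nr. rewrite !Lin, !Ac_st, !Bc_st. fold a b.
  unfold Qx. replace (PI - r) with (PI + - r) by ring. rewrite !sinh_plus, !cosh_plus, sinh_opp, cosh_opp.
  assert (Em : m * sinh PI = 1) by (unfold m; field; pose proof sinh_PI_pos; lra).
  set (A := prim a r). set (A1 := prim a (2 * PI)). set (B := prim b r). set (B1 := prim b (2 * PI)).
  generalize dependent (sinh PI). generalize (cosh PI). generalize m. intros n C S En.
  transitivity (- (n * S) * cosh r * A + (n * S) * sinh r * B +
    n / 2 * ((S * cosh r + C * sinh r) * A1 - (C * cosh r + S * sinh r) * B1)); [field|].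
  rewrite En. field.
Qed.

(** For [x < 0] neither [w] nor [sinh x] is unchanged when passing to [x + 2 * PI], but the
    combination in the equation is, again because [m * sinh PI = 1]. *)
Lemma rhs_formula (x : R) : - PI <= x <= PI -> x <> 0 ->
  rhs f x = (phiR 0 - phiR (frac x) + f 0 - f (frac x)) * Derive f (frac x) + Gc (st f) (frac x).
Proof.
  intros Hx Hx0. pose proof PI_RGT_0 as HP.
  assert (Hfr : (0 < x /\ frac x = x) \/ (x < 0 /\ frac x = x + 2 * PI)).
  { destruct (Rlt_dec 0 x); [left; split; [lra|]; apply frac_id; lra | right; split; [lra|]].
    apply frac_unique with (-1)%Z; lra. }
  assert (Hop : off_peak x) by (apply frac_off_peak; lra).
  unfold rhs, Gc, Gx. rewrite Q_formula by exact Hop.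
  rewrite c_phiR, phi_per. unfold per. rewrite (periodic_frac f x) by apply (C10_periodic _ Hf).
  rewrite (periodic_frac (Derive f) x) by (intros y; apply Derive_period).
  rewrite Xc_st, !Wc_st. pose proof C10_cb as Cf.
  assert (Em : mean f = / (2 * PI) * prim f (2 * PI)).
  { unfold mean. f_equal. rewrite (RInt_period f (RInt f 0 PI) (RInt f PI (2 * PI)) (C10_periodic _ Hf)).
    - rewrite prim_eq by lra. symmetry. apply RInt_split; apply cb_ex_RInt; auto; lra.
    - apply (RInt_correct (V := R_CompleteNormedModule)), cb_ex_RInt; auto; lra.
    - apply (RInt_correct (V := R_CompleteNormedModule)), cb_ex_RInt; auto; lra. }
  rewrite Em. set (q := Qx _ _ _ _ _). set (d := Derive f (frac x)). set (W1 := prim f (2 * PI)).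
  enough (E : phiR (frac x) * RInt f 0 x - PI * m ^ 2 * (/ (2 * PI) * W1) * sinh x =
    phiR (frac x) * prim f (frac x) - m ^ 2 / 2 * W1 * sinh (frac x)) by lra.
  replace (PI * m ^ 2 * (/ (2 * PI) * W1)) with (m ^ 2 / 2 * W1) by (field; lra).
  destruct Hfr as [[h E]|[h E]]; rewrite E.
  - rewrite prim_eq by lra. reflexivity.
  (* A primitive based at [0] loses the full integral [W1] under the shift by one period. *)
  - assert (E2 : @eq R (RInt f 0 x) (prim f (x + 2 * PI) - W1)).
    { assert (S : is_RInt f x 0 (RInt f (x + 2 * PI) (0 + 2 * PI))).
      { apply RInt_shift; [apply (C10_periodic _ Hf)|]. apply cb_ex_RInt; auto; lra. }
      apply (is_RInt_swap (V := R_NormedModule)) in S.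
      rewrite (is_RInt_unique (V := R_CompleteNormedModule) _ _ _ _ S). rewrite Rplus_0_l.
      unfold W1. rewrite !prim_eq by lra.
      rewrite (RInt_split f 0 (x + 2 * PI) (2 * PI)) by (apply cb_ex_RInt; auto; lra).
      unfold opp; simpl. ring. }
    rewrite E2. unfold phiR. replace (PI - (x + 2 * PI)) with (- (PI + x)) by ring. rewrite cosh_opp.
    replace (x + 2 * PI) with (PI + x + PI) by ring. replace (sinh x) with (sinh (PI + x + - PI)) by (f_equal; ring).
    rewrite (sinh_plus (PI + x) PI), (sinh_plus (PI + x) (- PI)), sinh_opp, cosh_opp.
    assert (Em' : m * sinh PI = 1) by (unfold m; field; pose proof sinh_PI_pos; lra).
    generalize (prim f (PI + x + PI)). intros P.
    generalize dependent (sinh PI). generalize (cosh PI) (cosh (PI + x)) (sinh (PI + x)). generalize m.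
    intros n C1 C2 S2 S En.
    transitivity (n * C2 * P - n * C2 * W1 + (n * S) * n * W1 * C2 / 2 - n ^ 2 / 2 * W1 * S2 * C1); [field|].
    transitivity (n * C2 * P - (n * S) * n * W1 * C2 / 2 - n ^ 2 / 2 * W1 * S2 * C1); [|field].
    rewrite En. field.
Qed.

End C10_function.

(** * From Lagrangian states to Eulerian velocities *)

Definition slope (z : state) (s : R) : R := Kc z s * / Jc z s.

Lemma adm_slope : adm slope.
Proof. apply adm_mult; [apply adm_K | apply adm_inv_J]. Qed.

(** The inverse of the label map, characterized by [Sc_spec] for [x] in [[0, 2 * PI]] and [z] in a
    level. *)
Definition Sc (z : state) (x : R) : R :=
  epsilon (inhabits 0) (fun s => 0 <= s <= 2 * PI /\ Xc z s = x).

(** * Inversion of the label map *)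

Section Level.

Variables (k : R) (z : state).
Hypothesis Hz : level k z.

Lemma level_nice : nice z.
Proof. apply Hz. Qed.

Lemma level_pos : 0 < k.
Proof. apply Hz. Qed.

Lemma Xc_lower (s r : R) : 0 <= s -> s <= r -> r <= 2 * PI -> (r - s) <= k * (Xc z r - Xc z s).
Proof.
  intros H1 H2 H3. pose proof level_pos as Hk. pose proof level_nice as Hn.
  destruct (Req_dec s r) as [->|Hne]; [lra|].
  destruct (MVT_open (Xc z) (Jc z) s r) as (q & Hq & E); try lra.
  - intros x Hx. apply Xc_derive; auto. lra.
  - intros x Hx. apply Xc_continuous, Hn.
  - rewrite E. destruct Hz as (_ & _ & _ & HJ). specialize (HJ q ltac:(lra)).
    apply Rmult_le_compat_l with (r := k) in HJ; [|lra]. rewrite Rinv_r in HJ by lra. nra.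
Qed.

Lemma Xc_lower_abs (s r : R) : 0 <= s <= 2 * PI -> 0 <= r <= 2 * PI ->
  Rabs (s - r) <= k * Rabs (Xc z s - Xc z r).
Proof.
  intros Hs Hr. pose proof level_pos as Hk. destruct (Rle_dec s r) as [h|h].
  - pose proof (Xc_lower s r ltac:(lra) h ltac:(lra)) as B.
    rewrite (Rabs_minus_sym s), (Rabs_minus_sym (Xc z s)), (Rabs_right (r - s)) by lra.
    eapply Rle_trans; [exact B|]. apply Rmult_le_compat_l; [lra | apply Rle_abs].
  - pose proof (Xc_lower r s ltac:(lra) ltac:(lra) ltac:(lra)) as B. rewrite (Rabs_right (s - r)) by lra.
    eapply Rle_trans; [exact B|]. apply Rmult_le_compat_l; [lra | apply Rle_abs].
Qed.

Lemma Xc_lt (s r : R) : 0 <= s -> s < r -> r <= 2 * PI -> Xc z s < Xc z r.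
Proof. intros H1 H2 H3. pose proof (Xc_lower s r H1 ltac:(lra) H3). pose proof level_pos. nra. Qed.

Lemma Xc_range (s : R) : 0 <= s <= 2 * PI -> 0 <= Xc z s <= 2 * PI.
Proof.
  intros Hs. pose proof two_PI_pos as HP. pose proof level_nice as Hn.
  pose proof (Xc_0 z) as E0. pose proof (Xc_2PI z Hn) as E1. split.
  - destruct (Req_dec s 0) as [->|]; [lra|]. pose proof (Xc_lt 0 s). lra.
  - destruct (Req_dec s (2 * PI)) as [->|]; [lra|]. pose proof (Xc_lt s (2 * PI)). lra.
Qed.

Lemma Xc_range_open (s : R) : 0 < s < 2 * PI -> 0 < Xc z s < 2 * PI.
Proof.
  intros Hs. pose proof level_nice as Hn. pose proof (Xc_0 z) as E0. pose proof (Xc_2PI z Hn) as E1.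
  pose proof (Xc_lt 0 s). pose proof (Xc_lt s (2 * PI)). lra.
Qed.

Lemma Xc_upper (s r : R) : Rabs (Xc z s - Xc z r) <= (1 + k) * Rabs (s - r).
Proof.
  unfold Xc. replace (s + prim (fun q => z (cJ q)) s - (r + prim (fun q => z (cJ q)) r))
    with ((s - r) + (prim (fun q => z (cJ q)) s - prim (fun q => z (cJ q)) r)) by ring.
  rewrite Rmult_plus_distr_r, Rmult_1_l. apply Rabs_plus_le; [lra|].
  apply prim_lip; [apply level_nice|]. intros q Hq. apply Hz. exact Hq.
Qed.

Lemma Vc_lip (s r : R) : Rabs (Vc z s - Vc z r) <= k * Rabs (s - r).
Proof.
  unfold Vc. replace (z cV + prim (Kc z) s - (z cV + prim (Kc z) r)) with (prim (Kc z) s - prim (Kc z) r) by ring.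
  apply prim_lip; [apply level_nice|]. intros q Hq. apply Hz. exact Hq.
Qed.

Lemma Vc_bound (s : R) : Rabs (Vc z s) <= k + k * (2 * PI).
Proof.
  unfold Vc. apply Rabs_plus_le; [apply Hz; exact Logic.I|].
  apply prim_bound; [apply level_nice|]. intros q Hq. apply Hz. exact Hq.
Qed.

Lemma slope_bound (s : R) : 0 < s < 2 * PI -> Rabs (slope z s) <= k * k.
Proof.
  intros Hs. destruct (level_inv_J k z s Hz Hs). apply Rabs_mult_le.
  - apply Hz. exact Hs.
  - rewrite Rabs_right; lra.
Qed.

Lemma Sc_spec (x : R) : 0 <= x <= 2 * PI -> 0 <= Sc z x <= 2 * PI /\ Xc z (Sc z x) = x.
Proof.
  intros Hx. apply (epsilon_spec (inhabits 0) (fun s => 0 <= s <= 2 * PI /\ Xc z s = x)).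
  pose proof two_PI_pos as HP. pose proof level_nice as Hn.
  destruct (IVT_gen (Xc z) 0 (2 * PI) x) as [s [Hs Es]].
  - intros s. apply continuity_pt_filterlim. apply Xc_continuous, Hn.
  - rewrite Xc_0, Xc_2PI, Rmin_left, Rmax_right by (auto; lra). exact Hx.
  - rewrite Rmin_left, Rmax_right in Hs by lra. exists s. auto.
Qed.

Lemma Sc_Xc (s : R) : 0 <= s <= 2 * PI -> Sc z (Xc z s) = s.
Proof.
  intros Hs. destruct (Sc_spec (Xc z s) (Xc_range s Hs)) as [H1 H2].
  pose proof (Xc_lower_abs _ _ H1 Hs) as B. rewrite H2, Rminus_diag, Rabs_R0 in B.
  rewrite Rmult_0_r in B. apply Rabs_le_iff in B. lra.
Qed.

Lemma Sc_lip (x y : R) : 0 <= x <= 2 * PI -> 0 <= y <= 2 * PI -> Rabs (Sc z x - Sc z y) <= k * Rabs (x - y).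
Proof.
  intros Hx Hy. destruct (Sc_spec x Hx) as [H1 H2]. destruct (Sc_spec y Hy) as [H3 H4].
  pose proof (Xc_lower_abs _ _ H1 H3) as B. rewrite H2, H4 in B. exact B.
Qed.

Lemma Sc_0 : Sc z 0 = 0.
Proof. rewrite <- (Xc_0 z) at 1. apply Sc_Xc. pose proof two_PI_pos; lra. Qed.

Lemma Sc_2PI : Sc z (2 * PI) = 2 * PI.
Proof. rewrite <- (Xc_2PI z level_nice) at 1. apply Sc_Xc. pose proof two_PI_pos; lra. Qed.

Lemma Sc_open (x : R) : 0 < x < 2 * PI -> 0 < Sc z x < 2 * PI.
Proof.
  intros Hx. destruct (Sc_spec x ltac:(lra)) as [H1 H2]. pose proof (Xc_2PI z level_nice) as E.
  split.
  - destruct (Req_dec (Sc z x) 0) as [e|]; [|lra]. rewrite e, Xc_0 in H2. lra.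
  - destruct (Req_dec (Sc z x) (2 * PI)) as [e|]; [|lra]. rewrite e, E in H2. lra.
Qed.

Lemma eul_profile : profile (fun x => Vc z (Sc z x)) (fun x => slope z (Sc z x)).
Proof.
  pose proof level_pos as Hk. pose proof level_nice as Hn. split; [|split; [|split; [|split]]].
  - exists (k * k). intros x y Hx Hy. eapply Rle_trans; [apply Vc_lip|].
    rewrite Rmult_assoc. apply Rmult_le_compat_l; [lra | apply Sc_lip; auto].
  - rewrite Sc_0, Sc_2PI, Vc_0, Vc_2PI by exact Hn. reflexivity.
  - intros x Hx. pose proof (Sc_open x Hx) as Hs. destruct (Sc_spec x ltac:(lra)) as [_ Ex].
    set (s := Sc z x) in *. pose proof (level_J_pos k z s Hz Hs) as HJ.
    (* This combination has zero derivative at [s]. Substituting the Lipschitz inverse [Sc] gives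
       the derivative of [V o X^-1] directly, with no derivative of [Sc] itself. *)
    assert (D : is_derive (fun r => Vc z r - slope z s * Xc z r) s 0).
    { replace 0 with (Kc z s - slope z s * Jc z s) by (unfold slope; field; lra).
      apply (is_derive_minus (Vc z) (fun r => slope z s * Xc z r)); [apply Vc_derive; auto|].
      apply (is_derive_scal (Xc z)), Xc_derive; auto. }
    apply is_derive_of_eps. intros eps He.
    destruct (is_derive_eps _ _ _ D (eps / k)) as (d & Hd & HD); [apply Rdiv_lt_0_compat; lra|].
    destruct (locally_between _ _ _ Hx) as [d2 Hd2].
    exists (Rmin (d / k) d2).
    split; [apply Rmin_glb_lt; [apply Rdiv_lt_0_compat; lra | apply cond_pos]|].
    intros y Hy. assert (Hy2 : 0 < y < 2 * PI).
    { apply (Hd2 y). eapply Rlt_le_trans; [exact Hy | apply Rmin_r]. }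
    assert (Hy1 : k * Rabs (y - x) < d).
    { assert (Rabs (y - x) < d / k) by (eapply Rlt_le_trans; [exact Hy | apply Rmin_l]).
      replace d with (k * (d / k)) by (field; lra). apply Rmult_lt_compat_l; lra. }
    pose proof (Sc_lip y x ltac:(lra) ltac:(lra)) as HS. fold s in HS.
    specialize (HD (Sc z y) ltac:(lra)). destruct (Sc_spec y ltac:(lra)) as [_ Ey].
    rewrite Ey, Ex, Rmult_0_l, Rminus_0_r in HD.
    change (Sc z x) with s.
    replace (Vc z (Sc z y) - Vc z s - slope z s * (y - x))
      with (Vc z (Sc z y) - slope z s * y - (Vc z s - slope z s * x)) by ring.
    eapply Rle_trans; [exact HD|].
    replace (eps * Rabs (y - x)) with (eps / k * (k * Rabs (y - x))) by (field; lra).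
    apply Rmult_le_compat_l; [|exact HS]. left; apply Rdiv_lt_0_compat; lra.
  - intros x Hx. pose proof (Sc_open x Hx) as Hs.
    apply (continuous_comp (Sc z) (slope z)); [|apply (proj2 adm_slope k); auto].
    apply continuous_eps. intros eps He. destruct (locally_between _ _ _ Hx) as [d2 Hd2].
    exists (Rmin (eps / k) d2).
    split; [apply Rmin_glb_lt; [apply Rdiv_lt_0_compat; lra | apply cond_pos]|].
    intros y Hy. assert (Hy2 : 0 < y < 2 * PI).
    { apply (Hd2 y). eapply Rlt_le_trans; [exact Hy | apply Rmin_r]. }
    assert (Hy1 : Rabs (y - x) < eps / k) by (eapply Rlt_le_trans; [exact Hy | apply Rmin_l]).
    eapply Rle_lt_trans; [apply Sc_lip; lra|].
    replace eps with (k * (eps / k)) by (field; lra). apply Rmult_lt_compat_l; lra.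
  - exists (k * k). intros x Hx. apply slope_bound, Sc_open, Hx.
Qed.

End Level.

(** The Eulerian velocity [v = V o X^-1] of a Lagrangian state. *)
Definition eul (z : state) : R -> R := per (fun x => Vc z (Sc z x)).

Lemma eul_C10 (k : R) (z : state) : level k z -> C10 (eul z).
Proof. intros Hz. eapply profile_C10, eul_profile, Hz. Qed.

Lemma eul_Derive (k : R) (z : state) (x : R) : level k z -> off_peak x ->
  Derive (eul z) x = slope z (Sc z (frac x)).
Proof. intros Hz Hx. apply (per_Derive _ _ _ (eul_profile k z Hz) Hx). Qed.

Definition eul_bound (k : R) : R := k + k * (2 * PI) + k * k.

Lemma eul_norm (k : R) (z : state) : level k z -> C10_norm_le (eul z) (eul_bound k).
Proof.
  intros Hz. pose proof (level_pos k z Hz). pose proof two_PI_pos. unfold eul_bound.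
  apply profile_norm with (1 := eul_profile k z Hz).
  - intros x Hx. pose proof (Vc_bound k z Hz (Sc z x)). nra.
  - intros x Hx. pose proof (slope_bound k z Hz (Sc z x) (Sc_open k z Hz x Hx)). nra.
Qed.

Lemma eul_Xc (k : R) (z : state) (s : R) : level k z -> 0 <= s < 2 * PI -> eul z (Xc z s) = Vc z s.
Proof.
  intros Hz Hs. unfold eul, per.
  assert (Xc z s < 2 * PI) by (rewrite <- (Xc_2PI z (level_nice k z Hz)); apply (Xc_lt k); auto; lra).
  pose proof (Xc_range k z Hz s ltac:(lra)). rewrite frac_id by lra. rewrite (Sc_Xc k) by (auto; lra). reflexivity.
Qed.

Lemma eul_0 (k : R) (z : state) : level k z -> eul z 0 = z cV.
Proof.
  intros Hz. pose proof two_PI_pos. rewrite <- (Xc_0 z) at 1. rewrite (eul_Xc k) by (auto; lra). apply Vc_0.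
Qed.

Lemma Xc_near (k d s : R) (z1 z2 : state) : level k z1 -> level k z2 -> near cdom z1 z2 d ->
  Rabs (Xc z1 s - Xc z2 s) <= d * (2 * PI).
Proof.
  intros H1 H2 Hn. unfold Xc.
  replace (s + prim (fun q => z1 (cJ q)) s - (s + prim (fun q => z2 (cJ q)) s))
    with (prim (fun q => z1 (cJ q)) s - prim (fun q => z2 (cJ q)) s) by ring.
  apply prim_near; [apply H1 | apply H2|]. intros q Hq. apply Hn. exact Hq.
Qed.

Lemma Vc_near (k d s : R) (z1 z2 : state) : level k z1 -> level k z2 -> near cdom z1 z2 d ->
  Rabs (Vc z1 s - Vc z2 s) <= d * (1 + 2 * PI).
Proof.
  intros H1 H2 Hn. unfold Vc.
  replace (z1 cV + prim (Kc z1) s - (z2 cV + prim (Kc z2) s))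
    with ((z1 cV - z2 cV) + (prim (Kc z1) s - prim (Kc z2) s)) by ring.
  rewrite Rmult_plus_distr_l, Rmult_1_r. apply Rabs_plus_le; [apply Hn; exact Logic.I|].
  apply prim_near; [apply H1 | apply H2|]. intros q Hq. apply Hn. exact Hq.
Qed.

Lemma Sc_near (k d x : R) (z1 z2 : state) : level k z1 -> level k z2 -> near cdom z1 z2 d ->
  0 <= x <= 2 * PI -> Rabs (Sc z1 x - Sc z2 x) <= k * (d * (2 * PI)).
Proof.
  intros H1 H2 Hn Hx. destruct (Sc_spec k z1 H1 x Hx) as [A1 E1]. destruct (Sc_spec k z2 H2 x Hx) as [A2 E2].
  eapply Rle_trans; [apply (Xc_lower_abs k z1 H1); auto|].
  apply Rmult_le_compat_l; [pose proof (level_pos k z1 H1); lra|].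
  rewrite E1. rewrite <- E2 at 1. rewrite Rabs_minus_sym. apply (Xc_near k); auto.
Qed.

(** Values depend on the state in a Lipschitz way because [Vc] is Lipschitz in the label. No such
    bound holds for [v_x], as [slope] is merely continuous in the label. *)
Lemma eul_near (k d x : R) (z1 z2 : state) : level k z1 -> level k z2 -> near cdom z1 z2 d ->
  Rabs (eul z1 x - eul z2 x) <= (k * (k * (2 * PI)) + (1 + 2 * PI)) * d.
Proof.
  intros H1 H2 Hn. unfold eul, per. pose proof (frac_range x) as Hx.
  replace (Vc z1 (Sc z1 (frac x)) - Vc z2 (Sc z2 (frac x))) with
    ((Vc z1 (Sc z1 (frac x)) - Vc z1 (Sc z2 (frac x))) + (Vc z1 (Sc z2 (frac x)) - Vc z2 (Sc z2 (frac x)))) by ring.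
  rewrite Rmult_plus_distr_r. apply Rabs_plus_le.
  - eapply Rle_trans; [apply (Vc_lip k z1 H1)|]. rewrite !Rmult_assoc.
    apply Rmult_le_compat_l; [pose proof (level_pos k z1 H1); lra|].
    replace (k * (2 * (PI * d))) with (k * (d * (2 * PI))) by ring. apply Sc_near; auto; lra.
  - rewrite Rmult_comm. apply (Vc_near k); auto.
Qed.

(* Change of variables [y = X s] in the primitives. *)
Section Relabel.

Variables (f : R -> R) (k : R) (z : state).
Hypothesis Hf : C10 f.
Hypothesis Hz : level k z.
Hypothesis HV : forall s, 0 <= s <= 2 * PI -> f (Xc z s) = Vc z s.

Lemma relabel_K (s : R) : 0 < s < 2 * PI -> Kc z s = Derive f (Xc z s) * Jc z s.
Proof.
  intros Hs. pose proof (level_nice k z Hz) as Hn.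
  assert (D1 : is_derive (fun r => f (Xc z r)) s (Jc z s * Derive f (Xc z s))).
  { apply (is_derive_comp f (Xc z)); [|apply Xc_derive; auto].
    apply Derive_correct, (C10_derivable _ Hf), off_peak_open, (Xc_range_open k); auto. }
  assert (D2 : is_derive (fun r => f (Xc z r)) s (Kc z s)).
  { apply is_derive_ext_loc with (Vc z); [|apply Vc_derive; auto].
    generalize (locally_between _ _ _ Hs). apply filter_imp. intros r Hr. symmetry. apply HV. lra. }
  rewrite Rmult_comm. rewrite <- (is_derive_unique _ _ _ D1). symmetry. apply is_derive_unique, D2.
Qed.

Lemma relabel_F (s : R) : 0 < s < 2 * PI -> Fc z s = Jc z s * Fc (st f) (Xc z s).
Proof.
  intros Hs. pose proof (level_J_pos k z s Hz Hs). pose proof (Xc_range_open k z Hz s Hs).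
  unfold Fc. rewrite relabel_K, Jc_st, Vc_st, HV by (auto; lra). unfold Kc; simpl. field. lra.
Qed.

Lemma relabel_prim (g h : R -> R) (s : R) :
  cb g -> cb h -> (forall r, 0 < r < 2 * PI -> h r = Jc z r * g (Xc z r)) ->
  0 <= s <= 2 * PI -> prim h s = prim g (Xc z s).
Proof.
  intros Hg Hh E Hs. pose proof (level_nice k z Hz) as Hn.
  rewrite (FTC_open (fun r => prim g (Xc z r)) h s Hh); auto.
  - rewrite Xc_0, prim_0. ring.
  - intros x Hx. rewrite E by exact Hx. apply (is_derive_comp (prim g) (Xc z)).
    + apply prim_derive; auto. apply (Xc_range_open k); auto.
    + apply Xc_derive; auto.
  - intros x. apply (continuous_comp (Xc z) (prim g)); [apply Xc_continuous, Hn | apply prim_continuous, Hg].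
Qed.

(** The nonlocal term depends on the state only through [V o X^-1]: every integral in [s] becomes
    one in [y = X(s)]. *)
Lemma relabel_G (s : R) : 0 <= s <= 2 * PI -> Gc z s = Gc (st f) (Xc z s).
Proof.
  intros Hs. destruct (C10_norm_bound f Hf) as (l & Hl & Hfl).
  pose proof (st_level f Hf l Hl Hfl) as Hst. pose proof (level_nice k z Hz) as Hn.
  assert (EW : forall r, 0 <= r <= 2 * PI -> Wc z r = Wc (st f) (Xc z r)).
  { intros r Hr. apply relabel_prim; auto; [apply (adm_cb _ _ _ adm_w Hst) | apply (adm_cb _ _ _ adm_w Hz)|].
    intros q Hq. pose proof (Xc_range_open k z Hz q Hq). rewrite Jc_st, Vc_st, HV by (auto; lra). ring. }
  assert (EA : forall r, 0 <= r <= 2 * PI -> Ac z r = Ac (st f) (Xc z r)).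
  { intros r Hr. apply relabel_prim; auto; [apply (adm_cb _ _ _ adm_a Hst) | apply (adm_cb _ _ _ adm_a Hz)|].
    intros q Hq. rewrite Xc_st, relabel_F by exact Hq. ring. }
  assert (EB : forall r, 0 <= r <= 2 * PI -> Bc z r = Bc (st f) (Xc z r)).
  { intros r Hr. apply relabel_prim; auto; [apply (adm_cb _ _ _ adm_b Hst) | apply (adm_cb _ _ _ adm_b Hz)|].
    intros q Hq. rewrite Xc_st, relabel_F by exact Hq. ring. }
  pose proof two_PI_pos. unfold Gc. rewrite !EW, !EA, !EB, Xc_st by lra. rewrite Xc_2PI by exact Hn. reflexivity.
Qed.

End Relabel.

(** * Existence *)

Lemma in_time_extend (T : Rbar) (t : R) : in_time T t -> exists T1, t < T1 /\ in_time T T1.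
Proof.
  intros [H1 H2]. destruct T as [T| |]; simpl in H2.
  - exists ((t + T) / 2). split; [lra|]. split; simpl; lra.
  - exists (t + 1). split; [lra|]. split; simpl; lra || exact Logic.I.
  - contradiction.
Qed.

Lemma in_time_le (T : Rbar) (t u : R) : in_time T u -> 0 <= t <= u -> in_time T t.
Proof.
  intros [H1 H2] Ht. split; [lra|]. apply Rbar_le_lt_trans with u; [simpl; lra | exact H2].
Qed.

Lemma time_derive_eps (T : Rbar) (g : R -> R) (t l : R) :
  time_derive T g t l <->
  forall eps, 0 < eps -> exists d, 0 < d /\ forall u, in_time T u -> Rabs (u - t) < d ->
    Rabs (g u - g t - (u - t) * l) <= eps * Rabs (u - t).
Proof.
  split.
  - intros H eps He. destruct (proj1 (filterlim_locally _ _) H (mkposreal eps He)) as [d Hd].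
    exists d. split; [apply cond_pos|]. intros u Hu Hud.
    destruct (Req_dec u t) as [->|Hne].
    { rewrite !Rminus_diag, Rmult_0_l, Rminus_diag, Rabs_R0. lra. }
    specialize (Hd u Hud (conj Hu Hne)).
    change (Rabs ((g u - g t) / (u - t) - l) < eps) in Hd.
    replace (g u - g t - (u - t) * l) with (((g u - g t) / (u - t) - l) * (u - t)) by (field; lra).
    rewrite Rabs_mult. apply Rmult_le_compat_r; [apply Rabs_pos | lra].
  - intros H. apply filterlim_locally. intros eps.
    destruct (H (eps / 2)) as (d & Hd & HD); [pose proof (cond_pos eps); lra|].
    exists (mkposreal d Hd). intros u Hu [Hin Hne]. specialize (HD u Hin Hu).
    change (Rabs ((g u - g t) / (u - t) - l) < eps).
    assert (Ha : 0 < Rabs (u - t)) by (apply Rabs_pos_lt; lra).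
    replace ((g u - g t) / (u - t) - l) with ((g u - g t - (u - t) * l) / (u - t)) by (field; lra).
    unfold Rdiv. rewrite Rabs_mult, Rabs_inv.
    apply Rmult_lt_reg_r with (Rabs (u - t)); [exact Ha|].
    rewrite Rmult_assoc, Rinv_l, Rmult_1_r by lra.
    eapply Rle_lt_trans; [exact HD|]. pose proof (cond_pos eps). apply Rmult_lt_compat_r; lra.
Qed.

Lemma time_derive_quad (T : Rbar) (g : R -> R) (t T1 C l : R) :
  0 <= t -> t < T1 -> 0 <= C ->
  (forall u, 0 <= u <= T1 -> Rabs (g u - g t - (u - t) * l) <= C * (u - t) ^ 2) ->
  time_derive T g t l.
Proof.
  intros Ht HT1 HC H. apply time_derive_eps. intros eps He.
  exists (Rmin (T1 - t) (eps / (C + 1))).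
  split; [apply Rmin_glb_lt; [lra | apply Rdiv_lt_0_compat; lra]|].
  intros u [Hu _] Hud.
  assert (H1 : Rabs (u - t) < T1 - t) by (eapply Rlt_le_trans; [exact Hud | apply Rmin_l]).
  assert (H2 : Rabs (u - t) < eps / (C + 1)) by (eapply Rlt_le_trans; [exact Hud | apply Rmin_r]).
  apply Rabs_def2 in H1. eapply Rle_trans; [apply H; lra|].
  rewrite <- (pow2_abs (u - t)). set (a := Rabs (u - t)) in *. assert (0 <= a) by apply Rabs_pos.
  apply Rmult_lt_compat_l with (r := C + 1) in H2; [|lra].
  replace ((C + 1) * (eps / (C + 1))) with eps in H2 by (field; lra). nra.
Qed.

Lemma filterlim_time_space (T : Rbar) (g : R -> R -> R) (t x : R) :
  filterlim (fun p : R * R => g (fst p) (snd p))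
    (within (fun p => in_time T (fst p)) (locally (t, x))) (locally (g t x)) <->
  forall eps, 0 < eps -> exists d, 0 < d /\ forall u y, in_time T u ->
    Rabs (u - t) < d -> Rabs (y - x) < d -> Rabs (g u y - g t x) < eps.
Proof.
  split.
  - intros H eps He. destruct (proj1 (filterlim_locally _ _) H (mkposreal eps He)) as [d Hd].
    exists d. split; [apply cond_pos|]. intros u y Hu Hut Hyx.
    apply (Hd (u, y)); [|exact Hu]. split; assumption.
  - intros H. apply filterlim_locally. intros eps.
    destruct (H eps (cond_pos eps)) as (d & Hd & HD).
    exists (mkposreal d Hd). intros [u y] [H1 H2] Hin. apply HD; assumption.
Qed.

(* Chain rule along a path through [x] at time [t], using only the joint continuity of [v_x]. *)
Lemma transport_derive (T : Rbar) (v : R -> R -> R) (xi : R -> R) (t x b : R) :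
  0 < x < 2 * PI -> in_time T t ->
  (forall u, in_time T u -> C10 (v u)) ->
  filterlim (fun p : R * R => Derive (v (fst p)) (snd p))
    (within (fun p => in_time T (fst p)) (locally (t, x))) (locally (Derive (v t) x)) ->
  xi t = x -> time_derive T xi t b ->
  time_derive T (fun u => v u (xi u) - v u x) t (Derive (v t) x * b).
Proof.
  intros Hx Ht HC Hj Exi Hxi.
  pose proof (proj1 (filterlim_time_space T (fun u => Derive (v u)) t x) Hj) as Hj'.
  apply time_derive_eps. intros eps He.
  set (D := Derive (v t) x) in *.
  (* [B] is a Lipschitz constant of the path near [t]. Half of [eps] goes to the variation of [v_x]
     through [e1], the other half to the remainder of the path through [e2]. *)
  set (B := Rabs b + 1). assert (HB : 0 < B) by (unfold B; pose proof (Rabs_pos b); lra).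
  set (e1 := eps / (2 * B)). assert (He1 : 0 < e1) by (apply Rdiv_lt_0_compat; lra).
  set (e2 := Rmin 1 (eps / (2 * (Rabs D + 1)))).
  assert (HD1 : 0 < Rabs D + 1) by (pose proof (Rabs_pos D); lra).
  assert (He2 : 0 < e2) by (apply Rmin_glb_lt; [lra | apply Rdiv_lt_0_compat; lra]).
  destruct (Hj' e1 He1) as (d1 & Hd1 & HJ).
  destruct (proj1 (time_derive_eps T xi t b) Hxi e2 He2) as (d2 & Hd2 & HX).
  destruct (locally_between _ _ _ Hx) as [d3 Hd3].
  (* Radius in space within which the segment from [x] to [xi u] avoids the peak and [v_x] is close
     to its value at [(t, x)]. *)
  set (r := Rmin d1 d3). assert (Hr : 0 < r) by (apply Rmin_glb_lt; [exact Hd1 | apply cond_pos]).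
  exists (Rmin (Rmin d1 d2) (r / B)).
  split; [repeat apply Rmin_glb_lt; auto; apply Rdiv_lt_0_compat; lra|].
  intros u Hu Hut.
  assert (H1 : Rabs (u - t) < d1) by (eapply Rlt_le_trans; [exact Hut | eapply Rle_trans; [apply Rmin_l | apply Rmin_l]]).
  assert (H2 : Rabs (u - t) < d2) by (eapply Rlt_le_trans; [exact Hut | eapply Rle_trans; [apply Rmin_l | apply Rmin_r]]).
  assert (H3 : B * Rabs (u - t) < r).
  { assert (Rabs (u - t) < r / B) by (eapply Rlt_le_trans; [exact Hut | apply Rmin_r]).
    replace r with (B * (r / B)) by (field; lra). apply Rmult_lt_compat_l; lra. }
  specialize (HX u Hu H2). rewrite Exi in *.
  assert (Hxu : Rabs (xi u - x) <= B * Rabs (u - t)).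
  { replace (xi u - x) with ((xi u - x - (u - t) * b) + (u - t) * b) by ring.
    assert (e2 <= 1) by apply Rmin_l.
    eapply Rle_trans; [apply Rabs_plus_le; [exact HX | rewrite Rabs_mult; apply Rle_refl]|].
    unfold B. pose proof (Rabs_pos (u - t)). nra. }
  assert (Hmean : exists q, Rabs (q - x) < r /\ v u (xi u) - v u x = Derive (v u) q * (xi u - x)).
  { destruct (MVT_gen (v u) x (xi u) (Derive (v u))) as (q & Hq & E).
    - intros q Hq. apply Derive_correct, (C10_derivable _ (HC u Hu)), off_peak_open.
      apply (Hd3 q). change (Rabs (q - x) < d3). assert (r <= d3) by apply Rmin_r.
      apply Rle_lt_trans with (Rabs (xi u - x)); [|lra].
      unfold Rmin, Rmax in Hq. destruct Rle_dec; apply Rabs_le_iff; unfold Rabs; destruct Rcase_abs; lra.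
    - intros q Hq. apply continuity_pt_filterlim. apply (C10_continuous _ (HC u Hu)).
    - exists q. split; [|exact E]. apply Rle_lt_trans with (Rabs (xi u - x)); [|lra].
      unfold Rmin, Rmax in Hq. destruct Rle_dec; apply Rabs_le_iff; unfold Rabs; destruct Rcase_abs; lra. }
  destruct Hmean as (q & Hq & E). rewrite E, Rminus_diag, Rminus_0_r.
  assert (r <= d1) by apply Rmin_l.
  specialize (HJ u q Hu H1 ltac:(lra)). fold D in HJ.
  replace (Derive (v u) q * (xi u - x) - (u - t) * (D * b)) with
    ((Derive (v u) q - D) * (xi u - x) + D * (xi u - x - (u - t) * b)) by ring.
  apply Rle_trans with (e1 * (B * Rabs (u - t)) + Rabs D * (e2 * Rabs (u - t))).
  { apply Rabs_plus_le; apply Rabs_mult_le; auto; lra. }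
  assert (A1 : e1 * B = eps / 2) by (unfold e1; field; lra).
  assert (A2 : Rabs D * e2 <= eps / 2).
  { apply Rle_trans with (Rabs D * (eps / (2 * (Rabs D + 1)))).
    - apply Rmult_le_compat_l; [apply Rabs_pos | apply Rmin_r].
    - apply Rle_trans with ((Rabs D + 1) * (eps / (2 * (Rabs D + 1)))); [|right; field; lra].
      apply Rmult_le_compat_r; [left; apply Rdiv_lt_0_compat; lra | lra]. }
  pose proof (Rabs_pos (u - t)). nra.
Qed.

Lemma time_derive_minus (T : Rbar) (f g : R -> R) (t a b : R) :
  time_derive T f t a -> time_derive T g t b -> time_derive T (fun u => f u - g u) t (a - b).
Proof.
  intros Hf Hg. apply time_derive_eps. intros eps He.
  destruct (proj1 (time_derive_eps T f t a) Hf (eps / 2)) as (d1 & Hd1 & H1); [lra|].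
  destruct (proj1 (time_derive_eps T g t b) Hg (eps / 2)) as (d2 & Hd2 & H2); [lra|].
  exists (Rmin d1 d2). split; [apply Rmin_glb_lt; auto|]. intros u Hu Hut.
  specialize (H1 u Hu ltac:(eapply Rlt_le_trans; [exact Hut | apply Rmin_l])).
  specialize (H2 u Hu ltac:(eapply Rlt_le_trans; [exact Hut | apply Rmin_r])).
  apply Rabs_le_iff in H1. apply Rabs_le_iff in H2. apply Rabs_le_iff. lra.
Qed.

Lemma time_derive_plus (T : Rbar) (f g : R -> R) (t a b : R) :
  time_derive T f t a -> time_derive T g t b -> time_derive T (fun u => f u + g u) t (a + b).
Proof.
  intros Hf Hg. apply time_derive_eps. intros eps He.
  destruct (proj1 (time_derive_eps T f t a) Hf (eps / 2)) as (d1 & Hd1 & H1); [lra|].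
  destruct (proj1 (time_derive_eps T g t b) Hg (eps / 2)) as (d2 & Hd2 & H2); [lra|].
  exists (Rmin d1 d2). split; [apply Rmin_glb_lt; auto|]. intros u Hu Hut.
  specialize (H1 u Hu ltac:(eapply Rlt_le_trans; [exact Hut | apply Rmin_l])).
  specialize (H2 u Hu ltac:(eapply Rlt_le_trans; [exact Hut | apply Rmin_r])).
  apply Rabs_le_iff in H1. apply Rabs_le_iff in H2. apply Rabs_le_iff. lra.
Qed.

Lemma time_derive_ext (T : Rbar) (f g : R -> R) (t l : R) :
  in_time T t -> (forall u, in_time T u -> f u = g u) -> time_derive T f t l -> time_derive T g t l.
Proof.
  intros Ht E Hf. apply time_derive_eps. intros eps He.
  destruct (proj1 (time_derive_eps T f t l) Hf eps He) as (d & Hd & H).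
  exists d. split; [exact Hd|]. intros u Hu Hut. rewrite <- !E by assumption. apply H; assumption.
Qed.

(** [lag 1 cK z] is [Vc z], and [lag 0 cJ z] is the displacement [Xc z s - s]. *)
Definition lag (th : R) (c : R -> coord) (z : state) (s : R) : R := th * z cV + prim (fun q => z (c q)) s.

Definition profile_coord (c : R -> coord) : Prop := c = cJ \/ c = cK.

Lemma profile_coord_nice (c : R -> coord) (z : state) : profile_coord c -> nice z ->
  cb (fun q => z (c q)) /\ prim (fun q => z (c q)) (2 * PI) = 0.
Proof. intros [-> | ->] Hz; split; apply Hz. Qed.

Lemma profile_coord_dom (c : R -> coord) (s : R) : profile_coord c -> 0 < s < 2 * PI -> cdom (c s).
Proof. intros [-> | ->] Hs; exact Hs. Qed.

Lemma lag_lin (th a s : R) (c : R -> coord) (z w : state) : profile_coord c -> nice z -> nice w ->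
  lag th c (fun i => z i + a * w i) s = lag th c z s + a * lag th c w s.
Proof.
  intros Hc Hz Hw. unfold lag.
  rewrite (prim_lin (fun q => z (c q)) (fun q => w (c q))) by (apply profile_coord_nice; assumption). ring.
Qed.

Lemma lag_profile (th : R) (c : R -> coord) (z : state) : profile_coord c -> nice z ->
  profile (lag th c z) (fun q => z (c q)).
Proof. intros Hc Hz. apply profile_prim; apply (profile_coord_nice c z Hc Hz). Qed.

Lemma lag_bound (th B s : R) (c : R -> coord) (z : state) : profile_coord c -> nice z -> Rabs th <= 1 ->
  (forall i, cdom i -> Rabs (z i) <= B) -> Rabs (lag th c z s) <= (1 + 2 * PI) * B.
Proof.
  intros Hc Hz Hth HB. unfold lag. rewrite Rmult_plus_distr_r. apply Rabs_plus_le.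
  - apply Rabs_mult_le; [exact Hth | apply HB; exact Logic.I].
  - rewrite Rmult_comm. apply prim_bound; [apply (profile_coord_nice c z Hc Hz)|].
    intros q Hq. apply HB, profile_coord_dom; auto.
Qed.

Lemma lag_norm (th B : R) (c : R -> coord) (z : state) : profile_coord c -> nice z -> Rabs th <= 1 ->
  (forall i, cdom i -> Rabs (z i) <= B) -> C10_norm_le (per (lag th c z)) ((1 + 2 * PI) * B).
Proof.
  intros Hc Hz Hth HB. pose proof two_PI_pos.
  assert (HB0 : 0 <= B) by (eapply Rle_trans; [apply Rabs_pos | apply (HB cV Logic.I)]).
  apply profile_norm with (1 := lag_profile th c z Hc Hz).
  - intros x _. apply lag_bound; auto.
  - intros x Hx. pose proof (HB (c x) (profile_coord_dom c x Hc Hx)). nra.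
Qed.

Lemma lag_field_J (k : R) (z : state) (s : R) : level k z -> 0 <= s <= 2 * PI ->
  lag 0 cJ (field z) s = Uc z s - Uc z 0.
Proof. intros Hz Hs. unfold lag. rewrite (prim_field_J k) by auto. ring. Qed.

Lemma lag_field_K (k : R) (z : state) (s : R) : level k z -> 0 <= s <= 2 * PI ->
  lag 1 cK (field z) s = Gc z s.
Proof. intros Hz Hs. unfold lag. rewrite (prim_field_K k) by auto. simpl. ring. Qed.

Lemma lag_V (z : state) (s : R) : lag 1 cK z s = Vc z s.
Proof. unfold lag, Vc, Kc. ring. Qed.

Lemma lag_X (z : state) (s : R) : lag 0 cJ z s = Xc z s - s.
Proof. unfold lag, Xc. ring. Qed.

Definition flow (y : R -> state) (t s : R) : R := s + per (lag 0 cJ (y t)) s.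

Lemma flow_frac (k : R) (y : R -> state) (t s : R) : level k (y t) ->
  frac (flow y t s) = Xc (y t) (frac s).
Proof.
  intros Hz. destruct (frac_eq s) as [l Hl]. pose proof (frac_range s) as Hs.
  apply frac_unique with l.
  - pose proof (Xc_range k _ Hz (frac s) ltac:(lra)).
    pose proof (Xc_lt k _ Hz (frac s) (2 * PI) ltac:(lra) ltac:(lra) ltac:(lra)) as B.
    rewrite Xc_2PI in B by apply Hz. lra.
  - unfold flow, per. rewrite lag_X. lra.
Qed.

Lemma eul_flow (k : R) (y : R -> state) (t s : R) : level k (y t) ->
  eul (y t) (flow y t s) = per (lag 1 cK (y t)) s.
Proof.
  intros Hz. unfold eul, per. rewrite (flow_frac k) by exact Hz. rewrite lag_V.
  pose proof (frac_range s). rewrite (Sc_Xc k) by (auto; lra). reflexivity.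
Qed.

(** * Time regularity of trajectories in the norm of [C^1_0] *)

Section Trajectory.

Variables (T : Rbar) (z0 : state) (y : R -> state).
Hypothesis Htraj : forall T1, in_time T T1 -> exists k, traj cdom level field k T1 z0 y.

Lemma traj_data (T1 : R) : in_time T T1 -> exists k C, 0 < k /\ 0 <= C /\
  (forall u, 0 <= u <= T1 -> level k (y u)) /\
  (forall t u, 0 <= t <= T1 -> 0 <= u <= T1 -> near cdom (y u) (y t) (C * Rabs (u - t))) /\
  (forall t u i, 0 <= t <= T1 -> 0 <= u <= T1 -> cdom i ->
     Rabs (y u i - y t i - (u - t) * field (y t) i) <= C * (u - t) ^ 2).
Proof.
  intros HT1. destruct (Htraj T1 HT1) as [k Hk].
  destruct (traj_lip _ _ _ _ _ field_regular _ _ _ _ Hk) as (K & HK & H1).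
  destruct (traj_remainder _ _ _ _ _ field_regular _ _ _ _ Hk) as (C & HC & H2).
  assert (Hlev : forall u, 0 <= u <= T1 -> level k (y u)) by apply Hk.
  exists k, (K + C). split; [apply (level_pos k (y 0)), Hlev; destruct HT1; lra|].
  split; [lra|]. split; [exact Hlev|]. split.
  - intros t u Ht Hu i Hi. eapply Rle_trans; [apply H1; auto|].
    apply Rmult_le_compat_r; [apply Rabs_pos | lra].
  - intros t u i Ht Hu Hi. eapply Rle_trans; [apply H2; auto|].
    apply Rmult_le_compat_r; [apply pow2_ge_0 | lra].
Qed.

Lemma traj_level (t : R) : in_time T t -> exists k, level k (y t).
Proof.
  intros Ht. destruct (traj_data t Ht) as (k & C & _ & _ & H & _). exists k. apply H.
  destruct Ht; lra.
Qed.

(** Writes the Taylor remainder as the [lag] of a single state, so that [lag_norm] bounds it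
    together with its space derivative. *)
Lemma lag_remainder (th : R) (c : R -> coord) (k t u : R) : profile_coord c ->
  level k (y t) -> level k (y u) ->
  per (lag th c (fun i => (y u i + -1 * y t i) + - (u - t) * field (y t) i)) =
  (fun x => per (lag th c (y u)) x - per (lag th c (y t)) x - (u - t) * per (lag th c (field (y t))) x).
Proof.
  intros Hc Ht Hu. assert (N1 := level_nice _ _ Ht). assert (N2 := level_nice _ _ Hu).
  assert (N3 := field_nice _ _ Ht).
  apply functional_extensionality. intros x. unfold per.
  rewrite (lag_lin th (- (u - t)) (frac x) c (fun i => y u i + -1 * y t i)) by (auto; apply nice_lin; auto).
  rewrite (lag_lin th (-1)) by auto. ring.
Qed.

(** [lag] is linear and bounded from the supremum norm on states to [C^1_0]. The quadratic remainder
    of a trajectory therefore gives differentiability, and the Lipschitz bound of [field] gives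
    continuity of the derivative. *)
Lemma lag_C1 (th : R) (c : R -> coord) : profile_coord c -> Rabs th <= 1 ->
  C1_time_C10 T (fun t => per (lag th c (y t))).
Proof.
  intros Hc Hth. exists (fun t => per (lag th c (field (y t)))). pose proof two_PI_pos as HP.
  split; [|split].
  - intros t Ht. destruct (traj_level t Ht) as [k Hk]. assert (N := level_nice _ _ Hk).
    assert (N2 := field_nice _ _ Hk). split; eapply profile_C10; apply lag_profile; eauto.
  - intros t Ht eps He. destruct (in_time_extend T t Ht) as (T1 & HtT & HT1).
    destruct (traj_data T1 HT1) as (k & C & Hk & HC & Hlev & _ & Hrem).
    assert (Ht0 : 0 <= t) by apply Ht.
    exists (Rmin (T1 - t) (eps / ((1 + 2 * PI) * (C + 1)))).
    assert (HM : 0 < (1 + 2 * PI) * (C + 1)) by nra.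
    split; [apply Rmin_glb_lt; [lra | apply Rdiv_lt_0_compat; lra]|].
    intros u Hu Hut. assert (Hu0 : 0 <= u) by apply Hu.
    assert (H1 : Rabs (u - t) < T1 - t) by (eapply Rlt_le_trans; [exact Hut | apply Rmin_l]).
    assert (H2 : Rabs (u - t) < eps / ((1 + 2 * PI) * (C + 1))) by (eapply Rlt_le_trans; [exact Hut | apply Rmin_r]).
    apply Rabs_def2 in H1.
    rewrite <- (lag_remainder th c k t u Hc) by (apply Hlev; lra).
    assert (B : C10_norm_le (per (lag th c (fun i => y u i + -1 * y t i + - (u - t) * field (y t) i)))
       ((1 + 2 * PI) * (C * (u - t) ^ 2))).
    { apply lag_norm; auto.
      - apply nice_lin; [apply nice_lin|].
        + apply (level_nice k), Hlev; lra.
        + apply (level_nice k), Hlev; lra.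
        + apply (field_nice k), Hlev; lra.
      - intros i Hi. replace (y u i + -1 * y t i + - (u - t) * field (y t) i) with
         (y u i - y t i - (u - t) * field (y t) i) by ring. apply Hrem; auto; lra. }
    assert (B2 : (1 + 2 * PI) * (C * (u - t) ^ 2) <= eps * Rabs (u - t)).
    { rewrite <- (pow2_abs (u - t)). set (a := Rabs (u - t)) in *. assert (0 <= a) by apply Rabs_pos.
      apply Rmult_lt_compat_l with (r := (1 + 2 * PI) * (C + 1)) in H2; [|lra].
      replace ((1 + 2 * PI) * (C + 1) * (eps / ((1 + 2 * PI) * (C + 1)))) with eps in H2 by (field; split; lra).
      assert (0 <= (1 + 2 * PI) * a) by nra.
      replace ((1 + 2 * PI) * (C * a ^ 2)) with ((1 + 2 * PI) * a * C * a) by ring. nra. }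
    destruct B as [Ba Bb]. split; intros x; [|intros Hx]; [pose proof (Ba x) | pose proof (Bb x Hx)]; lra.
  - intros t Ht eps He. destruct (in_time_extend T t Ht) as (T1 & HtT & HT1).
    destruct (traj_data T1 HT1) as (k & C & Hk & HC & Hlev & Hlip & _).
    destruct (vf_lip _ _ _ _ _ field_regular k) as (L & HL & _ & Hl).
    assert (Ht0 : 0 <= t) by apply Ht.
    assert (HM : 0 < (1 + 2 * PI) * (L * (C + 1))) by (apply Rmult_lt_0_compat; nra).
    exists (Rmin (T1 - t) (eps / ((1 + 2 * PI) * (L * (C + 1))))).
    split; [apply Rmin_glb_lt; [lra | apply Rdiv_lt_0_compat; lra]|].
    intros u Hu Hut. assert (Hu0 : 0 <= u) by apply Hu.
    assert (H1 : Rabs (u - t) < T1 - t) by (eapply Rlt_le_trans; [exact Hut | apply Rmin_l]).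
    assert (H2 : Rabs (u - t) < eps / ((1 + 2 * PI) * (L * (C + 1)))) by (eapply Rlt_le_trans; [exact Hut | apply Rmin_r]).
    apply Rabs_def2 in H1.
    assert (Nt := field_nice k (y t) ltac:(apply Hlev; lra)).
    assert (Nu := field_nice k (y u) ltac:(apply Hlev; lra)).
    replace (fun x => per (lag th c (field (y u))) x - per (lag th c (field (y t))) x) with
      (per (lag th c (fun i => field (y u) i + -1 * field (y t) i))).
    2:{ apply functional_extensionality. intros x. unfold per. rewrite lag_lin by auto. ring. }
    assert (B : C10_norm_le (per (lag th c (fun i => field (y u) i + -1 * field (y t) i)))
       ((1 + 2 * PI) * (L * (C * Rabs (u - t))))).
    { apply lag_norm; auto; [apply nice_lin; auto|].
      intros i Hi. replace (field (y u) i + -1 * field (y t) i) with (field (y u) i - field (y t) i) by ring.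
      apply Hl; auto; [apply Hlev; lra | apply Hlev; lra | apply Hlip; lra]. }
    assert (B2 : (1 + 2 * PI) * (L * (C * Rabs (u - t))) <= eps).
    { set (a := Rabs (u - t)) in *. assert (0 <= a) by apply Rabs_pos.
      apply Rmult_lt_compat_l with (r := (1 + 2 * PI) * (L * (C + 1))) in H2; [|lra].
      replace ((1 + 2 * PI) * (L * (C + 1)) * (eps / ((1 + 2 * PI) * (L * (C + 1))))) with eps in H2.
      2:{ field. repeat split; lra. }
      assert (0 <= (1 + 2 * PI) * L * a) by (apply Rmult_le_pos; [nra|lra]). nra. }
    destruct B as [Ba Bb]. split; intros x; [|intros Hx]; [pose proof (Ba x) | pose proof (Bb x Hx)]; lra.
Qed.

Lemma lag_time_derive (th : R) (c : R -> coord) (t s : R) : profile_coord c -> Rabs th <= 1 -> in_time T t ->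
  0 <= s < 2 * PI -> time_derive T (fun u => lag th c (y u) s) t (lag th c (field (y t)) s).
Proof.
  intros Hc Hth Ht Hs. destruct (in_time_extend T t Ht) as (T1 & HtT & HT1).
  destruct (traj_data T1 HT1) as (k & C & Hk & HC & Hlev & _ & Hrem).
  assert (Ht0 : 0 <= t) by apply Ht. pose proof two_PI_pos as HP.
  apply time_derive_quad with T1 ((1 + 2 * PI) * C); auto; [nra|].
  intros u Hu. pose proof (lag_remainder th c k t u Hc ltac:(apply Hlev; lra) ltac:(apply Hlev; lra)) as E.
  apply (f_equal (fun g => g s)) in E. unfold per in E. rewrite frac_id in E by lra. rewrite <- E.
  rewrite Rmult_assoc. apply lag_bound; auto.
  - apply nice_lin; [apply nice_lin|].
    + apply (level_nice k), Hlev; lra.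
    + apply (level_nice k), Hlev; lra.
    + apply (field_nice k), Hlev; lra.
  - intros i Hi. replace (y u i + -1 * y t i + - (u - t) * field (y t) i) with
      (y u i - y t i - (u - t) * field (y t) i) by ring. apply Hrem; auto; lra.
Qed.

Lemma profile_coord_J : profile_coord cJ.
Proof. left; reflexivity. Qed.

Lemma profile_coord_K : profile_coord cK.
Proof. right; reflexivity. Qed.

Lemma Xc_time_derive (t s : R) : in_time T t -> 0 <= s < 2 * PI ->
  time_derive T (fun u => Xc (y u) s) t (phiR (Xc (y t) s) - phiR 0 + Vc (y t) s - y t cV).
Proof.
  intros Ht Hs. destruct (traj_level t Ht) as [k Hk].
  pose proof (lag_time_derive 0 cJ t s profile_coord_J ltac:(rewrite Rabs_R0; lra) Ht Hs) as H.
  rewrite (lag_field_J k) in H by (auto; lra). unfold Uc in H. rewrite Xc_0, Vc_0 in H.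
  replace (phiR (Xc (y t) s) - phiR 0 + Vc (y t) s - y t cV) with
    (phiR (Xc (y t) s) + Vc (y t) s - (phiR 0 + y t cV)) by ring.
  apply time_derive_eps. intros eps He.
  destruct (proj1 (time_derive_eps _ _ _ _) H eps He) as (d & Hd & HD). exists d. split; [exact Hd|].
  intros u Hu Hut. specialize (HD u Hu Hut). rewrite !lag_X in HD.
  replace (Xc (y u) s - Xc (y t) s) with (Xc (y u) s - s - (Xc (y t) s - s)) by ring. exact HD.
Qed.

Lemma Vc_time_derive (t s : R) : in_time T t -> 0 <= s < 2 * PI ->
  time_derive T (fun u => Vc (y u) s) t (Gc (y t) s).
Proof.
  intros Ht Hs. destruct (traj_level t Ht) as [k Hk].
  pose proof (lag_time_derive 1 cK t s profile_coord_K ltac:(rewrite Rabs_R1; lra) Ht Hs) as H.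
  rewrite (lag_field_K k) in H by (auto; lra).
  apply time_derive_ext with (3 := H); [exact Ht|]. intros u _. apply lag_V.
Qed.

Lemma flow_is_flow : (forall s, 0 < s < 2 * PI -> z0 (cJ s) = 0) -> in_time T 0 ->
  is_flow T (fun t => eul (y t)) (flow y).
Proof.
  intros H0 HT0. split.
  - intros s. unfold flow, per, lag.
    rewrite (prim_ext _ (fun _ => 0)); [rewrite prim_zero; ring|].
    intros q Hq. destruct (Htraj 0 HT0) as [k (_ & E & _)]. rewrite E by exact Hq. apply H0, Hq.
  - intros t s Ht. destruct (traj_level t Ht) as [k Hk]. pose proof (frac_range s) as Hs.
    pose proof (Xc_time_derive t (frac s) Ht Hs) as H.
    rewrite (eul_flow k), (eul_0 k), c_phiR, phi_per by exact Hk.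
    unfold per. rewrite lag_V, (flow_frac k) by exact Hk.
    apply time_derive_eps. intros eps He.
    destruct (proj1 (time_derive_eps _ _ _ _) H eps He) as (d & Hd & HD). exists d. split; [exact Hd|].
    intros u Hu Hut. specialize (HD u Hu Hut). unfold flow, per. rewrite !lag_X.
    replace (s + (Xc (y u) (frac s) - frac s) - (s + (Xc (y t) (frac s) - frac s)))
      with (Xc (y u) (frac s) - Xc (y t) (frac s)) by ring. exact HD.
Qed.

End Trajectory.

Lemma small_factor (M eps : R) : 0 <= M -> 0 < eps -> exists d, 0 < d /\ M * d < eps.
Proof.
  intros HM He. exists (eps / (2 * (M + 1))). split; [apply Rdiv_lt_0_compat; lra|].
  apply Rle_lt_trans with ((M + 1) * (eps / (2 * (M + 1)))).
  - apply Rmult_le_compat_r; [|lra]. left; apply Rdiv_lt_0_compat; lra.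
  - replace ((M + 1) * (eps / (2 * (M + 1)))) with (eps / 2) by (field; lra). lra.
Qed.

(** * The Eulerian velocity of a trajectory solves the equation *)

Section Solution.

Variables (T : Rbar) (v0 : R -> R) (y : R -> state).
Hypothesis HT : Rbar_lt 0 T.
Hypothesis Hv0 : C10 v0.
Hypothesis Htraj : forall T1, in_time T T1 -> exists k, traj cdom level field k T1 (st v0) y.

Lemma sol_space_time_continuous (t x : R) : in_time T t ->
  filterlim (fun p : R * R => eul (y (fst p)) (snd p))
    (within (fun p => in_time T (fst p)) (locally (t, x))) (locally (eul (y t) x)).
Proof.
  intros Ht. apply (filterlim_time_space T (fun t => eul (y t)) t x).
  destruct (in_time_extend T t Ht) as (T1 & HtT & HT1). assert (Ht0 : 0 <= t) by apply Ht.
  destruct (traj_data T (st v0) y Htraj T1 HT1) as (k & C & Hk & HC & Hlev & Hlip & _).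
  pose proof two_PI_pos as HP. intros eps He.
  set (M := k * (k * (2 * PI)) + (1 + 2 * PI)).
  assert (HM : 0 <= M) by (unfold M; nra).
  assert (HB : 0 <= eul_bound k) by (unfold eul_bound; nra).
  destruct (small_factor (M * C + eul_bound k) eps) as (d & Hd & Hde); [nra | exact He |].
  exists (Rmin d (T1 - t)). split; [apply Rmin_glb_lt; lra|].
  intros u x' Hu Hut Hx. assert (Hu0 : 0 <= u) by apply Hu.
  assert (H1 : Rabs (u - t) < d) by (eapply Rlt_le_trans; [exact Hut | apply Rmin_l]).
  assert (H2 : Rabs (u - t) < T1 - t) by (eapply Rlt_le_trans; [exact Hut | apply Rmin_r]).
  assert (H3 : Rabs (x' - x) < d) by (eapply Rlt_le_trans; [exact Hx | apply Rmin_l]).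
  apply Rabs_def2 in H2.
  assert (Lt := Hlev t ltac:(lra)). assert (Lu := Hlev u ltac:(lra)).
  pose proof (C10_lip _ (eul_C10 k _ Lu) _ x' x (eul_norm k _ Lu)) as B1.
  pose proof (eul_near k _ x _ _ Lu Lt (Hlip t u ltac:(lra) ltac:(lra))) as B2. fold M in B2.
  replace (eul (y u) x' - eul (y t) x) with ((eul (y u) x' - eul (y u) x) + (eul (y u) x - eul (y t) x)) by ring.
  eapply Rle_lt_trans; [apply Rabs_plus_le; [exact B1 | exact B2]|].
  eapply Rle_lt_trans; [|exact Hde].
  assert (eul_bound k * Rabs (x' - x) <= eul_bound k * d) by (apply Rmult_le_compat_l; lra).
  assert (M * (C * Rabs (u - t)) <= M * (C * d)) by (repeat apply Rmult_le_compat_l; lra). lra.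
Qed.

(** Two effects are separated: the label [Sc] of the moving point stays near [s], where the profile
    at time [t] is continuous, and at a fixed label the profile is Lipschitz in the state. *)
Lemma sol_derive_time_continuous (t x : R) : in_time T t -> off_peak x ->
  filterlim (fun p : R * R => Derive (eul (y (fst p))) (snd p))
    (within (fun p => in_time T (fst p)) (locally (t, x))) (locally (Derive (eul (y t)) x)).
Proof.
  intros Ht Hx. apply (filterlim_time_space T (fun t => Derive (eul (y t))) t x).
  destruct (in_time_extend T t Ht) as (T1 & HtT & HT1). assert (Ht0 : 0 <= t) by apply Ht.
  destruct (traj_data T (st v0) y Htraj T1 HT1) as (k & C & Hk & HC & Hlev & Hlip & _).
  pose proof two_PI_pos as HP. intros eps He.
  assert (Lt := Hlev t ltac:(lra)).
  destruct (proj1 adm_slope k) as (B & HB & _ & HBl).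
  pose proof (off_peak_frac x Hx) as Hfx. pose proof (Sc_open k _ Lt _ Hfx) as Hs.
  set (s := Sc (y t) (frac x)) in *.
  pose proof (proj2 adm_slope k _ _ Lt Hs) as Hcont.
  destruct (proj1 (continuous_eps _ _) Hcont (eps / 2) ltac:(lra)) as (d1 & Hd1 & HD1).
  destruct (small_factor (B * C) (eps / 2)) as (d2 & Hd2 & HD2); [nra | lra |].
  destruct (small_factor (k + k * (C * (2 * PI))) d1) as (d3 & Hd3 & HD3); [| exact Hd1 |].
  { assert (0 <= C * (2 * PI)) by nra. nra. }
  destruct (frac_local x Hx) as [d4 Hd4].
  exists (Rmin (Rmin d2 d3) (Rmin d4 (T1 - t))).
  split; [repeat apply Rmin_glb_lt; auto; [apply cond_pos | lra]|].
  intros u x' Hu Hut Hxx. assert (Hu0 : 0 <= u) by apply Hu.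
  pose proof (Rmin_l (Rmin d2 d3) (Rmin d4 (T1 - t))). pose proof (Rmin_r (Rmin d2 d3) (Rmin d4 (T1 - t))).
  pose proof (Rmin_l d2 d3). pose proof (Rmin_r d2 d3).
  pose proof (Rmin_l d4 (T1 - t)). pose proof (Rmin_r d4 (T1 - t)).
  assert (Hu2 : Rabs (u - t) < T1 - t) by lra. apply Rabs_def2 in Hu2.
  assert (Lu := Hlev u ltac:(lra)).
  destruct (Hd4 x') as [Hf1 Hf2]. { change (Rabs (x' - x) < d4). lra. }
  pose proof (frac_range x') as Hf3.
  rewrite (eul_Derive k) by (auto using frac_off_peak). rewrite (eul_Derive k _ x) by auto. fold s.
  assert (Hs' := Sc_open k _ Lu (frac x') ltac:(lra)). set (s' := Sc (y u) (frac x')) in *.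
  assert (B1 : Rabs (s' - s) < d1).
  { replace (s' - s) with ((s' - Sc (y u) (frac x)) + (Sc (y u) (frac x) - s)) by ring.
    pose proof (Sc_lip k _ Lu (frac x') (frac x) ltac:(lra) ltac:(lra)) as A1. fold s' in A1.
    replace (frac x' - frac x) with (x' - x) in A1 by lra.
    pose proof (Sc_near k _ (frac x) _ _ Lu Lt (Hlip t u ltac:(lra) ltac:(lra)) ltac:(lra)) as A2. fold s in A2.
    eapply Rle_lt_trans; [apply Rabs_plus_le; [exact A1 | exact A2]|].
    eapply Rle_lt_trans; [|exact HD3].
    assert (k * Rabs (x' - x) <= k * d3) by (apply Rmult_le_compat_l; lra).
    assert (k * (C * Rabs (u - t) * (2 * PI)) <= k * (C * d3 * (2 * PI))).
    { apply Rmult_le_compat_l; [lra|]. apply Rmult_le_compat_r; [lra|]. apply Rmult_le_compat_l; lra. }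
    lra. }
  specialize (HD1 s' B1).
  pose proof (HBl _ _ _ s' Lu Lt (Hlip t u ltac:(lra) ltac:(lra)) Hs') as A.
  assert (B * (C * Rabs (u - t)) <= B * (C * d2)) by (repeat apply Rmult_le_compat_l; lra).
  apply Rabs_le_iff in A. apply Rabs_def2 in HD1. apply Rabs_def1; lra.
Qed.

Lemma eul_initial (x : R) : eul (y 0) x = v0 x.
Proof.
  assert (HT0 : in_time T 0) by (split; [lra | exact HT]).
  destruct (Htraj 0 HT0) as [k Hk]. pose proof Hk as (_ & E & Hlev & _).
  pose proof (Hlev 0 ltac:(lra)) as L0.
  assert (EX : forall s, Xc (y 0) s = s).
  { intros s. unfold Xc. rewrite (prim_ext _ (fun _ => 0)); [rewrite prim_zero; ring|].
    intros q Hq. rewrite E by exact Hq. reflexivity. }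
  assert (EV : forall s, 0 <= s <= 2 * PI -> Vc (y 0) s = v0 s).
  { intros s Hs. rewrite <- (Vc_st v0 Hv0) by exact Hs. unfold Vc. rewrite E by exact Logic.I. f_equal.
    apply prim_ext. intros q Hq. unfold Kc. rewrite E by exact Hq. reflexivity. }
  unfold eul, per. rewrite (periodic_frac v0 x) by apply (C10_periodic _ Hv0).
  pose proof (frac_range x) as Hx.
  destruct (Sc_spec k _ L0 (frac x) ltac:(lra)) as [H1 H2]. rewrite EX in H2. rewrite H2. apply EV. lra.
Qed.

(** The derivative along the characteristic through [x] is [Gc]; subtracting the transport
    contribution from [transport_derive] leaves the derivative at fixed [x]. The inverse of [X] is
    never differentiated in time. *)
Lemma eul_equation (t x : R) : in_time T t -> - PI <= x <= PI -> x <> 0 ->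
  time_derive T (fun u => eul (y u) x) t (rhs (eul (y t)) x).
Proof.
  intros Ht Hx Hx0. destruct (traj_level T (st v0) y Htraj t Ht) as [k Hk].
  pose proof PI_RGT_0 as HPI.
  assert (Hop : off_peak x).
  { apply frac_off_peak. destruct (Rlt_dec 0 x).
    - rewrite frac_id; lra.
    - rewrite (frac_unique x (x + 2 * PI) (-1)%Z); lra. }
  pose proof (off_peak_frac x Hop) as Hf. set (r := frac x) in *.
  rewrite (rhs_formula _ (eul_C10 k _ Hk)) by auto. fold r.
  pose proof (Sc_open k _ Hk r Hf) as Hs. destruct (Sc_spec k _ Hk r ltac:(lra)) as [_ Er].
  set (s := Sc (y t) r) in *.
  assert (Ev : eul (y t) r = Vc (y t) s) by (rewrite <- Er; apply (eul_Xc k); auto; lra).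
  rewrite <- Er at 4. rewrite <- (relabel_G (eul (y t)) k (y t)); auto; [|apply (eul_C10 k); auto| |lra].
  2:{ intros q Hq. destruct (Req_dec q (2 * PI)) as [->|].
      - rewrite Xc_2PI, Vc_2PI by apply (level_nice k _ Hk). rewrite <- (Rplus_0_l (2 * PI)).
        rewrite (C10_periodic _ (eul_C10 k _ Hk)). apply (eul_0 k); auto.
      - apply (eul_Xc k); auto; lra. }
  rewrite (eul_0 k), Ev by exact Hk.
  pose proof (Xc_time_derive T (st v0) y Htraj t s Ht ltac:(lra)) as DX. rewrite Er in DX.
  pose proof (Vc_time_derive T (st v0) y Htraj t s Ht ltac:(lra)) as DV.
  pose proof (transport_derive T (fun u => eul (y u)) (fun u => Xc (y u) s) t r (phiR r - phiR 0 + Vc (y t) s - y t cV) Hf Ht) as H.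
  assert (DT : time_derive T (fun u => eul (y u) (Xc (y u) s) - eul (y u) r) t
     (Derive (eul (y t)) r * (phiR r - phiR 0 + Vc (y t) s - y t cV))).
  { apply H; auto.
    - intros u Hu. destruct (traj_level T (st v0) y Htraj u Hu) as [l Hl]. apply (eul_C10 l), Hl.
    - apply sol_derive_time_continuous; [exact Ht | apply off_peak_open, Hf]. }
  assert (DVX : time_derive T (fun u => eul (y u) (Xc (y u) s)) t (Gc (y t) s)).
  { apply time_derive_ext with (3 := DV); [exact Ht|]. intros u Hu.
    destruct (traj_level T (st v0) y Htraj u Hu) as [l Hl]. symmetry. apply (eul_Xc l); auto; lra. }
  pose proof (time_derive_minus _ _ _ _ _ _ DVX DT) as D.
  match type of D with time_derive _ _ _ ?l => match goal with |- time_derive _ _ _ ?l' =>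
    replace l' with l by ring end end.
  apply time_derive_ext with (3 := D); [exact Ht|]. intros u Hu.
  replace (eul (y u) x) with (eul (y u) r); [ring|].
  unfold eul, per, r. rewrite (frac_id (frac x)) by apply frac_range. reflexivity.
Qed.

Theorem eul_is_solution : is_solution v0 T (fun t => eul (y t)).
Proof.
  constructor.
  - intros t Ht. destruct (traj_level T (st v0) y Htraj t Ht) as [k Hk]. apply (eul_C10 k), Hk.
  - intros T1 HT1. destruct (Htraj T1 HT1) as [k (_ & _ & Hlev & _)].
    exists (eul_bound k). intros t Ht. apply eul_norm. apply Hlev, Ht.
  - apply sol_space_time_continuous.
  - apply sol_derive_time_continuous.
  - apply eul_equation.
  - apply eul_initial.
Qed.

End Solution.

(** * Uniqueness *)

Section Time_calculus.

Variables (T : Rbar) (T1 : R) (g l : R -> R).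
Hypothesis HT1 : in_time T T1.
Hypothesis Hg : forall t, 0 <= t <= T1 -> time_derive T g t (l t).

Lemma clamped_continuous (x : R) : continuous (fun t => g (clamp 0 T1 t)) x.
Proof.
  assert (H0 : 0 <= T1) by apply HT1.
  pose proof (clamp_in 0 T1 x H0) as Hx. set (x' := clamp 0 T1 x) in *.
  apply continuous_eps. intros eps He. fold x'.
  destruct (proj1 (time_derive_eps T g x' (l x')) (Hg x' Hx) 1 Rlt_0_1) as (d & Hd & HD).
  destruct (small_factor (Rabs (l x') + 1) eps) as (e & He0 & Hee); [pose proof (Rabs_pos (l x')); lra | exact He|].
  exists (Rmin d e). split; [apply Rmin_glb_lt; auto|]. intros t Ht.
  pose proof (clamp_in 0 T1 t H0) as Ht'. pose proof (clamp_lip 0 T1 x t) as Hl. fold x' in Hl.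
  set (t' := clamp 0 T1 t) in *. pose proof (Rmin_l d e). pose proof (Rmin_r d e).
  specialize (HD t' (in_time_le T t' T1 HT1 Ht') ltac:(lra)).
  assert (B : Rabs ((t' - x') * l x') <= Rabs (t' - x') * Rabs (l x')) by (rewrite Rabs_mult; lra).
  replace (g t' - g x') with ((g t' - g x' - (t' - x') * l x') + (t' - x') * l x') by ring.
  eapply Rle_lt_trans; [apply Rabs_plus_le; [exact HD | exact B]|].
  eapply Rle_lt_trans; [|exact Hee].
  replace (1 * Rabs (t' - x') + Rabs (t' - x') * Rabs (l x')) with ((Rabs (l x') + 1) * Rabs (t' - x')) by ring.
  apply Rmult_le_compat_l; [pose proof (Rabs_pos (l x')); lra | lra].
Qed.

Lemma clamped_derive (x : R) : 0 < x < T1 -> is_derive (fun t => g (clamp 0 T1 t)) x (l x).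
Proof.
  intros Hx. apply is_derive_ext_loc with g.
  - generalize (locally_between _ _ _ Hx). apply filter_imp. intros t Ht. rewrite clamp_id by lra. reflexivity.
  - apply is_derive_of_eps. intros eps He.
    destruct (proj1 (time_derive_eps T g x (l x)) (Hg x ltac:(lra)) eps He) as (d & Hd & HD).
    destruct (locally_between _ _ _ Hx) as [d2 Hd2].
    exists (Rmin d d2). split; [apply Rmin_glb_lt; [exact Hd | apply cond_pos]|]. intros t Ht.
    pose proof (Rmin_l d d2). pose proof (Rmin_r d d2).
    assert (Ht2 : 0 < t < T1). { apply (Hd2 t). change (Rabs (t - x) < d2). lra. }
    rewrite (Rmult_comm (l x)). apply HD; [|lra]. apply (in_time_le T t T1 HT1). lra.
Qed.

Lemma time_mvt (a b M : R) : 0 <= a -> a <= b -> b <= T1 ->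
  (forall t, a < t < b -> Rabs (l t) <= M) -> Rabs (g b - g a) <= M * (b - a).
Proof.
  intros H1 H2 H3 HM.
  pose proof (MVT_bound (fun t => g (clamp 0 T1 t)) l a b M H2) as B. simpl in B.
  rewrite !clamp_id in B by lra. apply B.
  - intros x Hx. apply clamped_derive. lra.
  - intros x _. apply clamped_continuous.
  - exact HM.
Qed.

Lemma clamped_extension : exists gh : R -> R,
  (forall x, 0 <= x <= T1 -> gh x = g x) /\ (forall x, 0 < x < T1 -> is_derive gh x (l x)) /\
  forall x, continuous gh x.
Proof.
  exists (fun t => g (clamp 0 T1 t)). split; [|split].
  - intros x Hx. rewrite clamp_id by exact Hx. reflexivity.
  - apply clamped_derive.
  - apply clamped_continuous.
Qed.

(** [g ^ 2 * exp (- 2 L t)] is nonincreasing; squaring avoids differentiating an absolute value. *)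
Lemma growth_upper (L t : R) : (forall t, 0 <= t <= T1 -> Rabs (l t) <= L * Rabs (g t)) ->
  0 <= t <= T1 -> Rabs (g t) <= Rabs (g 0) * exp (L * t).
Proof.
  intros HL Ht.
  destruct clamped_extension as (gh & Eg & Dg & Cg).
  set (h := fun x => gh x ^ 2 * exp (- (2 * L * x))).
  assert (Hh : h t <= h 0).
  { destruct (Req_dec t 0) as [->|Hne]; [lra|].
    destruct (MVT_open h (fun x => (2 * g x * l x - 2 * L * g x ^ 2) * exp (- (2 * L * x))) 0 t) as (q & Hq & E); try lra.
    - intros x Hx. unfold h. pose proof (Dg x ltac:(lra)) as D.
      auto_derive; [eexists; exact D|].
      rewrite (is_derive_unique (fun r : R => gh r) _ _ D), Eg by lra. ring.
    - intros x _. unfold h.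
      apply (continuous_mult (fun x => gh x ^ 2) (fun x => exp (- (2 * L * x)))).
      + apply (continuous_comp gh (fun y => y ^ 2)); [apply Cg|].
        apply (ex_derive_continuous (V := R_NormedModule)). auto_derive. exact Logic.I.
      + apply (ex_derive_continuous (V := R_NormedModule)). auto_derive. exact Logic.I.
    - assert (B : 2 * g q * l q <= 2 * L * g q ^ 2).
      { specialize (HL q ltac:(lra)). pose proof (Rle_abs (g q * l q)) as B1. rewrite Rabs_mult in B1.
        rewrite <- (pow2_abs (g q)). pose proof (Rabs_pos (g q)). nra. }
      pose proof (exp_pos (- (2 * L * q))).
      assert ((2 * g q * l q - 2 * L * g q ^ 2) * exp (- (2 * L * q)) <= 0) by nra. nra. }
  unfold h in Hh. rewrite !Eg in Hh by lra. rewrite Rmult_0_r, Ropp_0, exp_0, Rmult_1_r in Hh.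
  apply Rsqr_incr_0_var; [|apply Rmult_le_pos; [apply Rabs_pos | left; apply exp_pos]].
  unfold Rsqr. replace (Rabs (g t) * Rabs (g t)) with (g t ^ 2) by (rewrite <- pow2_abs; ring).
  replace (Rabs (g 0) * exp (L * t) * (Rabs (g 0) * exp (L * t))) with (g 0 ^ 2 * exp (2 * L * t)).
  2:{ rewrite <- (pow2_abs (g 0)). replace (2 * L * t) with (L * t + L * t) by ring. rewrite exp_plus. ring. }
  apply Rmult_le_compat_r with (r := exp (2 * L * t)) in Hh; [|left; apply exp_pos].
  rewrite Rmult_assoc, <- exp_plus in Hh.
  replace (- (2 * L * t) + 2 * L * t) with 0 in Hh by ring. rewrite exp_0, Rmult_1_r in Hh. exact Hh.
Qed.

(** The reverse estimate: [g ^ 2 * exp (2 L t)] is nondecreasing. It serves to show that two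
    characteristics never meet. *)
Lemma growth_nonzero (L t : R) : (forall t, 0 <= t <= T1 -> Rabs (l t) <= L * Rabs (g t)) ->
  0 <= t <= T1 -> g 0 <> 0 -> g t <> 0.
Proof.
  intros HL Ht H0.
  destruct clamped_extension as (gh & Eg & Dg & Cg).
  set (h := fun x => gh x ^ 2 * exp (2 * L * x)).
  assert (Hh : h 0 <= h t).
  { destruct (Req_dec t 0) as [->|Hne]; [lra|].
    destruct (MVT_open h (fun x => (2 * g x * l x + 2 * L * g x ^ 2) * exp (2 * L * x)) 0 t) as (q & Hq & E); try lra.
    - intros x Hx. unfold h. pose proof (Dg x ltac:(lra)) as D.
      auto_derive; [eexists; exact D|].
      rewrite (is_derive_unique (fun r : R => gh r) _ _ D), Eg by lra. ring.
    - intros x _. unfold h.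
      apply (continuous_mult (fun x => gh x ^ 2) (fun x => exp (2 * L * x))).
      + apply (continuous_comp gh (fun y => y ^ 2)); [apply Cg|].
        apply (ex_derive_continuous (V := R_NormedModule)). auto_derive. exact Logic.I.
      + apply (ex_derive_continuous (V := R_NormedModule)). auto_derive. exact Logic.I.
    - assert (B : - (2 * L * g q ^ 2) <= 2 * g q * l q).
      { specialize (HL q ltac:(lra)). pose proof (Rle_abs (- (g q * l q))) as B1. rewrite Rabs_Ropp, Rabs_mult in B1.
        rewrite <- (pow2_abs (g q)). pose proof (Rabs_pos (g q)). nra. }
      pose proof (exp_pos (2 * L * q)).
      assert (0 <= (2 * g q * l q + 2 * L * g q ^ 2) * exp (2 * L * q)) by (apply Rmult_le_pos; lra). nra. }
  unfold h in Hh. rewrite !Eg in Hh by lra. rewrite Rmult_0_r, exp_0, Rmult_1_r in Hh.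
  intros E. rewrite E in Hh. assert (0 < g 0 ^ 2) by (apply pow2_gt_0; exact H0). simpl in Hh. lra.
Qed.

Lemma growth_positive (L t : R) : (forall t, 0 <= t <= T1 -> Rabs (l t) <= L * Rabs (g t)) ->
  0 <= t <= T1 -> 0 < g 0 -> 0 < g t.
Proof.
  intros HL Ht H0. destruct (Rlt_dec 0 (g t)) as [h|h]; [exact h|exfalso].
  destruct (IVT_gen (fun x => g (clamp 0 T1 x)) 0 t 0) as [x [Hx Ex]].
  - intros x. apply continuity_pt_filterlim, clamped_continuous.
  - rewrite !clamp_id by lra. rewrite Rmin_right, Rmax_left by lra. lra.
  - rewrite Rmin_left, Rmax_right in Hx by lra. rewrite clamp_id in Ex by lra.
    apply (growth_nonzero L x HL); auto; lra.
Qed.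

End Time_calculus.

Definition velocity (u : R -> R -> R) (t x : R) : R := phi x - c + u t x - u t 0.

(** * Time regularity and flow of an arbitrary solution *)

Section Eulerian_solution.

Variables (T : Rbar) (v0 : R -> R) (u : R -> R -> R) (T2 B : R).
Hypothesis HT2 : in_time T T2.
Hypothesis Hu : is_solution v0 T u.
Hypothesis HB1 : 1 <= B.
Hypothesis HB : forall t, 0 <= t <= T2 -> C10_norm_le (u t) B.

Lemma sol_at (t : R) : 0 <= t <= T2 -> C10 (u t).
Proof. intros Ht. apply (sol_C10 _ _ _ Hu). apply (in_time_le T t T2 HT2 Ht). Qed.

Definition rate (t x : R) : R :=
  (phiR 0 - phiR x + u t 0 - u t x) * Derive (u t) x + Gc (st (u t)) x.

Lemma equation_on_period (t x : R) : 0 <= t <= T2 -> 0 < x < 2 * PI ->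
  time_derive T (fun r => u r x) t (rate t x).
Proof.
  intros Ht Hx. assert (Hin : in_time T t) by apply (in_time_le T t T2 HT2 Ht).
  pose proof PI_RGT_0 as HPI.
  assert (Hx' : exists x', - PI <= x' <= PI /\ x' <> 0 /\ frac x' = x).
  { destruct (Rle_dec x PI).
    - exists x. split; [lra|]. split; [lra|]. apply frac_id; lra.
    - exists (x - 2 * PI). split; [lra|]. split; [lra|]. apply frac_unique with (-1)%Z; lra. }
  destruct Hx' as (x' & H1 & H2 & H3).
  pose proof (sol_equation _ _ _ Hu t x' Hin H1 H2) as H.
  rewrite (rhs_formula _ (sol_at t Ht)), H3 in H by auto. unfold rate.
  apply time_derive_ext with (3 := H); [exact Hin|]. intros r Hr.
  rewrite (periodic_frac (u r) x'), H3 by apply (sol_C10 _ _ _ Hu r Hr). reflexivity.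
Qed.

Lemma rate_bounded : exists M, 0 <= M /\ forall t x, 0 <= t <= T2 -> 0 < x < 2 * PI -> Rabs (rate t x) <= M.
Proof.
  destruct (proj1 adm_G B) as (BG & HBG & HG & _). pose proof two_PI_pos as HP.
  exists ((2 * PI + (B + B)) * B + BG). split; [nra|]. intros t x Ht Hx.
  destruct (HB t Ht) as [H1 H2]. unfold rate. apply Rabs_plus_le.
  - apply Rabs_mult_le; [|apply H2, off_peak_open, Hx].
    replace (phiR 0 - phiR x + u t 0 - u t x) with ((phiR 0 - phiR x) + (u t 0 + - u t x)) by ring.
    apply Rabs_plus_le.
    + pose proof (phi_lip 0 x) as E. rewrite !phi_per in E. unfold per in E.
      rewrite !frac_id in E by lra. rewrite Rminus_0_l, Rabs_Ropp, (Rabs_right x) in E by lra. lra.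
    + apply Rabs_plus_le; [apply H1 | rewrite Rabs_Ropp; apply H1].
  - apply HG; [|exact Hx]. apply st_level; auto using sol_at.
Qed.

Lemma sol_time_lip : exists M, 0 <= M /\ forall x t r, 0 <= t <= T2 -> 0 <= r <= T2 ->
  Rabs (u t x - u r x) <= M * Rabs (t - r).
Proof.
  destruct rate_bounded as (M & HM & HR). exists M. split; [exact HM|].
  assert (A1 : forall x t r, 0 < x < 2 * PI -> 0 <= t -> t <= r -> r <= T2 -> Rabs (u r x - u t x) <= M * (r - t)).
  { intros x t r Hx H1 H2 H3.
    apply (time_mvt T T2 (fun r => u r x) (fun r => rate r x) HT2); auto.
    - intros q Hq. apply equation_on_period; auto.
    - intros q Hq. apply HR; auto; lra. }
  assert (A2 : forall x t r, 0 < x < 2 * PI -> 0 <= t <= T2 -> 0 <= r <= T2 -> Rabs (u t x - u r x) <= M * Rabs (t - r)).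
  { intros x t r Hx Ht Hr. destruct (Rle_dec r t).
    - rewrite (Rabs_right (t - r)) by lra. apply A1; auto; lra.
    - rewrite (Rabs_minus_sym t), (Rabs_minus_sym (u t x)), (Rabs_right (r - t)) by lra. apply A1; auto; lra. }
  intros x t r Ht Hr.
  rewrite (periodic_frac (u t) x), (periodic_frac (u r) x) by (apply C10_periodic, sol_at; auto).
  pose proof (frac_range x) as Hx. set (x' := frac x) in *.
  (* The equation is available only off the peak. The estimate is made at the nearby interior point
     [x' + e] and carried back by the Lipschitz bound in space, at both times. *)
  apply le_of_le_eps with (2 * B). intros eps He.
  set (e := Rmin eps ((2 * PI - x') / 2)). assert (He0 : 0 < e) by (apply Rmin_glb_lt; lra).
  assert (He1 : e <= eps) by apply Rmin_l. assert (He2 : e <= (2 * PI - x') / 2) by apply Rmin_r.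
  pose proof (A2 (x' + e) t r ltac:(lra) Ht Hr) as A3.
  pose proof (C10_lip _ (sol_at t Ht) B x' (x' + e) (HB t Ht)) as A4.
  pose proof (C10_lip _ (sol_at r Hr) B (x' + e) x' (HB r Hr)) as A5.
  replace (x' - (x' + e)) with (- e) in A4 by ring. replace (x' + e - x') with e in A5 by ring.
  rewrite Rabs_Ropp in A4. rewrite (Rabs_right e) in A4, A5 by lra.
  assert (B * e <= B * eps) by (apply Rmult_le_compat_l; lra).
  apply Rabs_le_iff in A3. apply Rabs_le_iff in A4. apply Rabs_le_iff in A5. apply Rabs_le_iff. lra.
Qed.

Lemma velocity_lip (t x r : R) : 0 <= t <= T2 -> Rabs (velocity u t x - velocity u t r) <= (1 + B) * Rabs (x - r).
Proof.
  intros Ht. unfold velocity.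
  replace (phi x - c + u t x - u t 0 - (phi r - c + u t r - u t 0)) with ((phi x - phi r) + (u t x - u t r)) by ring.
  rewrite Rmult_plus_distr_r, Rmult_1_l. apply Rabs_plus_le; [apply phi_lip|].
  apply C10_lip; auto using sol_at.
Qed.

Lemma velocity_bound (t x : R) : 0 <= t <= T2 -> Rabs (velocity u t x) <= 2 * PI + 2 * B.
Proof.
  intros Ht. destruct (HB t Ht) as [H1 _]. unfold velocity.
  replace (phi x - c + u t x - u t 0) with ((phi (frac x) - phi 0) + (u t x + - u t 0)).
  2:{ unfold c. rewrite (phi_per x), (phi_per (frac x)). unfold per.
      rewrite (frac_id (frac x)) by apply frac_range. ring. }
  replace (2 * B) with (B + B) by ring. apply Rabs_plus_le.
  - eapply Rle_trans; [apply phi_lip|]. rewrite Rminus_0_r. pose proof (frac_range x). rewrite Rabs_right; lra.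
  - apply Rabs_plus_le; [apply H1 | rewrite Rabs_Ropp; apply H1].
Qed.

(** All characteristics are solved at once by the abstract Picard lemma, with one coordinate
    [Some s] per label and the clock [None], which makes the equation autonomous. The velocity is
    bounded and Lipschitz everywhere, so trivial levels suffice. *)
Lemma flow_exists : exists Y : R -> R -> R, (forall s, Y 0 s = s) /\
  forall t s, 0 <= t < T2 -> time_derive T (fun r => Y r s) t (velocity u t (Y t s)).
Proof.
  destruct sol_time_lip as (M & HM & Hlip). assert (H0 : 0 <= T2) by apply HT2. pose proof two_PI_pos as HP.
  set (F := fun (z : option R -> R) (i : option R) =>
    match i with None => 1 | Some s => velocity u (clamp 0 T2 (z None)) (z (Some s)) end).
  set (L := 1 + (2 * PI + 2 * B) + (1 + B) + 2 * M).
  assert (HL : 0 < L) by (unfold L; lra).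
  assert (Fb : forall z i, Rabs (F z i) <= L).
  { intros z [s|]; simpl.
    - pose proof (velocity_bound _ (z (Some s)) (clamp_in 0 T2 (z None) H0)). unfold L. lra.
    - rewrite Rabs_R1. unfold L. lra. }
  assert (Fl : forall z1 z2 d, near (fun _ => True) z1 z2 d -> near (fun _ => True) (F z1) (F z2) (L * d)).
  { intros z1 z2 d Hn. assert (Hd : 0 <= d) by (eapply Rle_trans; [apply Rabs_pos | apply (Hn None Logic.I)]).
    intros [s|] _; simpl.
    - set (t1 := clamp 0 T2 (z1 None)). set (t2 := clamp 0 T2 (z2 None)).
      assert (Ht1 : 0 <= t1 <= T2) by apply clamp_in, H0. assert (Ht2 : 0 <= t2 <= T2) by apply clamp_in, H0.
      replace (velocity u t1 (z1 (Some s)) - velocity u t2 (z2 (Some s))) with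
        ((velocity u t1 (z1 (Some s)) - velocity u t1 (z2 (Some s))) +
         ((u t1 (z2 (Some s)) - u t2 (z2 (Some s))) + - (u t1 0 - u t2 0))) by (unfold velocity; ring).
      assert (Ht : Rabs (t1 - t2) <= d).
      { eapply Rle_trans; [apply clamp_lip|]. apply (Hn None Logic.I). }
      assert (HMd : M * Rabs (t1 - t2) <= M * d) by (apply Rmult_le_compat_l; auto).
      apply Rle_trans with ((1 + B) * d + (M * d + M * d)).
      + apply Rabs_plus_le; [|apply Rabs_plus_le; [|rewrite Rabs_Ropp]].
        * eapply Rle_trans; [apply velocity_lip; exact Ht1|].
          apply Rmult_le_compat_l; [lra | apply (Hn (Some s) Logic.I)].
        * eapply Rle_trans; [apply Hlip; auto | exact HMd].
        * eapply Rle_trans; [apply Hlip; auto | exact HMd].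
      + unfold L. nra.
    - rewrite Rminus_diag, Rabs_R0. nra. }
  assert (VF : vector_field (fun _ : option R => True) (fun _ => True) (fun _ _ => True) F).
  { constructor; auto.
    - intros k. exists 1, k. split; [lra|]. split; [lra|]. auto.
    - intros k. exists L. split; [exact HL|]. split; auto. }
  set (z0 := fun i : option R => match i with None => 0 | Some s => s end).
  (* Since levels impose nothing, the tube radius may be taken as large as [T2 * L + 1], and one
     application reaches [T2]. *)
  pose proof (picard (option R) (fun _ => True) (fun _ => True) (fun _ _ => True) F VF 0 (T2 * L + 1) L T2 z0
    H0 ltac:(nra) HL ltac:(lra) ltac:(auto) ltac:(auto) ltac:(auto) Logic.I) as Htr.
  set (Z := picard_limit (option R) F T2 z0) in *. clearbody Z.
  destruct (traj_remainder _ _ _ _ _ VF _ _ _ _ Htr) as (C & HC & Hrem).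
  destruct Htr as (_ & Z0 & _ & _).
  assert (D : forall i t, 0 <= t < T2 -> time_derive T (fun r => Z r i) t (F (Z t) i)).
  { intros i t Ht. apply time_derive_quad with T2 C; auto; try lra. intros r Hr. apply Hrem; auto. lra. }
  assert (Hclock : forall t, 0 <= t < T2 -> Z t None = t).
  { intros t Ht.
    assert (Bd : Rabs ((Z t None - t) - (Z 0 None - 0)) <= 0 * (t - 0)).
    { apply (time_mvt T t (fun r => Z r None - r) (fun _ => 1 - 1)); try lra.
      - apply (in_time_le T t T2 HT2). lra.
      - intros r Hr. apply (time_derive_minus T (fun r => Z r None) (fun r => r)); [apply D; lra|].
        apply time_derive_eps. intros eps He. exists 1. split; [lra|]. intros q _ _.
        replace (q - r - (q - r) * 1) with 0 by ring. rewrite Rabs_R0. pose proof (Rabs_pos (q - r)). nra.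
      - intros r _. rewrite Rminus_diag, Rabs_R0. lra. }
    rewrite Z0 in Bd by exact Logic.I. simpl in Bd. rewrite Rmult_0_l in Bd. apply Rabs_le_iff in Bd. lra. }
  exists (fun t s => Z t (Some s)). split.
  - intros s. apply (Z0 (Some s) Logic.I).
  - intros t s Ht. pose proof (D (Some s) t Ht) as H. simpl in H. rewrite Hclock, clamp_id in H by lra. exact H.
Qed.

End Eulerian_solution.

(** * Differentiability of the flow of a solution in the label *)

Section Eulerian_flow.

Variables (T : Rbar) (v0 : R -> R) (u : R -> R -> R) (T1 T2 B : R) (Y : R -> R -> R).
Hypothesis HT1 : 0 <= T1 < T2.
Hypothesis HT2 : in_time T T2.
Hypothesis Hu : is_solution v0 T u.
Hypothesis HB1 : 1 <= B.
Hypothesis HB : forall t, 0 <= t <= T2 -> C10_norm_le (u t) B.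
Hypothesis Y0 : forall s, Y 0 s = s.
Hypothesis HY : forall t s, 0 <= t < T2 -> time_derive T (fun r => Y r s) t (velocity u t (Y t s)).

Lemma horizon : in_time T T1.
Proof. apply (in_time_le T T1 T2 HT2). lra. Qed.

Lemma u_C10 (t : R) : 0 <= t <= T1 -> C10 (u t).
Proof. intros Ht. apply (sol_C10 _ _ _ Hu). apply (in_time_le T t T2 HT2). lra. Qed.

Lemma u_norm (t : R) : 0 <= t <= T1 -> C10_norm_le (u t) B.
Proof. intros Ht. apply HB. lra. Qed.

Lemma u_vlip (t x r : R) : 0 <= t <= T1 -> Rabs (velocity u t x - velocity u t r) <= (1 + B) * Rabs (x - r).
Proof. intros Ht. apply (velocity_lip T v0 u T2 B); auto. lra. Qed.

Definition expansion : R := exp ((1 + B) * T1).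

Lemma expansion_ge (t : R) : 0 <= t <= T1 -> exp ((1 + B) * t) <= expansion.
Proof. intros Ht. apply exp_le_compat, Rmult_le_compat_l; lra. Qed.

Lemma expansion_pos : 1 <= expansion.
Proof. apply exp_ge_1. apply Rmult_le_pos; lra. Qed.

Lemma flow_diff (r s t : R) : 0 <= t <= T1 ->
  time_derive T (fun q => Y q r - Y q s) t (velocity u t (Y t r) - velocity u t (Y t s)).
Proof.
  intros Ht. apply (time_derive_minus T (fun q => Y q r) (fun q => Y q s)); apply HY; lra.
Qed.

Lemma flow_lip (r s t : R) : 0 <= t <= T1 -> Rabs (Y t r - Y t s) <= expansion * Rabs (r - s).
Proof.
  intros Ht.
  pose proof (growth_upper T T1 (fun q => Y q r - Y q s)
    (fun q => velocity u q (Y q r) - velocity u q (Y q s)) horizon (flow_diff r s) (1 + B) t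
    (fun q Hq => u_vlip q _ _ Hq) Ht) as H.
  simpl in H. rewrite !Y0 in H. eapply Rle_trans; [exact H|]. rewrite Rmult_comm.
  apply Rmult_le_compat_r; [apply Rabs_pos | apply expansion_ge, Ht].
Qed.

Lemma flow_increasing (r s t : R) : 0 <= t <= T1 -> s < r -> Y t s < Y t r.
Proof.
  intros Ht Hrs.
  pose proof (growth_positive T T1 (fun q => Y q r - Y q s)
    (fun q => velocity u q (Y q r) - velocity u q (Y q s)) horizon (flow_diff r s) (1 + B) t
    (fun q Hq => u_vlip q _ _ Hq) Ht) as H.
  simpl in H. rewrite !Y0 in H. specialize (H ltac:(lra)). lra.
Qed.

Lemma velocity_peak (t : R) : velocity u t 0 = 0.
Proof. unfold velocity, c. ring. Qed.

Lemma velocity_peak' (t : R) : 0 <= t <= T1 -> velocity u t (2 * PI) = 0.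
Proof.
  intros Ht. rewrite <- (velocity_peak t). unfold velocity. rewrite !phi_per.
  rewrite <- (Rplus_0_l (2 * PI)), per_periodic, (C10_periodic _ (u_C10 t Ht)). reflexivity.
Qed.

Lemma flow_peak (t : R) : 0 <= t <= T1 -> Y t 0 = 0.
Proof.
  intros Ht.
  pose proof (growth_upper T T1 (fun q => Y q 0) (fun q => velocity u q (Y q 0)) horizon
    (fun q Hq => HY q 0 ltac:(lra)) (1 + B) t) as H.
  simpl in H. rewrite Y0, Rabs_R0, Rmult_0_l in H.
  enough (E : Rabs (Y t 0) <= 0) by (apply Rabs_le_iff in E; lra).
  apply H; [|exact Ht]. intros q Hq. pose proof (u_vlip q (Y q 0) 0 Hq) as A.
  rewrite velocity_peak, !Rminus_0_r in A. exact A.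
Qed.

Lemma flow_peak' (t : R) : 0 <= t <= T1 -> Y t (2 * PI) = 2 * PI.
Proof.
  intros Ht.
  assert (D : forall q, 0 <= q <= T1 ->
     time_derive T (fun q => Y q (2 * PI) - 2 * PI) q (velocity u q (Y q (2 * PI)))).
  { intros q Hq. apply time_derive_eps. intros eps He.
    destruct (proj1 (time_derive_eps _ _ _ _) (HY q (2 * PI) ltac:(lra)) eps He) as (d & Hd & HD).
    exists d. split; [exact Hd|]. intros x Hx Hxq.
    replace (Y x (2 * PI) - 2 * PI - (Y q (2 * PI) - 2 * PI)) with (Y x (2 * PI) - Y q (2 * PI)) by ring.
    apply HD; auto. }
  pose proof (growth_upper T T1 _ _ horizon D (1 + B) t) as H.
  simpl in H. rewrite Y0, Rminus_diag, Rabs_R0, Rmult_0_l in H.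
  enough (E : Rabs (Y t (2 * PI) - 2 * PI) <= 0) by (apply Rabs_le_iff in E; lra).
  apply H; [|exact Ht]. intros q Hq. pose proof (u_vlip q (Y q (2 * PI)) (2 * PI) Hq) as A.
  rewrite velocity_peak', !Rminus_0_r in A by exact Hq. exact A.
Qed.

Lemma flow_range (t s : R) : 0 <= t <= T1 -> 0 < s < 2 * PI -> 0 < Y t s < 2 * PI.
Proof.
  intros Ht Hs. pose proof (flow_increasing s 0 t Ht ltac:(lra)) as H1.
  pose proof (flow_increasing (2 * PI) s t Ht ltac:(lra)) as H2.
  rewrite flow_peak in H1 by exact Ht. rewrite flow_peak' in H2 by exact Ht. lra.
Qed.

Lemma flow_time_lip (s t r : R) : 0 <= t <= T1 -> 0 <= r <= T1 ->
  Rabs (Y r s - Y t s) <= (2 * PI + 2 * B) * Rabs (r - t).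
Proof.
  assert (key : forall t r, 0 <= t -> t <= r -> r <= T1 -> Rabs (Y r s - Y t s) <= (2 * PI + 2 * B) * (r - t)).
  { intros a b H1 H2 H3.
    apply (time_mvt T T1 (fun q => Y q s) (fun q => velocity u q (Y q s)) horizon); auto.
    - intros q Hq. apply HY. lra.
    - intros q Hq. apply (velocity_bound u T2); auto. lra. }
  intros Ht Hr. destruct (Rle_dec t r).
  - rewrite (Rabs_right (r - t)) by lra. apply key; lra.
  - rewrite (Rabs_minus_sym (Y r s)), (Rabs_minus_sym r), (Rabs_right (t - r)) by lra. apply key; lra.
Qed.

Definition dvel (t x : R) : R := dphiR x + Derive (u t) x.

Lemma dvel_bound (t x : R) : 0 <= t <= T1 -> 0 < x < 2 * PI -> Rabs (dvel t x) <= 1 + B.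
Proof.
  intros Ht Hx. apply Rabs_plus_le; [apply dphiR_bound; lra|].
  apply (u_norm t Ht). apply off_peak_open, Hx.
Qed.

Lemma dvel_derive (t x : R) : 0 <= t <= T1 -> 0 < x < 2 * PI -> is_derive (velocity u t) x (dvel t x).
Proof.
  intros Ht Hx. unfold velocity, dvel.
  apply is_derive_ext_loc with (fun x => (phiR x + u t x) + (- c - u t 0)).
  - generalize (locally_between _ _ _ Hx). apply filter_imp. intros y Hy.
    rewrite phi_per. unfold per. rewrite frac_id by lra. lra.
  - rewrite <- (Rplus_0_r (dphiR x + Derive (u t) x)).
    apply (is_derive_plus (fun x => phiR x + u t x) (fun _ => - c - u t 0)).
    + apply (is_derive_plus phiR (u t)); [apply phiR_derive|].
      apply Derive_correct, (C10_derivable _ (u_C10 t Ht)), off_peak_open, Hx.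
    + apply (is_derive_const (K := R_AbsRing) (V := R_NormedModule)).
Qed.

Lemma dvel_joint (t x eps : R) : 0 <= t <= T1 -> 0 < x < 2 * PI -> 0 < eps -> exists d, 0 < d /\
  forall r y, 0 <= r <= T1 -> Rabs (r - t) < d -> Rabs (y - x) < d -> 0 < y < 2 * PI /\ Rabs (dvel r y - dvel t x) < eps.
Proof.
  intros Ht Hx He. assert (Hin : in_time T t) by (apply (in_time_le T t T2 HT2); lra).
  pose proof (sol_derive_continuous _ _ _ Hu t x Hin (off_peak_open x Hx)) as H.
  destruct (proj1 (filterlim_time_space T (fun t => Derive (u t)) t x) H (eps / 2) ltac:(lra)) as (d1 & Hd1 & H1).
  destruct (proj1 (continuous_eps _ _) (dphiR_continuous x) (eps / 2) ltac:(lra)) as (d2 & Hd2 & H2).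
  destruct (locally_between _ _ _ Hx) as [d3 Hd3].
  exists (Rmin (Rmin d1 d2) d3). split; [repeat apply Rmin_glb_lt; auto; apply cond_pos|].
  intros r y Hr Hrt Hy. pose proof (Rmin_l (Rmin d1 d2) d3). pose proof (Rmin_r (Rmin d1 d2) d3).
  pose proof (Rmin_l d1 d2). pose proof (Rmin_r d1 d2). split.
  - apply (Hd3 y). change (Rabs (y - x) < d3). lra.
  - unfold dvel. specialize (H1 r y (in_time_le T r T2 HT2 ltac:(lra)) ltac:(lra) ltac:(lra)).
    specialize (H2 y ltac:(lra)). apply Rabs_def2 in H1. apply Rabs_def2 in H2. apply Rabs_def1; lra.
Qed.

(** The characteristic of [s] over [[0, T1]] is a compact curve that avoids the peak, so joint
    continuity of [v_x] yields one radius for all times. *)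
Lemma dvel_uniform (s eps : R) : 0 < s < 2 * PI -> 0 < eps -> exists d, 0 < d /\
  forall t, 0 <= t <= T1 -> forall x, Rabs (x - Y t s) < d ->
    0 < x < 2 * PI /\ Rabs (dvel t x - dvel t (Y t s)) <= eps.
Proof.
  intros Hs He.
  apply (compact_uniform 0 T1 (fun t d => forall x, Rabs (x - Y t s) < d ->
    0 < x < 2 * PI /\ Rabs (dvel t x - dvel t (Y t s)) <= eps)).
  - intros t d d' Hd H x Hx. apply H. lra.
  - intros t Ht. destruct (dvel_joint t (Y t s) (eps / 2) Ht (flow_range t s Ht Hs) ltac:(lra)) as (d & Hd & H).
    set (K := 2 * PI + 2 * B). assert (HK : 0 <= K) by (unfold K; pose proof two_PI_pos; lra).
    destruct (small_factor K (d / 2) HK ltac:(lra)) as (e & He0 & Hee).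
    exists (Rmin d e), (d / 2). split; [apply Rmin_glb_lt; auto|]. split; [lra|].
    intros t' Ht' Htt x Hx. pose proof (Rmin_l d e). pose proof (Rmin_r d e).
    pose proof (flow_time_lip s t t' Ht Ht') as A. fold K in A.
    assert (K * Rabs (t' - t) <= K * e) by (apply Rmult_le_compat_l; lra).
    assert (A1 : Rabs (x - Y t s) < d).
    { replace (x - Y t s) with ((x - Y t' s) + (Y t' s - Y t s)) by ring.
      eapply Rle_lt_trans; [apply Rabs_triang|]. lra. }
    destruct (H t' x Ht' ltac:(lra) A1) as [B1 B2].
    destruct (H t' (Y t' s) Ht' ltac:(lra) ltac:(lra)) as [_ B3].
    split; [exact B1|]. apply Rabs_def2 in B2. apply Rabs_def2 in B3. apply Rabs_le_iff. lra.
Qed.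

Definition strain (s t : R) : R := dvel (clamp 0 T1 t) (Y (clamp 0 T1 t) s).

Lemma strain_continuous (s t : R) : 0 < s < 2 * PI -> continuous (strain s) t.
Proof.
  intros Hs. unfold strain. pose proof (clamp_in 0 T1 t ltac:(lra)) as Ht. set (t0 := clamp 0 T1 t) in *.
  apply continuous_eps. intros eps He. fold t0.
  destruct (dvel_joint t0 (Y t0 s) eps Ht (flow_range t0 s Ht Hs) He) as (d & Hd & H).
  set (K := 2 * PI + 2 * B). assert (HK : 0 <= K) by (unfold K; pose proof two_PI_pos; lra).
  destruct (small_factor K d HK Hd) as (e & He0 & Hee).
  exists (Rmin d e). split; [apply Rmin_glb_lt; auto|]. intros r Hr.
  pose proof (Rmin_l d e). pose proof (Rmin_r d e).
  pose proof (clamp_in 0 T1 r ltac:(lra)) as Hr0. pose proof (clamp_lip 0 T1 t r) as Hl. fold t0 in Hl.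
  set (r0 := clamp 0 T1 r) in *. pose proof (flow_time_lip s t0 r0 Ht Hr0) as A. fold K in A.
  assert (K * Rabs (r0 - t0) <= K * e) by (apply Rmult_le_compat_l; lra).
  apply H; auto; lra.
Qed.

Lemma strain_bound (s t : R) : 0 < s < 2 * PI -> Rabs (strain s t) <= 1 + B.
Proof.
  intros Hs. pose proof (clamp_in 0 T1 t ltac:(lra)) as Ht. apply dvel_bound; [exact Ht|].
  apply flow_range; auto.
Qed.

Definition total_strain (s t : R) : R := RInt (strain s) 0 t.

Lemma strain_ex_RInt (s a b : R) : 0 < s < 2 * PI -> ex_RInt (strain s) a b.
Proof. intros Hs. apply (ex_RInt_continuous (V := R_CompleteNormedModule)). intros x _. apply strain_continuous, Hs. Qed.

Lemma total_strain_derive (s t : R) : 0 < s < 2 * PI -> is_derive (total_strain s) t (strain s t).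
Proof.
  intros Hs. apply (is_derive_RInt (strain s) (total_strain s) 0); [|apply strain_continuous, Hs].
  apply filter_forall. intros x. apply (RInt_correct (V := R_CompleteNormedModule)), strain_ex_RInt, Hs.
Qed.

Lemma total_strain_bound (s t : R) : 0 < s < 2 * PI -> 0 <= t <= T1 -> Rabs (total_strain s t) <= (1 + B) * T1.
Proof.
  intros Hs Ht. apply Rle_trans with ((1 + B) * (t - 0)); [|apply Rmult_le_compat_l; lra].
  apply RInt_bound_open; [lra | |]; intros x _; [apply strain_continuous, Hs | apply strain_bound, Hs].
Qed.

Lemma total_strain_0 (s : R) : total_strain s 0 = 0.
Proof. exact (RInt_point (V := R_CompleteNormedModule) 0 (strain s)). Qed.

(** The explicit solution of the linearized flow equation [J_t = dvel * J], [J = 1] at time [0]; it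
    is written down first and then shown to be [Y_s]. *)
Definition jacobian (t s : R) : R := exp (total_strain s t).

Lemma jacobian_bound (t s : R) : 0 < s < 2 * PI -> 0 <= t <= T1 -> / expansion <= jacobian t s <= expansion.
Proof.
  intros Hs Ht. pose proof (total_strain_bound s t Hs Ht) as H. apply Rabs_le_iff in H.
  unfold jacobian, expansion. rewrite <- exp_Ropp. split; apply exp_le_compat; lra.
Qed.

(* [exp (- total_strain s t) * (Y t r - Y t s)] is almost constant in time. *)
Lemma flow_derive_uniform (s eps : R) : 0 < s < 2 * PI -> 0 < eps -> exists d, 0 < d /\
  forall t r, 0 <= t <= T1 -> Rabs (r - s) < d ->
    Rabs (Y t r - Y t s - jacobian t s * (r - s)) <= eps * Rabs (r - s).
Proof.
  intros Hs He. pose proof expansion_pos as HE. set (E := expansion) in *.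
  (* One factor [E] bounds [Y t r - Y t s], one the exponential weight, and one the removal of this
     weight. *)
  destruct (small_factor (E * E * E * T1) eps) as (e & He0 & Hee); [|exact He|].
  { repeat apply Rmult_le_pos; lra. }
  destruct (dvel_uniform s e Hs He0) as (d & Hd & H).
  exists (d / E). split; [apply Rdiv_lt_0_compat; lra|]. intros t r Ht Hr.
  set (a := Rabs (r - s)) in *. assert (Ha : 0 <= a) by apply Rabs_pos.
  assert (Hnear : forall q, 0 <= q <= T1 -> Rabs (Y q r - Y q s) < d).
  { intros q Hq. eapply Rle_lt_trans; [apply flow_lip; exact Hq|]. fold E a.
    replace d with (E * (d / E)) by (field; lra). apply Rmult_lt_compat_l; lra. }
  destruct (clamped_extension T T1 (fun q => Y q r - Y q s) (fun q => velocity u q (Y q r) - velocity u q (Y q s))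
     horizon (flow_diff r s)) as (g & Eg & Dg & Cg).
  set (h := fun q => g q * exp (- total_strain s q)).
  assert (Bh : Rabs (h t - h 0) <= e * (E * a) * E * (t - 0)).
  { apply (MVT_bound h (fun q => (velocity u q (Y q r) - velocity u q (Y q s) - strain s q * (Y q r - Y q s))
      * exp (- total_strain s q))); [lra | | |].
    - intros x Hx. unfold h. pose proof (Dg x ltac:(lra)) as D1. pose proof (total_strain_derive s x Hs) as D2.
      rewrite <- Eg by lra. set (A := total_strain s) in *. clearbody A.
      auto_derive; [repeat split; eexists; eassumption|].
      rewrite (is_derive_unique (fun q : R => g q) _ _ D1), (is_derive_unique (fun q : R => A q) _ _ D2). ring.
    - intros x _. apply (continuous_mult g (fun q => exp (- total_strain s q))); [apply Cg|].
      apply (continuous_comp (fun q => - total_strain s q) exp).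
      + apply (continuous_opp (total_strain s)). apply (ex_derive_continuous (V := R_NormedModule)).
        exists (strain s x). apply total_strain_derive, Hs.
      + apply (ex_derive_continuous (V := R_NormedModule)). auto_derive. exact Logic.I.
    - intros q Hq. assert (Hq' : 0 <= q <= T1) by lra. apply Rabs_mult_le.
      + destruct (MVT_gen (velocity u q) (Y q s) (Y q r) (dvel q)) as (x & Hx & Ex).
        * intros x Hx. apply dvel_derive; [lra|]. apply (H q Hq').
          apply Rle_lt_trans with (Rabs (Y q r - Y q s)); [|apply Hnear; lra].
          unfold Rmin, Rmax in Hx. destruct Rle_dec; apply Rabs_le_iff; unfold Rabs; destruct Rcase_abs; lra.
        * intros x _. apply continuity_pt_filterlim. apply continuous_lipschitz with (1 + B).
          intros y. apply u_vlip. exact Hq'.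
        * rewrite Ex. unfold strain. rewrite clamp_id by exact Hq'.
          replace (dvel q x * (Y q r - Y q s) - dvel q (Y q s) * (Y q r - Y q s))
            with ((dvel q x - dvel q (Y q s)) * (Y q r - Y q s)) by ring.
          apply Rabs_mult_le; [|apply flow_lip; exact Hq'].
          apply (H q Hq'). apply Rle_lt_trans with (Rabs (Y q r - Y q s)); [|apply Hnear; lra].
          unfold Rmin, Rmax in Hx. destruct Rle_dec; apply Rabs_le_iff; unfold Rabs; destruct Rcase_abs; lra.
      + rewrite Rabs_right by (left; apply exp_pos). unfold E, expansion. apply exp_le_compat.
        pose proof (total_strain_bound s q Hs Hq') as A. apply Rabs_le_iff in A. lra. }
  unfold h in Bh. rewrite !Eg, total_strain_0, Ropp_0, exp_0, Rmult_1_r, !Y0 in Bh by lra.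
  assert (HJ := jacobian_bound t s Hs Ht). fold E in HJ.
  replace (Y t r - Y t s - jacobian t s * (r - s)) with
    (jacobian t s * ((Y t r - Y t s) * exp (- total_strain s t) - (r - s))).
  2:{ unfold jacobian. rewrite exp_Ropp. field. apply Rgt_not_eq, exp_pos. }
  pose proof (exp_pos (total_strain s t)) as Hjp. fold (jacobian t s) in Hjp.
  eapply Rle_trans.
  { apply Rabs_mult_le; [rewrite Rabs_right by lra; apply (proj2 HJ) | exact Bh]. }
  assert (P1 : e * (E * a) * E * (t - 0) <= e * (E * a) * E * T1).
  { apply Rmult_le_compat_l; [|lra]. repeat apply Rmult_le_pos; lra. }
  apply Rle_trans with (E * (e * (E * a) * E * T1)); [apply Rmult_le_compat_l; lra|].
  replace (E * (e * (E * a) * E * T1)) with (E * E * E * T1 * e * a) by ring.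
  apply Rmult_le_compat_r; lra.
Qed.

Lemma flow_derive (t s : R) : 0 <= t <= T1 -> 0 < s < 2 * PI -> is_derive (Y t) s (jacobian t s).
Proof.
  intros Ht Hs. apply is_derive_of_eps. intros eps He.
  destruct (flow_derive_uniform s eps Hs He) as (d & Hd & H). exists d. split; [exact Hd|].
  intros r Hr. apply H; auto.
Qed.

Lemma flow_continuous (t s : R) : 0 <= t <= T1 -> continuous (Y t) s.
Proof. intros Ht. apply continuous_lipschitz with expansion. intros r. apply flow_lip, Ht. Qed.

Lemma jacobian_continuous (t s : R) : 0 <= t <= T1 -> 0 < s < 2 * PI -> continuous (jacobian t) s.
Proof.
  intros Ht Hs. unfold jacobian. apply (continuous_comp (fun s => total_strain s t) exp).
  2:{ apply (ex_derive_continuous (V := R_NormedModule)). auto_derive. exact Logic.I. }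
  apply continuous_eps. intros eps He. pose proof expansion_pos as HE.
  destruct (small_factor T1 eps ltac:(lra) He) as (e & He0 & Hee).
  destruct (dvel_uniform s e Hs He0) as (d & Hd & H).
  destruct (locally_between _ _ _ Hs) as [d2 Hd2].
  exists (Rmin (d / expansion) d2).
  split; [apply Rmin_glb_lt; [apply Rdiv_lt_0_compat; lra | apply cond_pos]|]. intros r Hr.
  pose proof (Rmin_l (d / expansion) d2). pose proof (Rmin_r (d / expansion) d2).
  assert (Hr2 : 0 < r < 2 * PI). { apply (Hd2 r). change (Rabs (r - s) < d2). lra. }
  apply Rle_lt_trans with (e * (t - 0)).
  2:{ apply Rle_lt_trans with (e * T1); [apply Rmult_le_compat_l; lra | lra]. }
  unfold total_strain.
  pose proof (RInt_minus (V := R_CompleteNormedModule) _ _ 0 t (strain_ex_RInt r 0 t Hr2) (strain_ex_RInt s 0 t Hs)) as Em.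
  unfold minus, plus, opp in Em; simpl in Em. unfold Rminus at 1. rewrite <- Em.
  apply RInt_bound_open; [lra | |]; intros x Hx.
  - apply (continuous_minus (strain r) (strain s)); apply strain_continuous; auto.
  - unfold strain. rewrite clamp_id by lra. apply (H x ltac:(lra)).
    eapply Rle_lt_trans; [apply flow_lip; lra|].
    replace d with (expansion * (d / expansion)) by (field; lra). apply Rmult_lt_compat_l; lra.
Qed.

End Eulerian_flow.

Lemma derive_bound_of_lip (h : R -> R) (s l C : R) :
  0 < s < 2 * PI -> is_derive h s l ->
  (forall r, 0 < r < 2 * PI -> Rabs (h r - h s) <= C * Rabs (r - s)) -> Rabs l <= C.
Proof.
  intros Hs D H. apply le_of_le_eps with 1. intros eps He.
  destruct (is_derive_eps _ _ _ D eps He) as (d & Hd & HD).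
  set (e := Rmin (d / 2) ((2 * PI - s) / 2)).
  assert (He0 : 0 < e) by (apply Rmin_glb_lt; lra).
  assert (e <= d / 2) by apply Rmin_l. assert (e <= (2 * PI - s) / 2) by apply Rmin_r.
  specialize (H (s + e) ltac:(lra)). specialize (HD (s + e)).
  replace (s + e - s) with e in * by ring. rewrite (Rabs_right e) in * by lra. specialize (HD ltac:(lra)).
  assert (E : Rabs (l * e) <= C * e + eps * e).
  { apply Rabs_le_iff in H. apply Rabs_le_iff in HD. apply Rabs_le_iff. lra. }
  rewrite Rabs_mult, (Rabs_right e) in E by lra. nra.
Qed.

(* A field [Phi] transported with time derivative [Psi] plus a space-independent term: the space
   derivatives [dPhi] and [dPsi] satisfy the same evolution law.  Only time derivatives of the
   difference quotients of [Phi] are used, so no mixed derivative is assumed to exist. *)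
Section Quotient.

Variables (T : Rbar) (T1 : R) (Phi Psi dPhi dPsi : R -> R -> R) (e : R -> R) (M : R).
Hypothesis HT1 : in_time T T1.
Hypothesis Ht : forall t r, 0 <= t <= T1 -> 0 < r < 2 * PI ->
  time_derive T (fun q => Phi q r) t (Psi t r + e t).
Hypothesis HPhi : forall t r, 0 <= t <= T1 -> 0 < r < 2 * PI -> is_derive (Phi t) r (dPhi t r).
Hypothesis HPsi : forall t r, 0 <= t <= T1 -> 0 < r < 2 * PI -> is_derive (Psi t) r (dPsi t r).

Lemma open_increment (h dh : R -> R) (r s C : R) :
  0 < r < 2 * PI -> 0 < s < 2 * PI ->
  (forall x, 0 < x < 2 * PI -> is_derive h x (dh x)) ->
  (forall x, 0 < x < 2 * PI -> Rabs (dh x) <= C) -> Rabs (h r - h s) <= C * Rabs (r - s).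
Proof.
  assert (key : forall a b, 0 < a -> a <= b -> b < 2 * PI ->
    (forall x, 0 < x < 2 * PI -> is_derive h x (dh x)) ->
    (forall x, 0 < x < 2 * PI -> Rabs (dh x) <= C) -> Rabs (h b - h a) <= C * (b - a)).
  { intros a b H1 H2 H3 Hd HC. apply (MVT_bound h dh); auto.
    - intros x Hx. apply Hd; lra.
    - intros x Hx. apply (ex_derive_continuous (V := R_NormedModule)). exists (dh x). apply Hd; lra.
    - intros x Hx. apply HC; lra. }
  intros Hr Hs Hd HC. destruct (Rle_dec s r).
  - rewrite (Rabs_right (r - s)) by lra. apply key; auto; lra.
  - rewrite (Rabs_minus_sym (h r)), (Rabs_minus_sym r), (Rabs_right (s - r)) by lra. apply key; auto; lra.
Qed.

Lemma difference_derive (r s t : R) : 0 <= t <= T1 -> 0 < r < 2 * PI -> 0 < s < 2 * PI ->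
  time_derive T (fun q => Phi q r - Phi q s) t (Psi t r - Psi t s).
Proof.
  intros H1 H2 H3. replace (Psi t r - Psi t s) with ((Psi t r + e t) - (Psi t s + e t)) by ring.
  apply (time_derive_minus T (fun q => Phi q r) (fun q => Phi q s)); apply Ht; auto.
Qed.

Lemma quotient_lip (t q s : R) :
  (forall t r, 0 <= t <= T1 -> 0 < r < 2 * PI -> Rabs (dPsi t r) <= M) ->
  0 <= t -> t <= q -> q <= T1 -> 0 < s < 2 * PI -> Rabs (dPhi q s - dPhi t s) <= M * (q - t).
Proof.
  intros HM H1 H2 H3 Hs.
  apply (derive_bound_of_lip (fun r => Phi q r - Phi t r) s); auto.
  - apply (is_derive_minus (Phi q) (Phi t)); apply HPhi; auto; lra.
  - intros r Hr.
    replace (Phi q r - Phi t r - (Phi q s - Phi t s)) with ((Phi q r - Phi q s) - (Phi t r - Phi t s)) by ring.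
    replace (M * (q - t) * Rabs (r - s)) with (M * Rabs (r - s) * (q - t)) by ring.
    apply (time_mvt T T1 (fun x => Phi x r - Phi x s) (fun x => Psi x r - Psi x s)); auto.
    + intros x Hx. apply difference_derive; auto.
    + intros x Hx. apply (open_increment (Psi x) (dPsi x)); auto.
      * intros p Hp. apply HPsi; auto; lra.
      * intros p Hp. apply HM; auto; lra.
Qed.

Lemma time_derive_affine (g : R -> R) (x l a b : R) : time_derive T g x l ->
  time_derive T (fun p => g p - (p - a) * b) x (l - b).
Proof.
  intros Hg. apply time_derive_eps. intros eps He.
  destruct (proj1 (time_derive_eps _ _ _ _) Hg eps He) as (d & Hd & HD).
  exists d. split; [exact Hd|]. intros p Hp Hpx.
  replace (g p - (p - a) * b - (g x - (x - a) * b) - (p - x) * (l - b)) with (g p - g x - (p - x) * l) by ring.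
  apply HD; auto.
Qed.

Lemma time_remainder (g l : R -> R) (N t q : R) :
  (forall x, 0 <= x <= T1 -> time_derive T g x (l x)) ->
  0 <= t -> t <= q -> q <= T1 -> 0 <= N ->
  (forall x, t <= x <= q -> Rabs (l x - l t) <= N * (x - t)) ->
  Rabs (g q - g t - (q - t) * l t) <= N * (q - t) ^ 2.
Proof.
  intros Hg H1 H2 H3 HN0 HN.
  pose proof (time_mvt T T1 (fun p => g p - (p - t) * l t) (fun x => l x - l t) HT1) as H.
  specialize (H (fun x Hx => time_derive_affine g x (l x) t (l t) (Hg x Hx)) t q (N * (q - t)) H1 H2 H3).
  simpl in H. rewrite Rminus_diag, Rmult_0_l, Rminus_0_r in H.
  replace (g q - g t - (q - t) * l t) with (g q - (q - t) * l t - g t) by ring.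
  replace (N * (q - t) ^ 2) with (N * (q - t) * (q - t)) by ring. apply H.
  intros x Hx. eapply Rle_trans; [apply HN; lra|]. apply Rmult_le_compat_l; lra.
Qed.

Lemma quotient_remainder (t q s N : R) : 0 <= N ->
  (forall x r, t <= x <= q -> 0 < r < 2 * PI -> Rabs (dPsi x r - dPsi t r) <= N * (x - t)) ->
  0 <= t -> t <= q -> q <= T1 -> 0 < s < 2 * PI ->
  Rabs (dPhi q s - dPhi t s - (q - t) * dPsi t s) <= N * (q - t) ^ 2.
Proof.
  intros HN0 HN H1 H2 H3 Hs.
  apply (derive_bound_of_lip (fun r => Phi q r - Phi t r - (q - t) * Psi t r) s); auto.
  - apply (is_derive_minus (fun r => Phi q r - Phi t r) (fun r => (q - t) * Psi t r)).
    + apply (is_derive_minus (Phi q) (Phi t)); apply HPhi; auto; lra.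
    + apply (is_derive_scal (Psi t)). apply HPsi; auto; lra.
  - intros r Hr.
    replace (Phi q r - Phi t r - (q - t) * Psi t r - (Phi q s - Phi t s - (q - t) * Psi t s)) with
      ((Phi q r - Phi q s) - (Phi t r - Phi t s) - (q - t) * (Psi t r - Psi t s)) by ring.
    replace (N * (q - t) ^ 2 * Rabs (r - s)) with (N * Rabs (r - s) * (q - t) ^ 2) by ring.
    apply (time_remainder (fun x => Phi x r - Phi x s) (fun x => Psi x r - Psi x s)); auto.
    + intros x Hx. apply difference_derive; auto.
    + apply Rmult_le_pos; [exact HN0 | apply Rabs_pos].
    + intros x Hx. replace (Psi x r - Psi x s - (Psi t r - Psi t s)) with
        ((Psi x r - Psi t r) - (Psi x s - Psi t s)) by ring.
      replace (N * Rabs (r - s) * (x - t)) with (N * (x - t) * Rabs (r - s)) by ring.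
      apply (open_increment (fun r => Psi x r - Psi t r) (fun r => dPsi x r - dPsi t r)); auto.
      intros p Hp. apply (is_derive_minus (Psi x) (Psi t)); apply HPsi; auto; lra.
Qed.

End Quotient.

(** * The Lagrangian state of a solution is a trajectory *)

Section Lagrangian_state.

Variables (T : Rbar) (v0 : R -> R) (u : R -> R -> R) (T1 T2 B : R) (Y : R -> R -> R).
Hypothesis HT1 : 0 <= T1 < T2.
Hypothesis HT2 : in_time T T2.
Hypothesis Hu : is_solution v0 T u.
Hypothesis HB1 : 1 <= B.
Hypothesis HB : forall t, 0 <= t <= T2 -> C10_norm_le (u t) B.
Hypothesis Y0 : forall s, Y 0 s = s.
Hypothesis HY : forall t s, 0 <= t < T2 -> time_derive T (fun r => Y r s) t (velocity u t (Y t s)).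

Let Jac := jacobian u T1 Y.
Let E := expansion T1 B.

Definition lagr (t : R) : state := fun i =>
  match i with
  | cJ s => Jac t s - 1
  | cK s => Derive (u t) (Y t s) * Jac t s
  | cV => u t 0
  end.

Lemma lagr_range (t s : R) : 0 <= t <= T1 -> 0 < s < 2 * PI -> 0 < Y t s < 2 * PI.
Proof. apply (flow_range T v0 u T1 T2 B); auto. Qed.

Lemma lagr_Jac (t s : R) : 0 <= t <= T1 -> 0 < s < 2 * PI -> / E <= Jac t s <= E.
Proof. intros Ht Hs. apply (jacobian_bound T v0 u T1 T2 B); auto. Qed.

Lemma lagr_C10 (t : R) : 0 <= t <= T1 -> C10 (u t).
Proof. intros Ht. apply (u_C10 T v0 u T1 T2 HT1 HT2 Hu t Ht). Qed.

Lemma lagr_flow_derive (t s : R) : 0 <= t <= T1 -> 0 < s < 2 * PI -> is_derive (Y t) s (Jac t s).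
Proof. intros Ht Hs. apply (flow_derive T v0 u T1 T2 B); auto. Qed.

Lemma lagr_flow_continuous (t s : R) : 0 <= t <= T1 -> continuous (Y t) s.
Proof. intros Ht. apply (flow_continuous T v0 u T1 T2 B); auto. Qed.

Lemma lagr_flow_0 (t : R) : 0 <= t <= T1 -> Y t 0 = 0.
Proof. intros Ht. apply (flow_peak T v0 u T1 T2 B); auto. Qed.

Lemma lagr_flow_2PI (t : R) : 0 <= t <= T1 -> Y t (2 * PI) = 2 * PI.
Proof. intros Ht. apply (flow_peak' T v0 u T1 T2 B); auto. Qed.

Lemma lagr_E : 1 <= E.
Proof. apply (expansion_pos T1 T2 B HT1 HB1). Qed.

Definition lagr_bound : R := E + 1 + B * E + B.

Lemma lagr_cb_J (t : R) : 0 <= t <= T1 -> cb (fun s => lagr t (cJ s)).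
Proof.
  intros Ht. pose proof lagr_E as HE. split.
  - intros s Hs. apply (continuous_minus (Jac t) (fun _ => 1)); [|apply continuous_const].
    apply (jacobian_continuous T v0 u T1 T2 B); auto.
  - exists (E + 1). intros s Hs. simpl. pose proof (lagr_Jac t s Ht Hs).
    assert (0 < / E) by (apply Rinv_0_lt_compat; lra). apply Rabs_le_iff. lra.
Qed.

Lemma lagr_cb_K (t : R) : 0 <= t <= T1 -> cb (Kc (lagr t)).
Proof.
  intros Ht. pose proof lagr_E as HE. split.
  - intros s Hs. apply (continuous_mult (fun s => Derive (u t) (Y t s)) (Jac t)).
    + apply (continuous_comp (Y t) (Derive (u t))); [apply lagr_flow_continuous, Ht|].
      apply (C10_derive_continuous _ (lagr_C10 t Ht)), off_peak_open, lagr_range; auto.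
    + apply (jacobian_continuous T v0 u T1 T2 B); auto.
  - exists (B * E). intros s Hs. pose proof (lagr_Jac t s Ht Hs).
    assert (0 < / E) by (apply Rinv_0_lt_compat; lra). apply Rabs_mult_le.
    + apply (HB t); [lra|]. apply off_peak_open, lagr_range; auto.
    + rewrite Rabs_right; lra.
Qed.

Lemma lagr_X (t s : R) : 0 <= t <= T1 -> 0 <= s <= 2 * PI -> Xc (lagr t) s = Y t s.
Proof.
  intros Ht Hs. unfold Xc. rewrite (FTC_open (fun s => Y t s - s) (fun s => lagr t (cJ s))); auto.
  - rewrite lagr_flow_0 by exact Ht. ring.
  - apply lagr_cb_J, Ht.
  - intros x Hx. apply (is_derive_minus (Y t) (fun x => x)); [apply lagr_flow_derive; auto|].
    apply (is_derive_id (K := R_AbsRing)).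
  - intros x. apply (continuous_minus (Y t) (fun x => x)); [apply lagr_flow_continuous, Ht | apply continuous_id].
Qed.

Lemma lagr_V (t s : R) : 0 <= t <= T1 -> 0 <= s <= 2 * PI -> Vc (lagr t) s = u t (Y t s).
Proof.
  intros Ht Hs. unfold Vc. rewrite (FTC_open (fun s => u t (Y t s)) (Kc (lagr t))); auto.
  - rewrite lagr_flow_0 by exact Ht. simpl. ring.
  - apply lagr_cb_K, Ht.
  - intros x Hx. unfold Kc; simpl. rewrite Rmult_comm.
    apply (is_derive_comp (u t) (Y t)); [|apply lagr_flow_derive; auto].
    apply Derive_correct, (C10_derivable _ (lagr_C10 t Ht)), off_peak_open, lagr_range; auto.
  - intros x. apply (continuous_comp (Y t) (u t)); [apply lagr_flow_continuous, Ht|].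
    apply (C10_continuous _ (lagr_C10 t Ht)).
Qed.

Lemma lagr_level (t : R) : 0 <= t <= T1 -> level lagr_bound (lagr t).
Proof.
  intros Ht. pose proof lagr_E as HE. pose proof two_PI_pos as HP.
  assert (HEi : 0 < / E) by (apply Rinv_0_lt_compat; lra).
  assert (HBE : 0 <= B * E) by nra.
  split; [unfold lagr_bound; lra|]. split; [split; [|split; [|split]]|split].
  - apply lagr_cb_J, Ht.
  - apply lagr_cb_K, Ht.
  - pose proof (lagr_X t (2 * PI) Ht ltac:(lra)) as H. unfold Xc in H. rewrite lagr_flow_2PI in H by exact Ht. lra.
  - pose proof (lagr_V t (2 * PI) Ht ltac:(lra)) as H. unfold Vc in H. rewrite lagr_flow_2PI in H by exact Ht.
    rewrite <- (Rplus_0_l (2 * PI)) in H at 2. rewrite (C10_periodic _ (lagr_C10 t Ht)) in H.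
    change (lagr t cV) with (u t 0) in H. lra.
  - intros [s|s|] Hi; unfold lagr_bound; simpl.
    + pose proof (lagr_Jac t s Ht Hi). apply Rabs_le_iff. lra.
    + apply Rle_trans with (B * E); [|lra]. pose proof (lagr_Jac t s Ht Hi). apply Rabs_mult_le.
      * apply (HB t); [lra|]. apply off_peak_open, lagr_range; auto.
      * rewrite Rabs_right; lra.
    + pose proof (proj1 (HB t ltac:(lra)) 0). lra.
  - intros s Hs. unfold Jc; simpl. pose proof (lagr_Jac t s Ht Hs).
    apply Rle_trans with (/ E); [apply Rinv_le_contravar; unfold lagr_bound; lra | lra].
Qed.

(** The velocity is split into a part depending on [s] and one depending on time only, the form
    [Psi + e] of the section on difference quotients; [lagr_V_derive] adds [0] for the same
    reason. *)
Lemma lagr_X_derive (t s : R) : 0 <= t <= T1 -> 0 < s < 2 * PI ->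
  time_derive T (fun q => Y q s) t (Uc (lagr t) s + - Uc (lagr t) 0).
Proof.
  intros Ht Hs. pose proof (lagr_range t s Ht Hs) as Hr.
  replace (Uc (lagr t) s + - Uc (lagr t) 0) with (velocity u t (Y t s)); [apply HY; lra|].
  unfold Uc, velocity. rewrite Xc_0, Vc_0, lagr_X, lagr_V, c_phiR, phi_per by (auto; lra).
  unfold per. rewrite frac_id by lra. simpl. ring.
Qed.

(** Along a characteristic the transport contribution cancels the [v_x] term of the equation and
    leaves the nonlocal part. *)
Lemma lagr_V_derive (t s : R) : 0 <= t <= T1 -> 0 < s < 2 * PI ->
  time_derive T (fun q => u q (Y q s)) t (Gc (lagr t) s + 0).
Proof.
  intros Ht Hs. pose proof (lagr_range t s Ht Hs) as Hr. set (x := Y t s) in *.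
  assert (Hin : in_time T t) by (apply (in_time_le T t T2 HT2); lra).
  assert (DT : time_derive T (fun q => u q (Y q s) - u q x) t (Derive (u t) x * velocity u t x)).
  { apply (transport_derive T u (fun q => Y q s) t x); auto.
    - intros q Hq. apply (sol_C10 _ _ _ Hu q Hq).
    - apply (sol_derive_continuous _ _ _ Hu); [exact Hin | apply off_peak_open, Hr].
    - apply HY. lra. }
  pose proof (equation_on_period T v0 u T2 HT2 Hu t x ltac:(lra) Hr) as DE.
  pose proof (time_derive_plus _ _ _ _ _ _ DT DE) as D. unfold rate in D.
  rewrite (relabel_G (u t) lagr_bound (lagr t)); [| apply lagr_C10; auto | apply lagr_level; auto | | lra].
  2:{ intros r Hr'. rewrite lagr_X, lagr_V by auto. reflexivity. }
  rewrite lagr_X by (auto; lra). fold x.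
  match type of D with time_derive _ _ _ ?l => match goal with |- time_derive _ _ _ ?l' =>
    replace l' with l end end.
  - apply time_derive_ext with (3 := D); [exact Hin|]. intros q _. ring.
  - unfold velocity. rewrite c_phiR, phi_per. unfold per. rewrite frac_id by lra. ring.
Qed.

Lemma lagr_traj : exists k, traj cdom level field k T1 (st v0) lagr.
Proof.
  assert (Hin : in_time T T1) by (apply (in_time_le T T1 T2 HT2); lra).
  destruct (sol_time_lip T v0 u T2 B HT2 Hu HB1 HB) as (M & HM & Hlip).
  destruct (vf_lip _ _ _ _ _ field_regular lagr_bound) as (L & HL & Lb & Ll).
  destruct (proj1 adm_G lagr_bound) as (BG & HBG & _ & GL).
  assert (Hlev := lagr_level).
  pose (dJ := fun t s => field (lagr t) (cJ s)). pose (dK := fun t s => field (lagr t) (cK s)).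
  assert (DU : forall t r, 0 <= t <= T1 -> 0 < r < 2 * PI -> is_derive (Uc (lagr t)) r (dJ t r)).
  { intros t r Ht Hr. apply Uc_derive; auto. apply (level_nice lagr_bound), Hlev, Ht. }
  assert (DG : forall t r, 0 <= t <= T1 -> 0 < r < 2 * PI -> is_derive (Gc (lagr t)) r (dK t r)).
  { intros t r Ht Hr. apply (Gc_derive lagr_bound); auto. }
  assert (DV : forall t r, 0 <= t <= T1 -> 0 < r < 2 * PI ->
     is_derive (fun r => u t (Y t r)) r (lagr t (cK r))).
  { intros t r Ht Hr. simpl. rewrite Rmult_comm.
    apply (is_derive_comp (u t) (Y t)); [|apply lagr_flow_derive; auto].
    apply Derive_correct, (C10_derivable _ (lagr_C10 t Ht)), off_peak_open, lagr_range; auto. }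
  set (K := L + M). assert (HK : 0 <= K) by (unfold K; lra).
  (* Two passes: boundedness of [field] first makes the state Lipschitz in time. Then [field] is
     Lipschitz along it, and this gives the quadratic remainder. *)
  assert (Hz : forall t q, 0 <= t -> t <= q -> q <= T1 -> near cdom (lagr q) (lagr t) (K * (q - t))).
  { intros t q H1 H2 H3.
    assert (HLM : L * (q - t) <= K * (q - t)) by (apply Rmult_le_compat_r; unfold K; lra).
    intros [s|s|] Hi.
    - replace (lagr q (cJ s) - lagr t (cJ s)) with (Jac q s - Jac t s) by (simpl; ring).
      eapply Rle_trans; [|exact HLM].
      apply (quotient_lip T T1 Y (fun t => Uc (lagr t)) Jac dJ (fun t => - Uc (lagr t) 0)); auto.
      + apply lagr_X_derive.
      + apply lagr_flow_derive.
      + intros x r Hx Hr. apply (Lb (lagr x) (cJ r)); auto.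
    - eapply Rle_trans; [|exact HLM].
      apply (quotient_lip T T1 (fun t r => u t (Y t r)) (fun t => Gc (lagr t)) (fun t r => lagr t (cK r)) dK (fun _ => 0)); auto.
      + apply lagr_V_derive.
      + intros x r Hx Hr. apply (Lb (lagr x) (cK r)); auto.
    - simpl. eapply Rle_trans; [apply Hlip; lra|]. rewrite Rabs_right by lra.
      apply Rmult_le_compat_r; unfold K; lra. }
  assert (HLK : 0 <= L * K) by nra. assert (HGK : 0 <= BG * K) by nra.
  exists lagr_bound. split; [lra|]. split; [|split; [exact Hlev|]].
  - assert (EJ : forall s, Jac 0 s = 1).
    { intros s. unfold Jac, jacobian. rewrite total_strain_0. apply exp_0. }
    intros [s|s|] Hi; simpl.
    + rewrite EJ. ring.
    + rewrite EJ, Y0, Rmult_1_r. apply Derive_ext. apply (sol_initial _ _ _ Hu).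
    + apply (sol_initial _ _ _ Hu).
  - exists (L * K + BG * K). intros t q i H1 H2 H3 Hi.
    pose proof (pow2_ge_0 (q - t)) as Hsq.
    assert (HL1 : L * K * (q - t) ^ 2 <= (L * K + BG * K) * (q - t) ^ 2) by (apply Rmult_le_compat_r; lra).
    assert (HG1 : BG * K * (q - t) ^ 2 <= (L * K + BG * K) * (q - t) ^ 2) by (apply Rmult_le_compat_r; lra).
    destruct i as [s|s|].
    + replace (lagr q (cJ s) - lagr t (cJ s) - (q - t) * field (lagr t) (cJ s)) with
        (Jac q s - Jac t s - (q - t) * dJ t s) by (unfold dJ; simpl; ring).
      eapply Rle_trans; [|exact HL1].
      apply (quotient_remainder T T1 Y (fun t => Uc (lagr t)) Jac dJ (fun t => - Uc (lagr t) 0)); auto.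
      * apply lagr_X_derive.
      * apply lagr_flow_derive.
      * intros x r Hx Hr. rewrite Rmult_assoc.
        apply (Ll (lagr x) (lagr t) (K * (x - t)) ltac:(apply Hlev; lra) ltac:(apply Hlev; lra) (Hz t x ltac:(lra) ltac:(lra) ltac:(lra)) (cJ r) Hr).
    + change (Rabs (lagr q (cK s) - lagr t (cK s) - (q - t) * dK t s) <= (L * K + BG * K) * (q - t) ^ 2).
      eapply Rle_trans; [|exact HL1].
      apply (quotient_remainder T T1 (fun t r => u t (Y t r)) (fun t => Gc (lagr t)) (fun t r => lagr t (cK r)) dK (fun _ => 0)); auto.
      * apply lagr_V_derive.
      * intros x r Hx Hr. rewrite Rmult_assoc.
        apply (Ll (lagr x) (lagr t) (K * (x - t)) ltac:(apply Hlev; lra) ltac:(apply Hlev; lra) (Hz t x ltac:(lra) ltac:(lra) ltac:(lra)) (cK r) Hr).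
    + eapply Rle_trans; [|exact HG1].
      change (Rabs (u q 0 - u t 0 - (q - t) * Gc (lagr t) 0) <= BG * K * (q - t) ^ 2).
      (* The equation is not assumed at the peak. The remainder is bounded at interior labels
         uniformly in [s], and continuity of [h] carries the bound to [s = 0]. *)
      set (h := fun s => u q (Y q s) - u t (Y t s) - (q - t) * Gc (lagr t) s).
      assert (Hh : forall s, 0 < s < 2 * PI -> Rabs (h s) <= BG * K * (q - t) ^ 2).
      { intros s Hs. unfold h.
        apply (time_remainder T T1 Hin (fun x => u x (Y x s)) (fun x => Gc (lagr x) s)); auto.
        - intros x Hx. rewrite <- (Rplus_0_r (Gc (lagr x) s)). apply lagr_V_derive; auto.
        - intros x Hx. rewrite Rmult_assoc.
          apply (GL (lagr x) (lagr t) (K * (x - t)) s); auto; try (apply Hlev; lra). apply Hz; lra. }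
      assert (Ch : continuous h 0).
      { apply (continuous_minus (fun s => u q (Y q s) - u t (Y t s)) (fun s => (q - t) * Gc (lagr t) s)).
        - apply (continuous_minus (fun s => u q (Y q s)) (fun s => u t (Y t s))).
          + apply (continuous_comp (Y q) (u q)); [apply lagr_flow_continuous; lra|].
            apply (C10_continuous _ (lagr_C10 q ltac:(lra))).
          + apply (continuous_comp (Y t) (u t)); [apply lagr_flow_continuous; lra|].
            apply (C10_continuous _ (lagr_C10 t ltac:(lra))).
        - apply (continuous_mult (fun _ => q - t) (Gc (lagr t))); [apply continuous_const|].
          apply (Gc_continuous lagr_bound). apply Hlev; lra. }
      replace (u q 0 - u t 0 - (q - t) * Gc (lagr t) 0) with (h 0).
      2:{ unfold h. rewrite !lagr_flow_0 by lra. reflexivity. }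
      apply le_of_le_eps with 1. intros eps He.
      destruct (proj1 (continuous_eps _ _) Ch eps He) as (d & Hd & HD). pose proof PI_RGT_0 as HP.
      set (s := Rmin (d / 2) PI). assert (Hs0 : 0 < s) by (apply Rmin_glb_lt; lra).
      assert (s <= d / 2) by apply Rmin_l. assert (s <= PI) by apply Rmin_r.
      specialize (HD s). rewrite Rminus_0_r, Rabs_right in HD by lra. specialize (HD ltac:(lra)).
      specialize (Hh s ltac:(lra)). apply Rabs_le_iff in Hh. apply Rabs_def2 in HD. apply Rabs_le_iff. lra.
Qed.

End Lagrangian_state.

Theorem Lagrangian_representation (T : Rbar) (v0 : R -> R) (u : R -> R -> R) (T1 : R) :
  is_solution v0 T u -> in_time T T1 ->
  exists k z, traj cdom level field k T1 (st v0) z /\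
    forall t s, 0 <= t <= T1 -> 0 <= s <= 2 * PI -> u t (Xc (z t) s) = Vc (z t) s.
Proof.
  (* A later time [T2] is needed because [flow_exists] differentiates the flow only before its final
     time. *)
  intros Hu HT1. destruct (in_time_extend T T1 HT1) as (T2 & H12 & HT2).
  assert (H01 : 0 <= T1 < T2) by (destruct HT1; lra).
  destruct (sol_bounded _ _ _ Hu T2 HT2) as [B0 HB0].
  set (B := Rmax 1 B0). assert (HB1 : 1 <= B) by apply Rmax_l.
  assert (HB : forall t, 0 <= t <= T2 -> C10_norm_le (u t) B).
  { intros t Ht. destruct (HB0 t Ht) as [A1 A2]. assert (B0 <= B) by apply Rmax_r.
    split; intros x; [specialize (A1 x); lra | intros Hx; specialize (A2 x Hx); lra]. }
  destruct (flow_exists T v0 u T2 B HT2 Hu HB1 HB) as (Y & Y0 & HY).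
  destruct (lagr_traj T v0 u T1 T2 B Y H01 HT2 Hu HB1 HB Y0 HY) as [k Hk].
  exists k, (lagr u T1 Y). split; [exact Hk|]. intros t s Ht Hs.
  rewrite (lagr_X T v0 u T1 T2 B Y), (lagr_V T v0 u T1 T2 B Y) by auto. reflexivity.
Qed.

(** * Continuous dependence *)

Lemma level_ext (k : R) (z w : state) : (forall i, cdom i -> w i = z i) -> level k z -> level k w.
Proof.
  intros E (H0 & (H1 & H2 & H3 & H4) & H5 & H6). split; [exact H0|]. split; [split; [|split; [|split]]|split].
  - apply cb_ext with (2 := H1). intros s Hs. symmetry. apply (E (cJ s) Hs).
  - apply cb_ext with (2 := H2). intros s Hs. symmetry. apply (E (cK s) Hs).
  - rewrite <- H3. apply prim_ext. intros s Hs. apply (E (cJ s) Hs).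
  - rewrite <- H4. apply prim_ext. intros s Hs. apply (E (cK s) Hs).
  - intros i Hi. rewrite E by exact Hi. apply H5, Hi.
  - intros s Hs. unfold Jc. rewrite E by exact Hs. apply H6, Hs.
Qed.

(** The two layers of width [eta] at the peak contribute at most [4 * b ^ 2 * eta < eps ^ 2 / 4];
    the rest contributes at most [PI * eps ^ 2 / 16 <= eps ^ 2 / 4], using [PI <= 4]. *)
Lemma H1_norm_small (f : R -> R) (b eta eps : R) : C10 f -> C10_norm_le f b ->
  0 < eta < PI -> 0 < eps -> 4 * b ^ 2 * eta < eps ^ 2 / 4 ->
  (forall x, eta < x < 2 * PI - eta -> Rabs (f x) <= eps / 8 /\ Rabs (Derive f x) <= eps / 8) ->
  H1_norm f < eps.
Proof.
  intros Hf [Hb1 Hb2] Heta He Hsmall Hin. unfold H1_norm. pose proof PI_RGT_0 as HP. pose proof PI_4 as HP4.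
  set (g := fun x => f x ^ 2 + Derive f x ^ 2).
  assert (Sq : forall x M, Rabs x <= M -> x ^ 2 <= M ^ 2).
  { intros x M H. rewrite <- (pow2_abs x). pose proof (Rabs_pos x). apply pow_incr. lra. }
  assert (Cg : cb g).
  { apply cb_plus.
    - apply cb_ext with (fun s => f s * f s); [intros; ring | apply cb_mult; apply C10_cb, Hf].
    - apply cb_ext with (fun s => Derive f s * Derive f s); [intros; ring | apply cb_mult; apply C10_cb_derive, Hf]. }
  assert (Pg : periodic g).
  { intros x. unfold g. rewrite Derive_period, (C10_periodic _ Hf) by exact Hf. reflexivity. }
  assert (Bd : forall x1 x2 M, 0 <= x1 -> x1 <= x2 -> x2 <= 2 * PI -> (forall x, x1 < x < x2 -> g x <= M) ->
    RInt g x1 x2 <= M * (x2 - x1)).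
  { intros x1 x2 M H1 H2 H3 HM. eapply Rle_trans; [apply Rle_abs|]. apply RInt_bound_open; [exact H2 | |].
    - intros x Hx. apply (proj1 Cg). lra.
    - intros x Hx. rewrite Rabs_right; [apply HM, Hx|]. unfold g. apply Rle_ge.
      apply Rplus_le_le_0_compat; apply pow2_ge_0. }
  assert (Gb : forall x, 0 < x < 2 * PI -> g x <= 2 * b ^ 2).
  { intros x Hx. unfold g. pose proof (Sq _ _ (Hb1 x)). pose proof (Sq _ _ (Hb2 x (off_peak_open x Hx))). lra. }
  assert (Gi : forall x, eta < x < 2 * PI - eta -> g x <= 2 * (eps / 8) ^ 2).
  { intros x Hx. destruct (Hin x Hx) as [A1 A2]. unfold g. pose proof (Sq _ _ A1). pose proof (Sq _ _ A2). lra. }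
  assert (Ex : forall x1 x2, 0 <= x1 <= 2 * PI -> 0 <= x2 <= 2 * PI -> ex_RInt g x1 x2) by (intros; apply cb_ex_RInt; auto).
  assert (Tot : RInt g (- PI) PI <= 2 * b ^ 2 * eta + (2 * (eps / 8) ^ 2 * (2 * PI) + 2 * b ^ 2 * eta)).
  { rewrite (RInt_period g (RInt g 0 PI) (RInt g PI (2 * PI)) Pg);
      [| apply (RInt_correct (V := R_CompleteNormedModule)), Ex; lra
       | apply (RInt_correct (V := R_CompleteNormedModule)), Ex; lra].
    rewrite (RInt_split g 0 eta PI) by (apply Ex; lra).
    rewrite (RInt_split g PI (2 * PI - eta) (2 * PI)) by (apply Ex; lra).
    pose proof (Bd 0 eta (2 * b ^ 2) ltac:(lra) ltac:(lra) ltac:(lra) (fun x Hx => Gb x ltac:(lra))) as B1.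
    pose proof (Bd eta PI _ ltac:(lra) ltac:(lra) ltac:(lra) (fun x Hx => Gi x ltac:(lra))) as B2.
    pose proof (Bd PI (2 * PI - eta) _ ltac:(lra) ltac:(lra) ltac:(lra) (fun x Hx => Gi x ltac:(lra))) as B3.
    pose proof (Bd (2 * PI - eta) (2 * PI) (2 * b ^ 2) ltac:(lra) ltac:(lra) ltac:(lra) (fun x Hx => Gb x ltac:(lra))) as B4.
    assert (0 <= 2 * (eps / 8) ^ 2) by (pose proof (pow2_ge_0 (eps / 8)); lra). nra. }
  assert (Heps : 2 * (eps / 8) ^ 2 * (2 * PI) <= eps ^ 2 / 4).
  { replace (2 * (eps / 8) ^ 2 * (2 * PI)) with (eps ^ 2 * PI / 16) by field.
    assert (0 <= eps ^ 2) by apply pow2_ge_0. nra. }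
  assert (Hlt : RInt g (- PI) PI < eps ^ 2).
  { assert (0 < eps ^ 2) by (apply pow_lt, He). lra. }
  assert (Hnn : 0 <= RInt g (- PI) PI).
  { rewrite (RInt_period g (RInt g 0 PI) (RInt g PI (2 * PI)) Pg);
      [| apply (RInt_correct (V := R_CompleteNormedModule)), Ex; lra
       | apply (RInt_correct (V := R_CompleteNormedModule)), Ex; lra].
    apply Rplus_le_le_0_compat; apply RInt_ge_0; try lra; try (apply Ex; lra);
      intros x _; unfold g; apply Rplus_le_le_0_compat; apply pow2_ge_0. }
  fold g. rewrite <- (sqrt_pow2 eps) by lra. apply sqrt_lt_1; [exact Hnn | apply pow2_ge_0 | exact Hlt].
Qed.

Lemma slope_uniform (k : R) (z : state) (a eps : R) : level k z -> 0 < a -> 0 < eps ->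
  exists d, 0 < d /\ forall s r, a <= s <= 2 * PI - a -> a <= r <= 2 * PI - a -> Rabs (r - s) < d ->
    Rabs (slope z r - slope z s) <= eps.
Proof.
  intros Hz Ha He.
  destruct (compact_uniform a (2 * PI - a) (fun s d => forall r, Rabs (r - s) < d -> Rabs (slope z r - slope z s) <= eps))
    as (d & Hd & H).
  - intros t d d' Hd H r Hr. apply H. lra.
  - intros s Hs. pose proof (proj2 adm_slope k z s Hz ltac:(lra)) as Hc.
    destruct (proj1 (continuous_eps _ _) Hc (eps / 2) ltac:(lra)) as (d & Hd & H).
    exists (d / 2), (d / 2). split; [lra|]. split; [lra|]. intros s' _ Hs' r Hr.
    assert (A1 : Rabs (r - s) < d).
    { replace (r - s) with ((r - s') + (s' - s)) by ring. eapply Rle_lt_trans; [apply Rabs_triang|]. lra. }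
    pose proof (H r A1) as B1. pose proof (H s' ltac:(lra)) as B2.
    apply Rabs_def2 in B1. apply Rabs_def2 in B2. apply Rabs_le_iff. lra.
  - exists d. split; [exact Hd|]. intros s r Hs Hr Hrs. apply (H s Hs r Hrs).
Qed.

(* Along a trajectory the profile [v_x o X] varies Lipschitz continuously in time in the supremum
   norm, so the moduli of continuity away from the peak are uniform on compact time intervals. *)
Lemma slope_equicontinuous (k C T1 : R) (y : R -> state) (a eps : R) :
  (forall t, 0 <= t <= T1 -> level k (y t)) -> 0 <= C ->
  (forall t u, 0 <= t <= T1 -> 0 <= u <= T1 -> near cdom (y u) (y t) (C * Rabs (u - t))) ->
  0 < a -> 0 < eps ->
  exists d, 0 < d /\ forall t, 0 <= t <= T1 -> forall s r, a <= s <= 2 * PI - a -> a <= r <= 2 * PI - a ->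
    Rabs (r - s) < d -> Rabs (slope (y t) r - slope (y t) s) <= eps.
Proof.
  intros Hlev HC Hlip Ha He.
  apply (compact_uniform 0 T1 (fun t d => forall s r, a <= s <= 2 * PI - a -> a <= r <= 2 * PI - a ->
    Rabs (r - s) < d -> Rabs (slope (y t) r - slope (y t) s) <= eps)).
  - intros t d d' Hd H s r Hs Hr Hrs. apply H; auto. lra.
  - intros t Ht. destruct (slope_uniform k (y t) a (eps / 2) (Hlev t Ht) Ha ltac:(lra)) as (d & Hd & H).
    destruct (proj1 adm_slope k) as (B & HB & _ & HBl).
    destruct (small_factor (B * C) (eps / 4) ltac:(nra) ltac:(lra)) as (e & He0 & Hee).
    exists e, d. split; [exact He0|]. split; [exact Hd|]. intros t' Ht' Htt s r Hs Hr Hrs.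
    specialize (H s r Hs Hr Hrs).
    pose proof (HBl _ _ _ s (Hlev t' Ht') (Hlev t Ht) (Hlip t t' Ht Ht') ltac:(lra)) as B1.
    pose proof (HBl _ _ _ r (Hlev t' Ht') (Hlev t Ht) (Hlip t t' Ht Ht') ltac:(lra)) as B2.
    assert (B * (C * Rabs (t' - t)) <= B * (C * e)) by (repeat apply Rmult_le_compat_l; lra).
    apply Rabs_le_iff in H. apply Rabs_le_iff in B1. apply Rabs_le_iff in B2. apply Rabs_le_iff. lra.
Qed.

Lemma eul_difference (k : R) (z w : state) : level k z -> level k w ->
  C10 (fun x => eul z x - eul w x) /\
  C10_norm_le (fun x => eul z x - eul w x) (2 * eul_bound k) /\
  forall x, off_peak x -> Derive (fun x => eul z x - eul w x) x = Derive (eul z) x - Derive (eul w) x.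
Proof.
  intros Hz Hw.
  assert (D : forall x, off_peak x -> Derive (fun x => eul z x - eul w x) x = Derive (eul z) x - Derive (eul w) x).
  { intros x Hx. apply (Derive_minus (eul z) (eul w)).
    - apply (C10_derivable _ (eul_C10 k z Hz) x Hx).
    - apply (C10_derivable _ (eul_C10 k w Hw) x Hx). }
  split; [|split; [|exact D]].
  - replace (fun x => eul z x - eul w x) with (per (fun x => Vc z (Sc z x) + (-1) * Vc w (Sc w x))).
    + eapply profile_C10, profile_lin; eapply eul_profile; eassumption.
    + apply functional_extensionality. intros x. unfold eul, per. ring.
  - destruct (eul_norm k z Hz) as [A1 A2]. destruct (eul_norm k w Hw) as [B1 B2].
    replace (2 * eul_bound k) with (eul_bound k + eul_bound k) by ring. split.
    + intros x. apply Rabs_plus_le; [apply A1 | rewrite Rabs_Ropp; apply B1].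
    + intros x Hx. rewrite D by exact Hx. apply Rabs_plus_le; [apply A2, Hx | rewrite Rabs_Ropp; apply B2, Hx].
Qed.

(** The difference of slopes is split at the label of [z]: changing the state costs a Lipschitz
    constant, changing the label costs the modulus of continuity of [y]. Only moduli of [y] enter,
    hence [d] serves all nearby [z]. *)
Lemma H1_dependence (k C T1 : R) (y : R -> state) (eps : R) :
  (forall t, 0 <= t <= T1 -> level k (y t)) -> 0 <= C ->
  (forall t u, 0 <= t <= T1 -> 0 <= u <= T1 -> near cdom (y u) (y t) (C * Rabs (u - t))) ->
  0 < k -> 0 < eps ->
  forall k', k <= k' ->
  exists d, 0 < d /\ forall t z, 0 <= t <= T1 -> level k' z -> near cdom z (y t) d ->
    H1_norm (fun x => eul z x - eul (y t) x) < eps.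
Proof.
  intros Hlev HC Hlip Hk He k' Hkk. pose proof PI_RGT_0 as HP.
  assert (Hlev' : forall t, 0 <= t <= T1 -> level k' (y t)).
  { intros t Ht. apply (vf_mono _ _ _ _ _ field_regular) with k; auto. }
  set (b := 2 * eul_bound k').
  destruct (small_factor (4 * b ^ 2) (eps ^ 2 / 4)) as (eta0 & He1 & He2).
  { pose proof (pow2_ge_0 b). lra. } { assert (0 < eps ^ 2) by (apply pow_lt, He). lra. }
  set (eta := Rmin eta0 (PI / 2)). assert (Heta : 0 < eta) by (apply Rmin_glb_lt; lra).
  assert (eta <= eta0) by apply Rmin_l. assert (eta <= PI / 2) by apply Rmin_r.
  (* The label map is [(1 + k')]-Lipschitz, so a point at distance [eta] from the peak has a label
     at distance at least [a] from the endpoints. *)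
  set (a := eta / (1 + k')). assert (Ha : 0 < a) by (apply Rdiv_lt_0_compat; lra).
  assert (Ea : (1 + k') * a = eta) by (unfold a; field; lra).
  destruct (slope_equicontinuous k' C T1 y a (eps / 16) Hlev' HC Hlip Ha ltac:(lra)) as (d1 & Hd1 & H1).
  destruct (proj1 adm_slope k') as (Bs & HBs & _ & HBl).
  set (M := k' * (k' * (2 * PI)) + (1 + 2 * PI)). assert (HM : 0 <= M) by (unfold M; nra).
  destruct (small_factor M (eps / 8) HM ltac:(lra)) as (d2 & Hd2 & H2).
  destruct (small_factor Bs (eps / 16) HBs ltac:(lra)) as (d3 & Hd3 & H3).
  destruct (small_factor (k' * (2 * PI)) d1 ltac:(nra) Hd1) as (d4 & Hd4 & H4).
  set (d := Rmin (Rmin d2 d3) d4). assert (Hd : 0 < d) by (repeat apply Rmin_glb_lt; auto).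
  exists d. split; [exact Hd|]. intros t z Ht Hz Hn.
  assert (D2 : d <= d2) by (eapply Rle_trans; [apply Rmin_l | apply Rmin_l]).
  assert (D3 : d <= d3) by (eapply Rle_trans; [apply Rmin_l | apply Rmin_r]).
  assert (D4 : d <= d4) by apply Rmin_r.
  pose proof (Hlev' t Ht) as Hy.
  destruct (eul_difference k' z (y t) Hz Hy) as (F1 & F2 & F3). fold b in F2.
  apply (H1_norm_small _ b eta eps F1 F2); auto; [lra| |].
  { apply Rle_lt_trans with (4 * b ^ 2 * eta0); [|exact He2].
    apply Rmult_le_compat_l; [pose proof (pow2_ge_0 b); lra | lra]. }
  assert (Away : forall w x, level k' w -> eta < x < 2 * PI - eta -> a <= Sc w x <= 2 * PI - a).
  { intros w x Hw Hx. destruct (Sc_spec k' w Hw x ltac:(lra)) as [G1 G2].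
    pose proof (Xc_upper k' w Hw (Sc w x) 0) as U1. pose proof (Xc_upper k' w Hw (2 * PI) (Sc w x)) as U2.
    rewrite G2, Xc_0, !Rminus_0_r, (Rabs_right (Sc w x)), (Rabs_right x) in U1 by lra.
    rewrite G2, (Xc_2PI w (level_nice k' w Hw)), (Rabs_right (2 * PI - x)), (Rabs_right (2 * PI - Sc w x)) in U2 by lra.
    assert ((1 + k') * a <= (1 + k') * Sc w x) by lra.
    assert ((1 + k') * a <= (1 + k') * (2 * PI - Sc w x)) by lra.
    split; [apply Rmult_le_reg_l with (1 + k'); lra|].
    assert (a <= 2 * PI - Sc w x) by (apply Rmult_le_reg_l with (1 + k'); lra). lra. }
  intros x Hx. split.
  - eapply Rle_trans; [apply (eul_near k' d x z (y t) Hz Hy Hn)|]. fold M.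
    assert (M * d <= M * d2) by (apply Rmult_le_compat_l; lra). lra.
  - assert (Hop : off_peak x) by (apply off_peak_open; lra).
    rewrite F3 by exact Hop. rewrite (eul_Derive k' z x Hz Hop), (eul_Derive k' (y t) x Hy Hop).
    rewrite frac_id by lra. pose proof (Away z x Hz Hx) as S1. pose proof (Away (y t) x Hy Hx) as S2.
    pose proof (HBl z (y t) d (Sc z x) Hz Hy Hn ltac:(lra)) as B1.
    pose proof (Sc_near k' d x z (y t) Hz Hy Hn ltac:(lra)) as B2.
    assert (k' * (d * (2 * PI)) <= k' * (2 * PI) * d4).
    { replace (k' * (d * (2 * PI))) with (k' * (2 * PI) * d) by ring. apply Rmult_le_compat_l; [nra | lra]. }
    pose proof (H1 t Ht (Sc (y t) x) (Sc z x) S2 S1 ltac:(lra)) as B3.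
    assert (Bs * d <= Bs * d3) by (apply Rmult_le_compat_l; lra).
    apply Rabs_le_iff in B1. apply Rabs_le_iff in B3. apply Rabs_le_iff. lra.
Qed.

(** * Maximal solutions and their dependence on the initial value *)

Definition maximal_from (z0 : state) (T : Rbar) (y : R -> state) : Prop :=
  Rbar_lt 0 T /\
  (forall T1, in_time T T1 -> exists k, traj cdom level field k T1 z0 y) /\
  (forall T1 k z, traj cdom level field k T1 z0 z -> Rbar_lt T1 T).

Lemma maximal_exists (v0 : R -> R) : C10 v0 -> exists T y, maximal_from (st v0) T y.
Proof.
  intros Hv. destruct (C10_norm_bound v0 Hv) as (k & Hk & Hn).
  apply (maximal_trajectory _ _ _ _ _ field_regular k). apply st_level; auto.
Qed.

(** Up to any time of its interval, a solution comes from a trajectory with the initial state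
    [st v0]. Maximality of [T] bounds that time, and uniqueness of trajectories identifies the
    states on [cdom], hence [X], [V] and [V o X^-1]. *)
Lemma maximal_solution (v0 : R -> R) (T : Rbar) (y : R -> state) :
  C10 v0 -> maximal_from (st v0) T y -> unique_maximal_solution v0 T (fun t => eul (y t)).
Proof.
  intros Hv (HT & Htr & Hmax). split; [exact HT|]. split; [apply eul_is_solution; auto|].
  intros T' u Hu.
  assert (key : forall t, in_time T' t -> in_time T t /\ forall x, u t x = eul (y t) x).
  { intros t Ht. destruct (Lagrangian_representation T' v0 u t Hu Ht) as (k & z & Hz & Huz).
    assert (Hin : in_time T t) by (split; [apply Ht | apply (Hmax t k z Hz)]).
    split; [exact Hin|]. destruct (Htr t Hin) as [l Hl].
    assert (Ht0 : 0 <= t) by apply Ht.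
    pose proof (fun i Hi => traj_unique _ _ _ _ _ field_regular _ _ _ _ _ _ Hz Hl t i ltac:(lra) Hi) as E.
    assert (Ly : level l (y t)) by (apply Hl; lra).
    intros x. rewrite (periodic_frac (u t) x) by apply (sol_C10 _ _ _ Hu t Ht).
    unfold eul, per. pose proof (frac_range x) as Hx.
    destruct (Sc_spec l (y t) Ly (frac x) ltac:(lra)) as [S1 S2]. set (s := Sc (y t) (frac x)) in *.
    assert (EX : Xc (z t) s = Xc (y t) s).
    { unfold Xc. f_equal. apply prim_ext. intros q Hq. apply E. exact Hq. }
    assert (EV : Vc (z t) s = Vc (y t) s).
    { unfold Vc. rewrite (E cV Logic.I). f_equal. apply prim_ext. intros q Hq. apply E. exact Hq. }
    rewrite <- S2, <- EX, Huz, EV by (auto; lra). reflexivity. }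
  split; [|intros t x Ht; apply key, Ht].
  (* If [T] were smaller, it would be a finite time of the other solution, and [key] at this time
     would give [T < T]. *)
  destruct (Rbar_le_lt_dec T' T) as [h|h]; [exact h|exfalso].
  destruct T as [r| |]; [|simpl in h; destruct T'; contradiction | simpl in HT; contradiction].
  simpl in HT. assert (Hr : in_time T' r) by (split; [lra | exact h]).
  destruct (key r Hr) as [[_ Hlt] _]. simpl in Hlt. lra.
Qed.

Lemma C1_time_ext (T : Rbar) (g h : R -> R -> R) :
  (forall t, in_time T t -> g t = h t) -> C1_time_C10 T g -> C1_time_C10 T h.
Proof.
  intros E (g' & H1 & H2 & H3). exists g'. split; [|split; [|exact H3]].
  - intros t Ht. rewrite <- E by exact Ht. apply H1, Ht.
  - intros t Ht eps He. destruct (H2 t Ht eps He) as (d & Hd & H). exists d. split; [exact Hd|].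
    intros u Hu Hut. rewrite <- !E by assumption. apply H; assumption.
Qed.

Lemma maximal_C1_along (v0 : R -> R) (T : Rbar) (y : R -> state) :
  maximal_from (st v0) T y -> C1_time_C10_along T (fun t => eul (y t)) (flow y).
Proof.
  intros (HT & Htr & _). split; [|split].
  - apply (flow_is_flow T (st v0)); [exact Htr | reflexivity | split; [lra | exact HT]].
  - apply C1_time_ext with (fun t => per (lag 0 cJ (y t))).
    + intros t _. apply functional_extensionality. intros s. unfold flow. ring.
    + apply (lag_C1 T (st v0) y Htr 0 cJ profile_coord_J). rewrite Rabs_R0. lra.
  - apply C1_time_ext with (fun t => per (lag 1 cK (y t))).
    + intros t Ht. destruct (traj_level T (st v0) y Htr t Ht) as [k Hk].
      apply functional_extensionality. intros s. symmetry. apply (eul_flow k), Hk.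
    + apply (lag_C1 T (st v0) y Htr 1 cK profile_coord_K). rewrite Rabs_R1. lra.
Qed.

Lemma st_near (u0 v0 : R -> R) (d : R) : C10 u0 -> C10 v0 ->
  C10_norm_le (fun x => u0 x - v0 x) d -> near cdom (st u0) (st v0) d.
Proof.
  intros Hu Hv [H1 H2].
  assert (Hd : 0 <= d) by (eapply Rle_trans; [apply Rabs_pos | apply (H1 0)]).
  intros [s|s|] Hi; simpl.
  - rewrite Rminus_diag, Rabs_R0. exact Hd.
  - rewrite <- (Derive_minus u0 v0).
    + apply H2, off_peak_open, Hi.
    + apply (C10_derivable _ Hu), off_peak_open, Hi.
    + apply (C10_derivable _ Hv), off_peak_open, Hi.
  - apply H1.
Qed.

Lemma lag_difference (th d : R) (c : R -> coord) (z w : state) (f : R -> R) :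
  profile_coord c -> Rabs th <= 1 -> nice z -> nice w -> near cdom z w d ->
  (forall x, f x = per (lag th c z) x - per (lag th c w) x) -> C10_norm_le f ((1 + 2 * PI) * d).
Proof.
  intros Hc Hth Hz Hw Hn Hf.
  replace f with (per (lag th c (fun i => z i + -1 * w i))).
  - apply lag_norm; auto; [apply nice_lin; auto|].
    intros i Hi. replace (z i + -1 * w i) with (z i - w i) by ring. apply Hn, Hi.
  - apply functional_extensionality. intros x. rewrite Hf. unfold per. rewrite lag_lin by auto. ring.
Qed.

Theorem lemma4p2 :
  forall v0 : R -> R, C10 v0 ->
  exists (T : Rbar) (v X : R -> R -> R),
    unique_maximal_solution v0 T v /\
    C1_time_C10_along T v X /\
    (forall T1, in_time T T1 -> forall eps, 0 < eps ->
       exists delta, 0 < delta /\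
       forall u0, C10 u0 -> C10_norm_le (fun x => u0 x - v0 x) delta ->
       exists (S : Rbar) (u Y : R -> R -> R),
         unique_maximal_solution u0 S u /\
         C1_time_C10_along S u Y /\
         Rbar_lt T1 S /\
         forall t, 0 <= t <= T1 ->
           H1_norm (fun x => u t x - v t x) < eps /\
           C10_norm_le (fun s => Y t s - X t s) eps /\
           C10_norm_le (fun s => u t (Y t s) - v t (X t s)) eps).
Proof.
  intros v0 Hv. destruct (maximal_exists v0 Hv) as (T & y & Hy).
  exists T, (fun t => eul (y t)), (flow y).
  split; [apply maximal_solution; auto|]. split; [apply (maximal_C1_along v0), Hy|].
  intros T1 HT1 eps He. destruct Hy as (_ & Htr & _).
  destruct (Htr T1 HT1) as [k Hk].
  destruct (traj_lip _ _ _ _ _ field_regular _ _ _ _ Hk) as (C & HC & Hlip).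
  assert (Hlev : forall t, 0 <= t <= T1 -> level k (y t)) by apply Hk.
  assert (HT1' : 0 <= T1) by apply HT1. pose proof PI_RGT_0 as HP.
  assert (Hk0 : 0 < k) by (apply (level_pos k (y 0)), Hlev; lra).
  (* The level [k'] is fixed before any closeness is requested, so [d1] can be chosen for it and
     then passed back to [Hdep]. *)
  destruct (continuous_dependence _ _ _ _ _ field_regular k T1 (st v0) y Hk) as (k' & Hkk & Hdep).
  destruct (H1_dependence k C T1 y eps Hlev HC Hlip Hk0 He k' Hkk) as (d1 & Hd1 & HH1).
  destruct (small_factor (1 + 2 * PI) eps ltac:(lra) He) as (d2 & Hd2 & Hd2e).
  destruct (Hdep (Rmin d1 d2)) as (delta & Hdelta & Hz); [apply Rmin_glb_lt; auto|].
  exists delta. split; [exact Hdelta|]. intros u0 Hu0 Hn0.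
  destruct (maximal_exists u0 Hu0) as (S & z & Hmz).
  destruct (Hz (st u0)) as (z' & Hz' & Hzn); [apply st_nice; auto | apply st_near; auto |].
  exists S, (fun t => eul (z t)), (flow z).
  split; [apply maximal_solution; auto|]. split; [apply (maximal_C1_along u0), Hmz|].
  destruct Hmz as (_ & Htrz & Hmaxz).
  assert (HS : Rbar_lt T1 S) by (apply (Hmaxz T1 k' z' Hz')). split; [exact HS|].
  intros t Ht. destruct (Htrz T1 (conj HT1' HS)) as [l Hl].
  (* [z] is the maximal trajectory and [z'] the one supplied by continuous dependence; they agree on
     [cdom] up to [T1], so the estimates for [z'] transfer to [z]. *)
  pose proof (fun i Hi => traj_unique _ _ _ _ _ field_regular _ _ _ _ _ _ Hl Hz' t i Ht Hi) as E.
  assert (Lz : level k' (z t)) by (apply level_ext with (z' t); [exact E | apply Hz', Ht]).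
  assert (Ly : level k' (y t)).
  { apply (vf_mono _ _ _ _ _ field_regular) with k; auto. }
  assert (Hn : near cdom (z t) (y t) (Rmin d1 d2)).
  { intros i Hi. rewrite E by exact Hi. apply (Hzn t Ht i Hi). }
  assert (Hn2 : near cdom (z t) (y t) d2).
  { intros i Hi. eapply Rle_trans; [apply (Hn i Hi) | apply Rmin_r]. }
  assert (Mono : forall f, C10_norm_le f ((1 + 2 * PI) * d2) -> C10_norm_le f eps).
  { intros f [A1 A2]. split; intros x; [specialize (A1 x) | intros Hx; specialize (A2 x Hx)]; lra. }
  pose proof (level_nice k' _ Lz) as Nz. pose proof (level_nice k' _ Ly) as Ny.
  split; [|split].
  - apply HH1; auto. intros i Hi. eapply Rle_trans; [apply (Hn i Hi) | apply Rmin_l].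
  - apply Mono. apply (lag_difference 0 d2 cJ (z t) (y t)); auto using profile_coord_J.
    + rewrite Rabs_R0. lra.
    + intros s. unfold flow. ring.
  - apply Mono. apply (lag_difference 1 d2 cK (z t) (y t)); auto using profile_coord_K.
    + rewrite Rabs_R1. lra.
    + intros s. rewrite (eul_flow k' z), (eul_flow k' y) by assumption. reflexivity.
Qed.
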